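(* Let $p$ be an odd prime and let $\mu$ be a symmetric probability measure on $\mathrm{SL}_2 (\mathbb{F}_p)$ such that for a parameter $K\ge 1$: (i) $\mu (g \Gamma) \le K^{-1}$ for every proper subgroup $\Gamma\subset \mathrm{SL}_2 (\mathbb{F}_p)$ and every $g\in \mathrm{SL}_2 (\mathbb{F}_p)$, and (ii) $\| \mu \|_\infty \le K^{-1}$. Then for any integer $k \le K^{c_*}$, $$0\le \| \mu *_{2^k} \mu \|^2_2 - |\mathrm{SL}_2 (\mathbb{F}_p)|^{-1} \le C^k_* K^{-c_* k},$$ where $c_* \in (0,1)$ and $C_* >1$ are absolute constants.
   Context: $\mu$ is a function $\mathrm{SL}_2(\mathbb{F}_p)\to[0,1]$ with $\sum_g\mu(g)=1$; symmetric means $\mu(g)=\mu(g^{-1})$; $\mu(S)=\sum_{g\in S}\mu(g)$. Convolution on the group: $(\mu*\nu)(x)=\sum_{y}\mu(y)\nu(y^{-1}x)$. $\mu *_{n}\mu$ denotes the $n$-fold convolution $\mu*\mu*\cdots*\mu$ ($n$ copies of $\mu$). $\|\mu\|_2^2=\sum_g\mu(g)^2$, $\|\mu\|_\infty=\max_g\mu(g)$. *)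

(* Defs.v *)
From HB Require Import structures.
From mathcomp Require Import all_boot all_order all_algebra all_fingroup.
From mathcomp Require Import reals exp.

Set Implicit Arguments.
Unset Strict Implicit.
Unset Printing Implicit Defensive.

Import Order.TTheory GRing.Theory Num.Theory GroupScope.
Local Open Scope ring_scope.

Definition SL2_set (p : nat) : {set {'GL_2(p)}} := [set g | \det (GLval g) == 1].

Lemma SL2_group_set (p : nat) : group_set (SL2_set p).
Proof.
apply/group_setP; split => [|x y]; first by rewrite inE GL_1E det1.
by rewrite !inE GL_MxE det_mulmx => /eqP -> /eqP ->; rewrite mulr1.
Qed.

Canonical SL2_group (p : nat) : {group {'GL_2(p)}} := Group (SL2_group_set p).

(* 'F_p is the field with p elements only when p is prime. *)
Notation SL2 p := [subg SL2_group p]%type.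

Section FiniteGroupMeasures.
Variables (R : realType) (gT : finGroupType).
Implicit Types (mu nu : gT -> R).

Definition is_prob mu : Prop :=
  (forall g, 0 <= mu g <= 1) /\ \sum_g mu g = 1.

Definition symmetric_measure mu : Prop := forall g, mu g = mu g^-1%g.

Definition measure_of mu (S : {set gT}) : R := \sum_(g in S) mu g.

Definition conv mu nu : gT -> R := fun x => \sum_y mu y * nu (y^-1 * x)%g.

(* mu * ... * mu with n copies of mu, meaningful for n > 0 only. *)
Definition conv_pow mu (n : nat) : gT -> R := iter n.-1 (conv mu) mu.

Definition l2norm_sq mu : R := \sum_g mu g ^+ 2.

(* The value at the identity is only the seed of the maximum. *)
Definition linfnorm mu : R := \big[Num.max/mu 1%g]_g mu g.

End FiniteGroupMeasures.

(* Main.v *)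
Require Import Defs.
From HB Require Import structures.
From mathcomp Require Import all_boot all_order all_algebra all_fingroup.
From mathcomp Require Import reals exp.
From mathcomp Require Import complex ring lra zify.
Import Order.TTheory GRing.Theory Num.Theory.
Local Open Scope ring_scope.

(** Write f_k for the 2^k-fold convolution of mu, so that f_(k+1) = f_k * f_k, and let M be
    a small power of K.  Either each doubling divides the deviation |f_k|_2^2 - 1/|G| by M,
    or f_k is already nearly flat.

    If |f * f|_2^2 >= |f|_2^2 / M, the Balog-Szemeredi-Gowers argument (dependent random
    choice in the graph of popular quotients, followed by the passage to popular correlations)
    produces a symmetric set A of size about 1/|f|_2^2 with |A^12| <= M^O(1) |A| whose
    translate carries mu-mass M^-O(1).  Since mu gives mass at most 1/K to cosets of proper
    subgroups, the restriction of mu to that translate is a measure which escapes any bounded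
    number of such cosets; this replaces the usual escape from subvarieties.

    Growth in SL_2 then follows Larsen-Pink and Helfgott.  For a conjugacy class of trace
    t <> 0 the map (x, y, z) -> (x y, y z) has fibres of size at most 2 outside an explicit
    degenerate locus, because inverting y is affine on the class and the fibre is the
    intersection of a line with a quadric.  Hence a class meets A^5 in at most
    M^O(1) |A|^(2/3) points, and every maximal torus containing a regular element of A^3
    meets A^2 in at least M^-O(1) |A|^(1/3) points.  Conjugation by A preserves this family
    of tori unless |A| <= M^O(1); as A generates, all conjugates of one torus occur, and
    counting gives |A| >= M^-O(1) |G|.

    In this last case |f|_2^2 <= M^O(1) / |G| and quasirandomness takes over: for f of mean
    zero, |f * f|_2^2 <= (9 |G| / p) |f|_2^4.  The components of f on which the unipotent
    subgroup acts through a nontrivial character are moved by the diagonal torus to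
    (p - 1) / 2 orthogonal ones, so Bessel's inequality bounds their contribution, and the
    invariant vectors of the two opposite unipotent subgroups are almost orthogonal. *)

Set Implicit Arguments.
Unset Strict Implicit.
Unset Printing Implicit Defensive.

(** * Convolution *)

(** Lagrange's identity: the double sum of [(a i * b j - a j * b i) ^+ 2] is twice the defect.
    Realness is a hypothesis so that the inequality also applies to absolute values in a closed
    field. *)
Lemma cauchy_schwarz_real (R : numDomainType) (I : finType) (P : pred I) (a b : I -> R) :
  (forall i, a i \is Num.real) -> (forall i, b i \is Num.real) ->
  (\sum_(i | P i) a i * b i) ^+ 2 <=
  (\sum_(i | P i) a i ^+ 2) * (\sum_(i | P i) b i ^+ 2).
Proof.
move=> ra rb.
have H : 0 <= \sum_(i | P i) \sum_(j | P j) (a i * b j - a j * b i) ^+ 2.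
  apply: sumr_ge0 => i _; apply: sumr_ge0 => j _.
  by apply: real_exprn_even_ge0 => //; rewrite rpredB ?rpredM.
have E : \sum_(i | P i) \sum_(j | P j) (a i * b j - a j * b i) ^+ 2 =
  ((\sum_(i | P i) a i ^+ 2) * (\sum_(i | P i) b i ^+ 2)
    - (\sum_(i | P i) a i * b i) ^+ 2) *+ 2.
  have e1 : (\sum_(i | P i) a i ^+ 2) * (\sum_(i | P i) b i ^+ 2) =
    \sum_(i | P i) \sum_(j | P j) a i ^+ 2 * b j ^+ 2 by rewrite big_distrlr.
  have e2 : (\sum_(i | P i) a i ^+ 2) * (\sum_(i | P i) b i ^+ 2) =
    \sum_(i | P i) \sum_(j | P j) a j ^+ 2 * b i ^+ 2.
    by rewrite e1 exchange_big.
  have e3 : (\sum_(i | P i) a i * b i) ^+ 2 =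
    \sum_(i | P i) \sum_(j | P j) (a i * b i) * (a j * b j).
    by rewrite expr2 big_distrlr.
  rewrite mulrnBl mulr2n {1}e1 e2 e3 -big_split -sumrMnl -sumrB.
  apply: eq_bigr => i _; rewrite -big_split -sumrMnl -sumrB.
  by apply: eq_bigr => j _ /=; ring.
by move: H; rewrite E pmulrn_lge0 // subr_ge0.
Qed.

Lemma cauchy_schwarz (R : realDomainType) (I : finType) (P : pred I) (a b : I -> R) :
  (\sum_(i | P i) a i * b i) ^+ 2 <=
  (\sum_(i | P i) a i ^+ 2) * (\sum_(i | P i) b i ^+ 2).
Proof. by apply: cauchy_schwarz_real => i; apply: num_real. Qed.

Lemma sqr_sum_le_card (R : realDomainType) (I : finType) (P : pred I) (a : I -> R) :
  (\sum_(i | P i) a i) ^+ 2 <= #|P|%:R * \sum_(i | P i) a i ^+ 2.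
Proof.
have := @cauchy_schwarz R I P (fun=> 1) a.
under eq_bigr do rewrite mul1r.
by under [X in _ <= X * _]eq_bigr do rewrite expr1n; rewrite sumr_const.
Qed.

Section Convolution.
Variables (R : realType) (gT : finGroupType).
Implicit Types (f h : gT -> R) (x y : gT).

Lemma sum_translate (V : nmodType) (F : gT -> V) x : \sum_y F (x * y)%g = \sum_y F y.
Proof. by rewrite [RHS](reindex_inj (mulgI x)). Qed.

Lemma sum_translater (V : nmodType) (F : gT -> V) x : \sum_y F (y * x)%g = \sum_y F y.
Proof. by rewrite [RHS](reindex_inj (mulIg x)). Qed.

Lemma sum_inv (V : nmodType) (F : gT -> V) : \sum_y F y^-1%g = \sum_y F y.
Proof. by rewrite [RHS](reindex_inj invg_inj). Qed.

Lemma sum_conv f h : \sum_x conv f h x = (\sum_x f x) * (\sum_x h x).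
Proof.
rewrite exchange_big /= mulr_suml; apply: eq_bigr => y _.
by rewrite -mulr_sumr (sum_translate h).
Qed.

(** At a quotient, a convolution is a sum over the midpoints [x] of two-step paths from [a] to [b];
    this links convolutions with paths in the graph of popular quotients. *)
Lemma convE f h a b : conv f h (a * b^-1)%g = \sum_x f (a * x^-1)%g * h (x * b^-1)%g.
Proof.
rewrite /conv -(sum_inv (fun y => _ * _)) -(sum_translater _ a^-1%g).
apply: eq_bigr => x _; rewrite !invMg !invgK; congr (_ * h _).
by rewrite mulgA mulgKV.
Qed.

Lemma eq_conv f f' h h' : f =1 f' -> h =1 h' -> conv f h =1 conv f' h'.
Proof. by move=> ef eh x; apply: eq_bigr => y _; rewrite ef eh. Qed.

Lemma convA f h k : conv f (conv h k) =1 conv (conv f h) k.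
Proof.
move=> x; rewrite /conv; under eq_bigr do rewrite mulr_sumr.
under [RHS]eq_bigr do rewrite mulr_suml.
rewrite [RHS]exchange_big /=; apply: eq_bigr => y _.
rewrite [RHS](reindex_inj (mulgI y)) /=; apply: eq_bigr => z _.
by rewrite mulKg invMg -!mulgA mulrA.
Qed.

Lemma conv_ge0 f h : (forall x, 0 <= f x) -> (forall x, 0 <= h x) ->
  forall x, 0 <= conv f h x.
Proof. by move=> f0 h0 x; apply: sumr_ge0 => y _; rewrite mulr_ge0. Qed.

Lemma symmetric_conv f : symmetric_measure f -> symmetric_measure (conv f f).
Proof.
move=> sf x; rewrite /conv [LHS](reindex_inj (mulgI x)) /=.
apply: eq_bigr => y _.
by rewrite mulrC !invMg mulgKV -(sf y) [f (x * y)%g]sf invMg.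
Qed.

Lemma is_prob_conv f h : is_prob f -> is_prob h -> is_prob (conv f h).
Proof.
move=> [f01 sf] [h01 sh].
have pos : forall x, 0 <= conv f h x.
  by apply: conv_ge0 => x; [case/andP: (f01 x) | case/andP: (h01 x)].
have tot : \sum_x conv f h x = 1 by rewrite sum_conv sf sh mulr1.
split=> // x; rewrite pos /= -tot (bigD1 x) //= lerDl.
by apply: sumr_ge0.
Qed.

Lemma conv_powD f m n : (0 < m)%N -> (0 < n)%N ->
  conv_pow f (m + n) =1 conv (conv_pow f m) (conv_pow f n).
Proof.
case: m => // m _; elim: m => [|m IH] n0; first by case: n n0.
move=> x; change (conv f (conv_pow f (m.+1 + n)) x =
  conv (conv f (conv_pow f m.+1)) (conv_pow f n) x).
by rewrite (eq_conv (frefl f) (IH n0)) convA.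
Qed.

Fixpoint conv_dbl f (k : nat) : gT -> R :=
  if k is k'.+1 then conv (conv_dbl f k') (conv_dbl f k') else f.

Lemma conv_pow_dbl f k : conv_pow f (2 ^ k) =1 conv_dbl f k.
Proof.
elim: k => [|k IH] x //=.
by rewrite expnS mul2n -addnn conv_powD ?expn_gt0 //; apply: eq_conv.
Qed.

Lemma conv_dbl_prob f k : is_prob f -> is_prob (conv_dbl f k).
Proof. by move=> pf; elim: k => //= k IH; apply: is_prob_conv. Qed.

Lemma conv_dbl_symmetric f k : symmetric_measure f -> symmetric_measure (conv_dbl f k).
Proof. by move=> sf; elim: k => //= k IH; apply: symmetric_conv. Qed.

(** The weights may total less than 1, since truncated measures occur as weights; [0 < t] then
    excludes the case where all weights vanish. *)
Lemma exists_ge_average (I : finType) (w F : I -> R) (P : pred I) (t : R) :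
  (forall i, 0 <= w i) -> \sum_(i | P i) w i <= 1 -> 0 < t ->
  t <= \sum_(i | P i) w i * F i -> exists2 i, P i & t <= F i.
Proof.
move=> w0 w1 t0 H; case: (pickP (fun i => P i && (t <= F i))) => [i /andP[]|no].
  by exists i.
have lt i : P i -> F i < t by move=> Pi; have := no i; rewrite Pi /= ltNge => ->.
have : \sum_(i | P i) w i * F i <= \sum_(i | P i) w i * t.
  by apply: ler_sum => i Pi; rewrite ler_wpM2l // ltW // lt.
rewrite -mulr_suml => H2.
have e1 : \sum_(i | P i) w i * F i = t.
  apply/eqP; rewrite eq_le H andbT (le_trans H2) //.
  by rewrite ler_piMl // ltW.
have [/existsP[i /andP[Pi wi]]|/existsPn nw] := boolP [exists i, P i && (0 < w i)].
  suff : \sum_(i | P i) w i * F i < (\sum_(i | P i) w i) * t.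
    by rewrite e1 => /lt_le_trans - /(_ t); rewrite ltxx ler_piMl // ?ltW // => /(_ isT).
  rewrite mulr_suml (bigD1 i) //= [ltRHS](bigD1 i) //= ltr_leD //.
    by rewrite ltr_pM2l // lt.
  by apply: ler_sum => j /andP[Pj _]; rewrite ler_wpM2l // ltW // lt.
move: e1; rewrite big1 => [e0|i Pi]; first by move: t0; rewrite -e0 ltxx.
have /negP := nw i; rewrite Pi /= => /negP; rewrite -leNgt => w_le0.
have -> : w i = 0 by apply/eqP; rewrite eq_le w_le0 w0.
by rewrite mul0r.
Qed.

(** The mass of [X] under [conv f h] is the [h]-average of the [f]-masses of the right translates of
    [X]. *)
Lemma measure_conv_translate f h (X : {set gT}) :
  (forall x, 0 <= f x) -> is_prob h -> 0 < measure_of (conv f h) X ->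
  exists z, measure_of (conv f h) X <= measure_of f (X :* z)%g.
Proof.
move=> f0 [h01 sh] pos.
have e : measure_of (conv f h) X = \sum_z h z * measure_of f (X :* z^-1)%g.
  rewrite /measure_of /conv exchange_big /=.
  under [RHS]eq_bigr do rewrite mulr_sumr big_mkcond /=.
  rewrite [RHS]exchange_big; apply: eq_bigr => y _.
  rewrite big_mkcond [LHS](reindex_inj (mulgI y)) /=; apply: eq_bigr => z _.
  by rewrite mem_rcoset invgK mulKg mulrC.
rewrite e; rewrite e in pos.
have [z _ Hz] := @exists_ge_average gT h (fun z => measure_of f (X :* z^-1)%g) predT _
  (fun z => proj1 (andP (h01 z))) (eq_ind_r (fun t => t <= 1) (lexx 1) sh) pos (lexx _).
by exists z^-1%g.
Qed.

(** This returns from a convolution power to the original measure, the one for which coset bounds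
    are assumed. *)
Lemma conv_dbl_translate f k (X : {set gT}) : is_prob f ->
  0 < measure_of (conv_dbl f k) X ->
  exists z, measure_of (conv_dbl f k) X <= measure_of f (X :* z)%g.
Proof.
move=> pf; elim: k X => [|k IH] X pos; first by exists 1%g; rewrite rcoset1.
have pk := conv_dbl_prob k pf.
have [z Hz] := measure_conv_translate (fun x => proj1 (andP (proj1 pk x))) pk pos.
have [y Hy] := IH _ (lt_le_trans pos Hz).
by exists (z * y)%g; rewrite rcosetM; apply: le_trans Hz Hy.
Qed.

End Convolution.

(** * Balog-Szemeredi-Gowers *)

(** [A] is the neighbourhood of a well-chosen vertex [v], minus the vertices with many bad partners
    in it; a pair is bad if it has few common neighbours, and so rarely falls into one
    neighbourhood. Two elements of [A] share many [c] that are good for both, whence many paths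
    a-x-c-y-b. *)
Lemma dependent_random_choice (R : realType) (T : finType) (w : T -> R) (e : rel T) (d : R) :
  (forall x, 0 <= w x) -> \sum_x w x <= 1 -> symmetric e -> 0 < d ->
  d <= \sum_x w x * \sum_y (e x y)%:R * w y ->
  exists A : {set T}, d / 4 <= \sum_(a in A) w a /\
    forall a b, a \in A -> b \in A ->
      d ^+ 5 / 4096 <= \sum_c w c * ((\sum_x (e a x && e x c)%:R * w x) *
                                     (\sum_y (e c y && e y b)%:R * w y)).
Proof.
move=> w0 w1 esym d0 dens.
pose deg v : R := \sum_a (e v a)%:R * w a.
pose cd a b : R := \sum_x (e a x && e x b)%:R * w x.
have cd_sym a b : cd a b = cd b a.
  by apply: eq_bigr => x _; rewrite andbC esym [e a x]esym.
have cd_ge0 a b : 0 <= cd a b by apply: sumr_ge0 => x _; rewrite mulr_ge0.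
(* With this threshold, [16 * t] is half of [d ^+ 2], the lower bound for the mean of
   [deg v ^+ 2]. *)
pose t := d ^+ 2 / 32.
have t0 : 0 < t by rewrite divr_gt0 ?exprn_gt0.
pose bad a b := cd a b < t.
pose bdeg v a : R := \sum_b (e v b && bad a b)%:R * w b.
pose badv v : R := \sum_a (e v a)%:R * w a * bdeg v a.
have deg2 : d ^+ 2 <= \sum_v w v * deg v ^+ 2.
  have h : 0 <= \sum_v w v * (deg v - d) ^+ 2.
    by apply: sumr_ge0 => v _; rewrite mulr_ge0 ?sqr_ge0.
  have E : \sum_v w v * (deg v - d) ^+ 2 =
      \sum_v w v * deg v ^+ 2 - 2 * d * (\sum_v w v * deg v) + d ^+ 2 * \sum_v w v.
    rewrite !mulr_sumr -sumrN -!big_split /=; apply: eq_bigr => v _; ring.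
  have h1 : d * d <= d * (\sum_v w v * deg v) by rewrite ler_pM2l.
  have h2 : d ^+ 2 * \sum_v w v <= d ^+ 2 by rewrite ler_piMr ?sqr_ge0.
  by move: h; rewrite E; lra.
have badsum : \sum_v w v * badv v <= t.
  have -> : \sum_v w v * badv v =
      \sum_a w a * \sum_b w b * ((bad a b)%:R * cd a b).
    rewrite /badv /bdeg.
    under eq_bigr do rewrite mulr_sumr; rewrite exchange_big; apply: eq_bigr => a _ /=.
    under eq_bigr do rewrite !mulr_sumr.
    rewrite mulr_sumr exchange_big; apply: eq_bigr => b _ /=.
    rewrite !mulr_sumr; apply: eq_bigr => v _.
    rewrite [e v a]esym.
    by case: (e a v); case: (e v b); case: (bad a b) => /=; ring.
  apply: (@le_trans _ _ (\sum_a w a * \sum_b w b * t)).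
    apply: ler_sum => a _; apply: ler_wpM2l => //.
    apply: ler_sum => b _; apply: ler_wpM2l => //.
    by rewrite /bad; case: ltP => [/ltW|_]; rewrite ?mul1r ?mul0r // ltW.
  rewrite -!mulr_suml -[X in _ <= X]mul1r.
  apply: le_trans (_ : (\sum_b w b) * t <= _); last by rewrite ler_wpM2r // ltW.
  by rewrite ler_piMl // mulr_ge0 ?sumr_ge0 // ltW.
have [||v _ Hv] := @exists_ge_average R T w (fun v => deg v ^+ 2 - 16 * badv v) predT
    (d ^+ 2 / 2) w0 w1.
- by rewrite divr_gt0 ?exprn_gt0.
- have -> : \sum_v w v * (deg v ^+ 2 - 16 * badv v) =
     \sum_v w v * deg v ^+ 2 - 16 * \sum_v w v * badv v.
    by rewrite mulr_sumr -sumrN -big_split /=; apply: eq_bigr => v _; ring.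
  by move: deg2 badsum; rewrite /t; lra.
have degv0 : 0 <= deg v by apply: sumr_ge0 => a _; rewrite mulr_ge0.
have badv0 : 0 <= badv v.
  apply: sumr_ge0 => a _; rewrite mulr_ge0 ?mulr_ge0 //.
  by apply: sumr_ge0 => b _; rewrite mulr_ge0.
have degv : d / 2 <= deg v.
  have h : d ^+ 2 / 4 <= deg v ^+ 2 by have := sqr_ge0 d; move: Hv badv0 => /=; lra.
  rewrite leNgt; apply/negP => lt.
  by move: h degv0 lt d0; rewrite !expr2; nra.
have badv_le : badv v <= deg v ^+ 2 / 16 by have := sqr_ge0 d; move: Hv => /=; lra.
exists [set a | e v a && (bdeg v a <= deg v / 4)]; split.
  set A := [set a | _].
  have sp : deg v = \sum_(a in A) w a + \sum_(a | e v a && (a \notin A)) w a.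
    rewrite /deg (bigID (mem A)) /=; congr (_ + _).
      by apply: eq_bigr => a; rewrite inE => /andP[-> _]; rewrite mul1r.
    rewrite [RHS]big_mkcond [LHS]big_mkcond; apply: eq_bigr => a _ /=.
    by case: (a \in A); case: (e v a); rewrite ?mul1r ?mul0r.
  have : (\sum_(a | e v a && (a \notin A)) w a) * (deg v / 4) <= badv v.
    rewrite mulr_suml /badv [leRHS](bigID (fun a => e v a && (a \notin A))) /=.
    rewrite -[leLHS]addr0 lerD //.
      apply: ler_sum => a /andP[eva]; rewrite inE eva /= -ltNge => /ltW h.
      by rewrite mul1r ler_wpM2l.
    apply: sumr_ge0 => a _; rewrite mulr_ge0 ?mulr_ge0 //.
    by apply: sumr_ge0 => b _; rewrite mulr_ge0.
  set r := \sum_(a | _) _ => hr.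
  have : r <= deg v / 4.
    rewrite -(@ler_pM2r _ (deg v / 4)); last by rewrite divr_gt0 // (lt_le_trans _ degv) ?divr_gt0.
    by move: hr badv_le; rewrite expr2; lra.
  by move: sp; rewrite -/r; lra.
move=> a b; rewrite !inE => /andP[eva ha] /andP[evb hb].
(* Only the neighbours [c] of [v] that are bad with neither [a] nor [b] are kept: they weigh at
   least [deg v / 2], and each contributes at least [t ^+ 2]. *)
apply: (@le_trans _ _ (t ^+ 2 * (deg v / 2))).
  have -> : d ^+ 5 / 4096 = t ^+ 2 * (d / 4) by rewrite /t; field.
  by rewrite ler_wpM2l ?sqr_ge0 //; lra.
apply: (@le_trans _ _ (t ^+ 2 * (deg v - bdeg v a - bdeg v b))).
  by rewrite ler_wpM2l ?sqr_ge0 //; lra.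
rewrite /deg /bdeg -!sumrB mulr_sumr; apply: ler_sum => c _.
rewrite -/(cd a c) -/(cd c b).
have tt : t ^+ 2 = t * t by rewrite expr2.
have [bac|gac] := boolP (bad a c).
  apply: le_trans (_ : 0 <= _); last by rewrite !mulr_ge0.
  rewrite andbT mulr_ge0_le0 ?sqr_ge0 // subrr add0r oppr_le0.
  by rewrite mulr_ge0.
have [bbc|gbc] := boolP (bad b c).
  apply: le_trans (_ : 0 <= _); last by rewrite !mulr_ge0.
  rewrite andbT andbF mul0r subr0 mulr_ge0_le0 ?sqr_ge0 // subrr //.
rewrite !andbF !mul0r !subr0.
have -> : t ^+ 2 * ((e v c)%:R * w c) = w c * ((e v c)%:R * t ^+ 2) by ring.
apply: ler_wpM2l => //.
apply: le_trans (_ : t ^+ 2 <= _).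
  by case: (e v c); rewrite ?mul1r ?mul0r ?sqr_ge0.
rewrite expr2; apply: ler_pM; rewrite ?(ltW t0) // leNgt //.
by rewrite cd_sym.
Qed.

Section BalogSzemerediGowers.
Variables (R : realType) (gT : finGroupType).
Implicit Types (f w : gT -> R) (M : R).

Lemma l2norm_sq_gt0 f : is_prob f -> 0 < l2norm_sq f.
Proof.
move=> [_ sf].
have := @sqr_sum_le_card R gT predT f; rewrite sf expr1n => h.
rewrite lt_neqAle sumr_ge0 ?andbT => [|x _]; last exact: sqr_ge0.
apply/negP => /eqP e0; move: h; rewrite -/(l2norm_sq f) -e0 mulr0.
by rewrite ler10.
Qed.

Lemma conv_sym_le_l2 f x : conv f f x <= l2norm_sq f.
Proof.
have h : conv f f x <= \sum_y (f y ^+ 2 + f (y^-1 * x)%g ^+ 2) / 2.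
  by apply: ler_sum => y _; have := sqr_ge0 (f y - f (y^-1 * x)%g); rewrite sqrrB; lra.
apply: le_trans h _; rewrite -mulr_suml big_split /=.
rewrite -[\sum_i f (i^-1 * x)%g ^+ 2](sum_inv (fun i => f (i^-1 * x)%g ^+ 2)).
under [X in _ + X]eq_bigr do rewrite invgK.
by rewrite (sum_translater (fun y => f y ^+ 2)) -/(l2norm_sq f); lra.
Qed.

Lemma conv_symE f g : symmetric_measure f -> conv f f g = \sum_x f (g * x)%g * f x.
Proof.
move=> sf; have := convE f f g 1%g; rewrite invg1 mulg1 => ->.
rewrite -sum_inv; apply: eq_bigr => x _.
by rewrite invgK mulg1 -sf.
Qed.

(** [conv f f] is bounded by [l2norm_sq f] pointwise, and the unpopular points contribute at most
    half of the assumed energy. *)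
Lemma sum_popular f M : is_prob f -> 1 <= M ->
  l2norm_sq f <= M * l2norm_sq (conv f f) ->
  1 / (2 * M) <= \sum_(g | l2norm_sq f / (2 * M) <= conv f f g) conv f f g.
Proof.
move=> pf M1 hq; set q := l2norm_sq f; set F := conv f f.
have q0 : 0 < q by apply: l2norm_sq_gt0.
have M0 : 0 < M by apply: lt_le_trans M1.
have F0 g : 0 <= F g by apply: conv_ge0 => x; case/andP: (proj1 pf x).
have sF : \sum_g F g = 1 by rewrite sum_conv (proj2 pf) mulr1.
set s := \sum_(g | _) _.
have : l2norm_sq F <= q * s + q / (2 * M).
  rewrite /l2norm_sq (bigID (fun g => q / (2 * M) <= F g)) /=; apply: lerD.
    rewrite mulr_sumr; apply: ler_sum => g _.
    by rewrite expr2 ler_wpM2r // conv_sym_le_l2.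
  apply: (@le_trans _ _ (\sum_(g | ~~ (q / (2 * M) <= F g)) q / (2 * M) * F g)).
    apply: ler_sum => g; rewrite -ltNge => /ltW h.
    by rewrite expr2 ler_wpM2r.
  rewrite -mulr_sumr ler_piMr ?divr_ge0 ?mulr_ge0 ?(ltW q0) ?(ltW M0) //.
  by rewrite -[leRHS]sF [leRHS](bigID (fun g => q / (2 * M) <= F g)) /= lerDr sumr_ge0.
move=> h.
have h2 : q / M <= l2norm_sq F by rewrite ler_pdivrMr // mulrC.
rewrite -(ler_pM2l q0).
have -> : q * (1 / (2 * M)) = q / M - q / (2 * M) by field; rewrite gt_eqF.
by lra.
Qed.

(** Dependent random choice is applied to the graph joining [x] and [y] when [x y^-1] is popular.
    Paths of length four make the eight-fold convolution [conv F2 F2] at least [q / M ^+ 14] on all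
    of A A^-1; its total mass is 1, which bounds the size of A A^-1. *)
Lemma small_difference_set f M : is_prob f -> symmetric_measure f ->
  2 ^+ 20 <= M -> l2norm_sq f <= M * l2norm_sq (conv f f) ->
  exists A : {set gT}, [/\ forall a, a \in A -> f a <= 8 * M * l2norm_sq f,
    1 / (16 * M) <= measure_of f A &
    #|(A * A^-1)%g|%:R * l2norm_sq f <= M ^+ 14].
Proof.
move=> pf sf M20 hq; set q := l2norm_sq f in hq *; set F := conv f f.
have M1 : 1 <= M by apply: le_trans M20; rewrite -natrX ler1n expn_gt0.
have M0 : 0 < M by apply: lt_le_trans M1.
have q0 : 0 < q by apply: l2norm_sq_gt0.
have f0 x : 0 <= f x by case/andP: (proj1 pf x).
have F0 g : 0 <= F g by apply: conv_ge0.
have sF : \sum_g F g = 1 by rewrite sum_conv (proj2 pf) mulr1.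
have symF : symmetric_measure F by apply: symmetric_conv.
(* Cutting off the values above [8 * M * q] loses mass at most [1 / (8 * M)], which keeps half of
   the edge density, and the cap turns weights of paths into lower bounds for convolutions. *)
pose w x := if f x <= 8 * M * q then f x else 0.
pose e x y := q / (2 * M) <= F (x * y^-1)%g.
have w0 x : 0 <= w x by rewrite /w; case: ifP.
have wf x : w x <= f x by rewrite /w; case: ifP.
have wM x : w x <= 8 * M * q.
  by rewrite /w; case: ifP => // _; rewrite !mulr_ge0 // ltW.
have esym : symmetric e by move=> x y; rewrite /e symF invMg invgK.
have sw : \sum_x w x <= 1 by rewrite -(proj2 pf) ler_sum.
have sfw : \sum_x (f x - w x) <= 1 / (8 * M).
  have h : (\sum_x (f x - w x)) * (8 * M * q) <= q.
    rewrite mulr_suml; apply: ler_sum => x _; rewrite /w.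
    case: (leP (f x) (8 * M * q)) => [_|/ltW h]; first by rewrite subrr mul0r sqr_ge0.
    by rewrite subr0 expr2 ler_wpM2l.
  rewrite ler_pdivlMr ?mulr_gt0 // -(ler_pM2r q0) mul1r.
  by rewrite -!mulrA in h *.
have dens0 : 1 / (2 * M) <= \sum_x f x * \sum_y (e x y)%:R * f y.
  apply: le_trans (sum_popular pf M1 hq) _.
  rewrite big_mkcond le_eqVlt; apply/orP; left; apply/eqP.
  transitivity (\sum_g \sum_y (e (g * y)%g y)%:R * (f (g * y)%g * f y)).
    apply: eq_bigr => g _; rewrite -/q -[conv f f g]/(F g); case: ifP => h.
      by rewrite /F conv_symE //; apply: eq_bigr => y _; rewrite /e mulgK h mul1r.
    by rewrite big1 // => y _; rewrite /e mulgK h mul0r.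
  rewrite exchange_big /=.
  under eq_bigr => y _ do rewrite (sum_translater (fun x => (e x y)%:R * (f x * f y))).
  rewrite exchange_big; apply: eq_bigr => x _; rewrite mulr_sumr.
  by apply: eq_bigr => y _; rewrite mulrCA.
have dens : 1 / (4 * M) <= \sum_x w x * \sum_y (e x y)%:R * w y.
  have h : \sum_x f x * (\sum_y (e x y)%:R * f y) - 2 * (\sum_x (f x - w x)) <=
      \sum_x w x * \sum_y (e x y)%:R * w y.
    have e1 : \sum_x (f x - w x) = \sum_x \sum_y (f x - w x) * f y.
      by apply: eq_bigr => x _; rewrite -mulr_sumr (proj2 pf) mulr1.
    have e2 : \sum_x (f x - w x) = \sum_x \sum_y f x * (f y - w y).
      by rewrite exchange_big; apply: eq_bigr => y _; rewrite -mulr_suml (proj2 pf) mul1r.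
    rewrite mulr_natl mulr2n {1}e1 e2 -big_split -sumrB /=; apply: ler_sum => x _.
    rewrite !mulr_sumr -big_split -sumrB /=; apply: ler_sum => y _.
    have h1 : 0 <= f x - w x by rewrite subr_ge0.
    have h2 : 0 <= f y - w y by rewrite subr_ge0.
    have := mulr_ge0 h1 h2; have := mulr_ge0 h1 (f0 y); have := mulr_ge0 (f0 x) h2.
    by case: (e x y); rewrite ?mul1r ?mul0r ?mulr0; lra.
  apply: le_trans h.
  have -> : 1 / (4 * M) = 1 / (2 * M) - 2 * (1 / (8 * M)) by field; rewrite gt_eqF.
  by lra.
have d0 : 0 < 1 / (4 * M) by rewrite divr_gt0 ?mulr_gt0.
have [A [hA path]] := dependent_random_choice w0 sw esym d0 dens.
exists [set a in A | f a <= 8 * M * q]; split.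
- by move=> a; rewrite inE => /andP[].
- have <- : 1 / (4 * M) / 4 = 1 / (16 * M) by field; rewrite gt_eqF.
  apply: le_trans hA _; rewrite /measure_of le_eqVlt; apply/orP; left; apply/eqP.
  rewrite [RHS]big_mkcond [LHS]big_mkcond; apply: eq_bigr => a _.
  by rewrite inE /w; case: (a \in A) => //=.
pose F2 := conv F F.
have F20 g : 0 <= F2 g by apply: conv_ge0.
have b0 : 0 < 8 * M * q by rewrite !mulr_gt0.
pose k := (q / (2 * M)) ^+ 2 / (8 * M * q).
have k0 : 0 <= k by rewrite divr_ge0 ?sqr_ge0 ?ltW.
have F2_ge a c : k * (\sum_x (e a x && e x c)%:R * w x) <= F2 (a * c^-1)%g.
  rewrite /F2 convE mulr_sumr; apply: ler_sum => x _.
  case eax: (e a x); case exc: (e x c); rewrite ?mul0r ?mulr0 ?mulr_ge0 //= mul1r.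
  apply: (@le_trans _ _ ((q / (2 * M)) ^+ 2)).
    by rewrite /k mulrAC ler_pdivrMr // ler_wpM2l ?sqr_ge0.
  by rewrite expr2 ler_pM // divr_ge0 ?mulr_ge0 // ltW.
have F4_ge a b : a \in A -> b \in A -> q / M ^+ 14 <= conv F2 F2 (a * b^-1)%g.
  move=> aA bA; rewrite convE.
  apply: (@le_trans _ _ (k ^+ 2 / (8 * M * q) * ((1 / (4 * M)) ^+ 5 / 4096))).
    (* The factor [2 ^+ 35] is absorbed by [M ^+ 2], as [M] is at least [2 ^+ 20]. *)
    have -> : k ^+ 2 / (8 * M * q) * ((1 / (4 * M)) ^+ 5 / 4096) = q / (2 ^+ 35 * M ^+ 12).
      by rewrite /k; field; rewrite !gt_eqF.
    rewrite ler_wpM2l ?(ltW q0) // lef_pV2 ?posrE ?mulr_gt0 ?exprn_gt0 //.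
    rewrite (exprD M 2 12) ler_wpM2r ?exprn_ge0 ?(ltW M0) //.
    apply: (@le_trans _ _ ((2 ^+ 20) ^+ 2)); first by rewrite -exprM ler_weXn2l // ler1n.
    by rewrite lerXn2r // nnegrE ?exprn_ge0 // ltW.
  apply: (@le_trans _ _ (k ^+ 2 / (8 * M * q) *
     \sum_c w c * ((\sum_x (e a x && e x c)%:R * w x) *
                  (\sum_y (e c y && e y b)%:R * w y)))).
    by rewrite ler_wpM2l ?path // divr_ge0 ?sqr_ge0 // ltW.
  rewrite mulr_sumr; apply: ler_sum => c _.
  set s1 := (\sum_x _); set s2 := (\sum_y _).
  have s10 : 0 <= s1 by apply: sumr_ge0 => x _; rewrite mulr_ge0.
  have s20 : 0 <= s2 by apply: sumr_ge0 => x _; rewrite mulr_ge0.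
  apply: (@le_trans _ _ ((k * s1) * (k * s2))); last first.
    by apply: ler_pM; [rewrite mulr_ge0|rewrite mulr_ge0|apply: F2_ge|apply: F2_ge].
  have -> : k ^+ 2 / (8 * M * q) * (w c * (s1 * s2)) =
     (k * s1 * (k * s2)) * (w c / (8 * M * q)) by ring.
  by rewrite ler_piMr  ?(mulr_ge0 (mulr_ge0 k0 s10) (mulr_ge0 k0 s20)) // ler_pdivrMr // mul1r.
set B := [set a in A | _].
have : \sum_(g in (B * B^-1)%g) q / M ^+ 14 <= 1.
  apply: (@le_trans _ _ (\sum_(g in (B * B^-1)%g) conv F2 F2 g)).
    apply: ler_sum => g /mulsgP[x y xB]; rewrite inE => yB ->.
    rewrite -[y in (x * y)%g]invgK; apply: F4_ge.
      by move: xB; rewrite /B inE => /andP[].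
    by move: yB; rewrite /B inE => /andP[].
  have sF4 : \sum_g conv F2 F2 g = 1 by rewrite sum_conv (sum_conv F F) sF !mulr1.
  rewrite -[leRHS]sF4 [leRHS](bigID (mem (B * B^-1)%g)) /= lerDl sumr_ge0 // => g _.
  exact: conv_ge0.
by rewrite sumr_const -(mulr_natl (q / M ^+ 14)) mulrA ler_pdivrMr ?exprn_gt0 // mul1r.
Qed.

End BalogSzemerediGowers.

Lemma double_count_le (I J : finType) (X : {set I}) (Y : {set J}) (r : I -> J -> bool)
    (m n : nat) :
  (forall x, x \in X -> m <= #|[set y in Y | r x y]|)%N ->
  (forall y, y \in Y -> #|[set x in X | r x y]| <= n)%N ->
  (#|X| * m <= #|Y| * n)%N.
Proof.
move=> hX hY; rewrite -!sum_nat_const.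
apply: (@leq_trans (\sum_(x in X) #|[set y in Y | r x y]|)%N); first exact: leq_sum.
apply: (@leq_trans (\sum_(y in Y) #|[set x in X | r x y]|)%N); last exact: leq_sum.
rewrite leq_eqVlt; apply/orP; left; apply/eqP.
under eq_bigr do rewrite -sum1dep_card big_mkcond /=.
under [RHS]eq_bigr do rewrite -sum1dep_card big_mkcond /=.
rewrite [LHS]big_mkcond [RHS]big_mkcond /=.
transitivity (\sum_x \sum_y (if [&& x \in X, y \in Y & r x y] then 1 else 0))%N.
  by apply: eq_bigr => x _; case: ifP => xX; rewrite ?xX //= big1.
rewrite exchange_big; apply: eq_bigr => y _ /=.
case: ifP => yY /=; first by apply: eq_bigr => x _.
by rewrite big1 // => x _; rewrite andbF.
Qed.

(* A S T is covered with multiplicity m by (A A^-1) (A T): if s = a^-1 b with a, b in A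
   then a0 s y = (a0 a^-1) (b y). *)
Lemma card_mul_popular (gT : finGroupType) (A S T : {set gT}) (m : nat) :
  (forall s, s \in S -> m <= #|[set a in A | (a * s)%g \in A]|)%N ->
  (#|(A * (S * T))%g| * m <= #|(A * A^-1)%g| * #|(A * T)%g|)%N.
Proof.
move=> hS.
apply: (@double_count_le _ _ _ _ (fun x e => (e^-1 * x)%g \in (A * T)%g)).
  move=> x /mulsgP[a0 z a0A /mulsgP[s y sS yT ->] ->].
  apply: leq_trans (hS s sS) _.
  have inj : injective (fun a : gT => a0 * a^-1)%g.
    by move=> u v /mulgI/invg_inj.
  rewrite -(card_imset (mem [set a in A | (a * s)%g \in A]) inj); apply: subset_leq_card.
  apply/subsetP => _ /imsetP[a aS ->]; move: aS; rewrite inE => /andP[aA asA].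
  rewrite inE /= mem_mulg ?inE ?invgK //=.
  by rewrite invMg invgK -mulgA mulKg mulgA mem_mulg.
move=> e eE; rewrite -(card_lcoset (A * T)%g e); apply: subset_leq_card.
by apply/subsetP => x; rewrite inE mem_lcoset => /andP[].
Qed.

(** * Popular correlations and the approximate group *)

Section PopularCorrelations.
Variables (R : realType) (gT : finGroupType).
Implicit Types (f w : gT -> R) (M : R).

(** The autocorrelation of [w]: for the indicator of a set it counts the representations of [s] as
    a^-1 b. *)
Definition corr w s : R := \sum_a w a * w (a * s)%g.

Lemma sum_corr w : \sum_s corr w s = (\sum_a w a) ^+ 2.
Proof.
rewrite /corr exchange_big expr2 mulr_suml; apply: eq_bigr => a _.
by rewrite -mulr_sumr (sum_translate w).
Qed.

Lemma corr_inv w s : corr w s^-1%g = corr w s.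
Proof.
rewrite /corr -(sum_translater _ s); apply: eq_bigr => a _.
by rewrite mulgK mulrC.
Qed.

Lemma corr_le w s : corr w s <= l2norm_sq w.
Proof.
have h : corr w s <= \sum_y (w y ^+ 2 + w (y * s)%g ^+ 2) / 2.
  by apply: ler_sum => y _; have := sqr_ge0 (w y - w (y * s)%g); rewrite sqrrB; lra.
apply: le_trans h _; rewrite -mulr_suml big_split /=.
by rewrite (sum_translater (fun y => w y ^+ 2)) -/(l2norm_sq w); lra.
Qed.

(** The correlations [r] by left quotients a b^-1 have the same sum of squares as [corr], because
    a^-1 b = c^-1 d amounts to c a^-1 = d b^-1. As [r] lives on A A^-1, Cauchy-Schwarz applies to
    it. *)
Lemma corr_energy w (A : {set gT}) : (forall a, a \notin A -> w a = 0) ->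
  (\sum_a w a) ^+ 4 <= #|(A * A^-1)%g|%:R * \sum_s corr w s ^+ 2.
Proof.
move=> wA; pose r e := \sum_b w (e * b)%g * w b.
have sr : \sum_e r e = (\sum_a w a) ^+ 2.
  rewrite /r exchange_big expr2 mulr_sumr; apply: eq_bigr => b _.
  by rewrite -mulr_suml (sum_translater w).
have r0 e : e \notin (A * A^-1)%g -> r e = 0.
  move=> eE; apply: big1 => b _; have [bA|/wA ->] := boolP (b \in A); last by rewrite mulr0.
  rewrite wA ?mul0r //; apply: contra eE => ebA.
  by rewrite -[e](mulgK b) mem_mulg // inE invgK.
have -> : \sum_s corr w s ^+ 2 = \sum_e r e ^+ 2.
  have -> : \sum_s corr w s ^+ 2 =
      \sum_b \sum_d \sum_c (w b * w d) * (w c * w (c * (b^-1 * d))%g).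
    under eq_bigr do rewrite expr2 /corr mulr_suml.
    rewrite exchange_big; apply: eq_bigr => b _ /=.
    rewrite -(sum_translate _ b^-1%g); apply: eq_bigr => d _.
    by rewrite mulKVg mulr_sumr; apply: eq_bigr.
  under [RHS]eq_bigr do rewrite expr2 /r mulr_suml.
  rewrite [RHS]exchange_big; apply: eq_bigr => b _ /=.
  under [RHS]eq_bigr do rewrite mulr_sumr.
  rewrite [RHS]exchange_big; apply: eq_bigr => d _ /=.
  rewrite -(sum_translater _ b); apply: eq_bigr => e _.
  by rewrite !mulgA mulgK; ring.
have -> : (\sum_a w a) ^+ 4 = (\sum_(e in (A * A^-1)%g) r e) ^+ 2.
  rewrite -[4%N]/(2 * 2)%N exprM -sr; congr (_ ^+ 2).
  by rewrite (bigID (mem (A * A^-1)%g)) /= [X in _ + X]big1 ?addr0.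
apply: le_trans (sqr_sum_le_card _ _) _; rewrite ler_wpM2l //.
rewrite [leRHS](bigID (mem (A * A^-1)%g)) /= lerDl sumr_ge0 // => e _.
exact: sqr_ge0.
Qed.

(** Correlations below the threshold account for at most half of the energy that [corr_energy]
    provides. *)
Lemma sum_large_corr w (A : {set gT}) (q : R) :
  (forall a, 0 <= w a) -> (forall a, a \notin A -> w a = 0) ->
  0 < q -> l2norm_sq w <= q -> 0 < \sum_a w a ->
  (\sum_a w a) ^+ 4 / (2 * (#|(A * A^-1)%g|%:R * q)) <=
  \sum_(s | (\sum_a w a) ^+ 2 / (2 * #|(A * A^-1)%g|%:R) <= corr w s) corr w s.
Proof.
move=> w0 wA q0 wq m0; set m := \sum_a w a in m0 *; set E := (A * A^-1)%g.
set t := m ^+ 2 / (2 * _); set s := \sum_(s | _) _.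
have c0 x : 0 <= corr w x by apply: sumr_ge0 => a _; rewrite mulr_ge0.
have en := corr_energy wA; rewrite -/m -/E in en.
have E0 : 0 < #|E|%:R :> R.
  rewrite ltr0n lt0n; apply/negP => /eqP E0; move: en; rewrite E0 mul0r.
  by rewrite leNgt exprn_gt0.
have t0 : 0 <= t by rewrite divr_ge0 ?exprn_ge0 ?mulr_ge0 ?(ltW m0) ?(ltW E0).
have h : \sum_s corr w s ^+ 2 <= q * s + t * m ^+ 2.
  rewrite (bigID (fun x => t <= corr w x)) /=; apply: lerD.
    rewrite mulr_sumr; apply: ler_sum => x _.
    by rewrite expr2 ler_wpM2r // (le_trans (corr_le w x)).
  apply: (@le_trans _ _ (\sum_(x | ~~ (t <= corr w x)) t * corr w x)).
    apply: ler_sum => x; rewrite -ltNge => /ltW hx.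
    by rewrite expr2 ler_wpM2r.
  rewrite -mulr_sumr ler_wpM2l // -sum_corr.
  by rewrite [leRHS](bigID (fun x => t <= corr w x)) /= lerDr sumr_ge0.
rewrite ler_pdivrMr ?mulr_gt0 //.
have h2 : m ^+ 4 <= #|E|%:R * (q * s + t * m ^+ 2).
  by apply: le_trans en _; rewrite ler_wpM2l // ltW.
have e : #|E|%:R * (t * m ^+ 2) = m ^+ 4 / 2 by rewrite /t; field; rewrite gt_eqF.
by move: h2; rewrite mulrDr e => h2; lra.
Qed.

(** [S] is the set of large correlations of [f] restricted to [A]. Each of its elements has at least
    [n] representations by [A], with |A A^-1| at most [M ^+ 34 * n], so [card_mul_popular] bounds A
    S^k by induction on k. The exponents are 422 = 34 * 12 + 14 and 464 = 422 + 42. *)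
Lemma approximate_group_of_energy f M : is_prob f -> symmetric_measure f ->
  2 ^+ 20 <= M -> l2norm_sq f <= M * l2norm_sq (conv f f) ->
  exists (S : {set gT}) (a : gT), [/\ 1%g \in S, (S^-1)%g = S,
    #|(S ^+ 12)%g|%:R <= M ^+ 464 * #|S|%:R,
    #|S|%:R * l2norm_sq f <= M ^+ 422 &
    M ^- 21 <= measure_of f (a *: S)%g].
Proof.
move=> pf sf M20 hq.
have [A [fA mA]] := small_difference_set pf sf M20 hq.
set q := l2norm_sq f in fA *; set E := (A * A^-1)%g => hE.
have M1 : 1 <= M by apply: le_trans M20; rewrite -natrX ler1n expn_gt0.
have M0 : 0 < M by apply: lt_le_trans M1.
have powM n k : (k <= 20 * n)%N -> 2 ^+ k <= M ^+ n.
  move=> kn; apply: (@le_trans _ _ ((2 ^+ 20) ^+ n)).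
    by rewrite -exprM ler_weXn2l // ler1n.
  by apply: lerXn2r; rewrite // nnegrE ?exprn_ge0 // ltW.
have q0 : 0 < q by apply: l2norm_sq_gt0.
have f0 x : 0 <= f x by case/andP: (proj1 pf x).
pose w x := if x \in A then f x else 0.
have w0 x : 0 <= w x by rewrite /w; case: ifP.
have wf x : w x <= f x by rewrite /w; case: ifP.
have wA a : a \notin A -> w a = 0 by rewrite /w => /negPf ->.
have sw : \sum_a w a = measure_of f A by rewrite /measure_of [RHS]big_mkcond.
have wq : l2norm_sq w <= q.
  apply: ler_sum => x _; rewrite /w; case: ifP => // _.
  by rewrite expr0n /= sqr_ge0.
set m := measure_of f A in mA sw.
have m0 : 0 < m by apply: lt_le_trans mA; rewrite divr_gt0 ?mulr_gt0.
have sw0 : 0 < \sum_a w a by rewrite sw.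
have := sum_large_corr w0 wA q0 wq sw0; rewrite sw -/E => mass.
set t := m ^+ 2 / (2 * _) in mass.
have Apos : (0 < #|A|)%N.
  rewrite lt0n; apply/negP => /eqP/cards0_eq A0.
  by move: m0; rewrite /m A0 /measure_of big_set0 ltxx.
have AE : (#|A| <= #|E|)%N.
  have [a aA] : exists a, a \in A by apply/set0Pn; rewrite -card_gt0.
  rewrite -(card_rcoset A a^-1%g); apply: subset_leq_card.
  apply/subsetP => x; rewrite mem_rcoset invgK => xa.
  by rewrite -[x](mulgK a) mem_mulg // inE invgK.
have E0 : 0 < #|E|%:R :> R by rewrite ltr0n (leq_trans Apos).
have t0 : 0 < t by rewrite divr_gt0 ?exprn_gt0 ?mulr_gt0.
pose S := [set s | t <= corr w s].
have mass2 : M ^- 21 <= \sum_(s | t <= corr w s) corr w s.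
  apply: le_trans mass.
  rewrite ler_pdivlMr ?mulr_gt0 //.
  apply: (@le_trans _ _ (M ^- 21 * (2 * M ^+ 14))).
    by rewrite ler_wpM2l ?invr_ge0 ?exprn_ge0 ?(ltW M0) // ler_wpM2l.
  apply: (@le_trans _ _ ((1 / (16 * M)) ^+ 4)); last first.
    by apply: lerXn2r => //; rewrite nnegrE ltW // divr_gt0 ?mulr_gt0.
  have -> : (1 / (16 * M)) ^+ 4 = M ^- 21 * (M ^+ 17 / 2 ^+ 16).
    by field; rewrite gt_eqF.
  rewrite ler_wpM2l ?invr_ge0 ?exprn_ge0 ?(ltW M0) //.
  rewrite ler_pdivlMr ?exprn_gt0 // (exprD M 14 3) mulrAC [leRHS]mulrC.
  rewrite ler_wpM2r ?exprn_ge0 ?(ltW M0) //.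
  by rewrite -exprS powM.
(* The sum of [corr] over [S] is an average, with weights [w a], of the masses of the translates
   [a *: S]; one translate reaches it. *)
have avg : M ^- 21 <= \sum_a w a * measure_of f (a *: S)%g.
  apply: le_trans mass2 _.
  rewrite /corr exchange_big /=; apply: ler_sum => a _.
  rewrite -mulr_sumr ler_wpM2l // /measure_of.
  rewrite [leRHS](reindex_inj (mulgI a)) /= big_mkcond [leRHS]big_mkcond /=.
  by apply: ler_sum => s _; rewrite mem_lcoset mulKg inE; case: ifP.
have [||a _ Ha] := @exists_ge_average R gT w (fun a => measure_of f (a *: S)%g) predT
  (M ^- 21) w0 _ _ avg.
- by rewrite sw -(proj2 pf) /m /measure_of big_mkcond ler_sum // => x _; case: ifP.
- by rewrite invr_gt0 exprn_gt0.
have S1 : 1%g \in S.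
  have [s sS] : exists s, s \in S.
    apply/set0Pn/negP => /eqP S0.
    have : 0 < M ^- 21 by rewrite invr_gt0 exprn_gt0.
    rewrite ltNge => /negP; apply; apply: le_trans Ha _.
    by rewrite /measure_of big1 // => x; rewrite mem_lcoset S0 inE.
  move: sS; rewrite !inE => /le_trans; apply.
  rewrite /corr; under [leRHS]eq_bigr do rewrite mulg1 -expr2.
  exact: corr_le.
have SV : (S^-1)%g = S by apply/setP => s; rewrite !inE corr_inv.
pose b := 8 * M * q.
have b0 : 0 < b by rewrite !mulr_gt0.
(* [s0] is the element of [S] with the fewest representations; [n] serves for all the others. *)
case: (@arg_minnP _ 1%g (fun s => s \in S) (fun s => #|[set a in A | (a * s)%g \in A]|) S1) => s0 /= s0S.
set n := #|_| => nle.
have nge : t / b ^+ 2 <= n%:R.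
  move: s0S; rewrite inE => /le_trans h; rewrite ler_pdivrMr ?exprn_gt0 //; apply: h.
  rewrite mulr_natl -sumr_const [leRHS]big_mkcond; apply: ler_sum => x _.
  rewrite inE /w; case: ifP => xA; case: ifP => xsA; rewrite ?mul0r ?mulr0 //=.
  by rewrite expr2 ler_pM ?fA.
have En : #|E|%:R <= M ^+ 34 * n%:R.
  apply: (@le_trans _ _ (M ^+ 34 * (t / b ^+ 2))); last first.
    by rewrite ler_wpM2l ?exprn_ge0 ?(ltW M0).
  have -> : M ^+ 34 * (t / b ^+ 2) = (M ^+ 34 * m ^+ 2) / (128 * (#|E|%:R * q ^+ 2 * M ^+ 2)).
    by rewrite /t /b; field; rewrite !gt_eqF.
  rewrite ler_pdivlMr ?mulr_gt0 ?exprn_gt0 //.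
  apply: (@le_trans _ _ (128 * M ^+ 2 * (M ^+ 14) ^+ 2)).
    have -> : #|E|%:R * (128 * (#|E|%:R * q ^+ 2 * M ^+ 2)) =
       128 * M ^+ 2 * (#|E|%:R * q) ^+ 2 by ring.
    rewrite ler_wpM2l ?mulr_ge0 ?exprn_ge0 ?(ltW M0) //.
    by apply: lerXn2r => //; rewrite nnegrE ?exprn_ge0 ?mulr_ge0 ?(ltW M0) ?(ltW q0).
  apply: (@le_trans _ _ (M ^+ 34 * (1 / (16 * M)) ^+ 2)); last first.
    rewrite ler_wpM2l ?exprn_ge0 ?(ltW M0) //.
    by apply: lerXn2r => //; rewrite nnegrE ltW // divr_gt0 ?mulr_gt0.
  have -> : M ^+ 34 * (1 / (16 * M)) ^+ 2 = M ^+ 32 / 256 by field; rewrite gt_eqF.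
  rewrite ler_pdivlMr //.
  have -> : M ^+ 32 = M ^+ 2 * (M ^+ 2 * M ^+ 28) by ring.
  have -> : 128 * M ^+ 2 * (M ^+ 14) ^+ 2 * 256 = 2 ^+ 15 * (M ^+ 2 * M ^+ 28) by ring.
  by rewrite ler_wpM2r ?powM // mulr_ge0 ?exprn_ge0 ?(ltW M0).
have cardAS k : #|(A * S ^+ k)%g|%:R <= (M ^+ 34) ^+ k * #|A|%:R.
  elim: k => [|k IH]; first by rewrite expg0 mulg1 expr0 mul1r.
  have n0 : 0 < n%:R :> R.
    rewrite -(pmulr_rgt0 _ (exprn_gt0 34 M0)); exact: lt_le_trans E0 En.
  rewrite -(ler_pM2r n0) expgS -natrM.
  apply: (@le_trans _ _ (#|E| * #|(A * S ^+ k)%g|)%N%:R).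
    by rewrite ler_nat card_mul_popular.
  rewrite natrM exprS; move: IH; set z := (M ^+ 34) ^+ k => IH.
  have -> : M ^+ 34 * z * #|A|%:R * n%:R = (M ^+ 34 * n%:R) * (z * #|A|%:R) by ring.
  by rewrite ler_pM.
have card12 : #|(S ^+ 12)%g|%:R * q <= M ^+ 422.
  have h1 : #|(S ^+ 12)%g|%:R <= #|(A * S ^+ 12)%g|%:R :> R.
    have [x xA] : exists x, x \in A by apply/set0Pn; rewrite -card_gt0.
    rewrite ler_nat -(card_lcoset _ x) subset_leq_card //.
    apply/subsetP => y; rewrite mem_lcoset => h.
    by rewrite -(mulKVg x y) mem_mulg.
  apply: (@le_trans _ _ ((M ^+ 34) ^+ 12 * (#|E|%:R * q))).
    rewrite mulrA ler_wpM2r ?(ltW q0) //; apply: le_trans h1 (le_trans (cardAS 12%N) _).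
    by rewrite ler_wpM2l ?ler_nat // !exprn_ge0 // ltW.
  rewrite -exprM (exprD M 408 14).
  by rewrite ler_wpM2l ?exprn_ge0 // ltW.
(* Cauchy-Schwarz on [a *: S]: a set carrying this much mass cannot be small. *)
have Sge : M ^- 42 <= #|S|%:R * q.
  have -> : M ^- 42 = (M ^- 21) ^+ 2 by rewrite exprVn -exprM.
  apply: (@le_trans _ _ (measure_of f (a *: S)%g ^+ 2)).
    by apply: lerXn2r Ha; rewrite nnegrE ?invr_ge0 ?exprn_ge0 ?(ltW M0) ?sumr_ge0.
  apply: le_trans (sqr_sum_le_card _ _) _.
  rewrite card_lcoset ler_wpM2l // /q /l2norm_sq.
  rewrite [leRHS](bigID (mem (a *: S)%g)) /= lerDl sumr_ge0 // => e _.
  exact: sqr_ge0.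
exists S, a; split=> //.
  rewrite -(ler_pM2r q0) -mulrA; apply: le_trans card12 _.
  have -> : M ^+ 422 = M ^+ 464 * M ^- 42.
    by rewrite (exprD M 422 42) mulfK // expf_neq0 // gt_eqF.
  by rewrite ler_wpM2l ?exprn_ge0 // ltW.
apply: le_trans card12; rewrite ler_wpM2r ?(ltW q0) // ler_nat subset_leq_card //.
have sub k : S \subset (S ^+ k.+1)%g.
  elim: k => [|k IH]; first by rewrite expg1.
  by rewrite expgS; apply: subset_trans IH _; apply/subsetP => x xS; rewrite -[x]mul1g mem_mulg.
exact: sub.
Qed.

End PopularCorrelations.

(** * Matrix algebra of SL_2 *)

(** An equation that follows from known ones is reduced to a [ring] identity once the coefficients
    [k] of the combination are given. *)
Lemma eq_of_lincomb1 (F : pzRingType) (x y u v k : F) :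
  u = v -> x - y = k * (u - v) -> x = y.
Proof. by move=> ->; rewrite subrr mulr0 => /eqP; rewrite subr_eq0 => /eqP. Qed.

Lemma eq_of_lincomb2 (F : pzRingType) (x y u v u' v' k k' : F) :
  u = v -> u' = v' -> x - y = k * (u - v) + k' * (u' - v') -> x = y.
Proof.
by move=> -> ->; rewrite !subrr !mulr0 addr0 => /eqP; rewrite subr_eq0 => /eqP.
Qed.

Lemma eq_of_lincomb3 (F : pzRingType) (x y u v u' v' u'' v'' k k' k'' : F) :
  u = v -> u' = v' -> u'' = v'' ->
  x - y = k * (u - v) + k' * (u' - v') + k'' * (u'' - v'') -> x = y.
Proof.
by move=> -> -> ->; rewrite !subrr !mulr0 !addr0 => /eqP; rewrite subr_eq0 => /eqP.
Qed.

(** SL_2 over a finite field, presented by its four entry functions, so that all arguments become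
    polynomial identities in the entries. *)
Record sl2_coord (F : finFieldType) (gT : finGroupType) := Sl2Coord {
  ca : gT -> F; cb : gT -> F; cc : gT -> F; cd : gT -> F;
  sl2_det : forall g, ca g * cd g - cb g * cc g = 1;
  sl2_Ma : forall x y, ca (x * y)%g = ca x * ca y + cb x * cc y;
  sl2_Mb : forall x y, cb (x * y)%g = ca x * cb y + cb x * cd y;
  sl2_Mc : forall x y, cc (x * y)%g = cc x * ca y + cd x * cc y;
  sl2_Md : forall x y, cd (x * y)%g = cc x * cb y + cd x * cd y;
  sl2_inj : forall x y, ca x = ca y -> cb x = cb y -> cc x = cc y -> cd x = cd y -> x = y;
  sl2_surj : forall a b c d, a * d - b * c = 1 ->
    exists g, [/\ ca g = a, cb g = b, cc g = c & cd g = d] }.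

Section SL2Algebra.
Variables (F : finFieldType) (gT : finGroupType) (X : sl2_coord F gT).
Implicit Types (g h x y z u v : gT) (e : F * F).

Local Notation a := (ca X).
Local Notation b := (cb X).
Local Notation c := (cc X).
Local Notation d := (cd X).

Lemma sl2_1 : [/\ a 1%g = 1, b 1%g = 0, c 1%g = 0 & d 1%g = 1].
Proof.
have [g [ga gb gc gd]] : exists g, [/\ a g = 1, b g = 0, c g = 0 & d g = 1].
  by apply: sl2_surj; ring.
suff -> : 1%g = g by [].
apply: (mulgI g); rewrite mulg1; apply: (sl2_inj (s := X));
  by rewrite ?sl2_Ma ?sl2_Mb ?sl2_Mc ?sl2_Md ?ga ?gb ?gc ?gd; ring.
Qed.

Lemma sl2_V g : [/\ a g^-1%g = d g, b g^-1%g = - b g, c g^-1%g = - c g & d g^-1%g = a g].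
Proof.
have [h [ha hb hc hd]] : exists h, [/\ a h = d g, b h = - b g, c h = - c g & d h = a g].
  by apply: sl2_surj; rewrite -[RHS](sl2_det X g); ring.
suff -> : g^-1%g = h by [].
have [u1 u2 u3 u4] := sl2_1; have dt := sl2_det X g.
apply: (mulgI g); rewrite mulgV; apply: (sl2_inj (s := X));
  rewrite ?sl2_Ma ?sl2_Mb ?sl2_Mc ?sl2_Md ?ha ?hb ?hc ?hd ?u1 ?u2 ?u3 ?u4; try ring;
  by rewrite -[LHS]dt; ring.
Qed.

Lemma sl2_Va g : a g^-1%g = d g. Proof. by case: (sl2_V g). Qed.
Lemma sl2_Vb g : b g^-1%g = - b g. Proof. by case: (sl2_V g). Qed.
Lemma sl2_Vc g : c g^-1%g = - c g. Proof. by case: (sl2_V g). Qed.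
Lemma sl2_Vd g : d g^-1%g = a g. Proof. by case: (sl2_V g). Qed.

Definition sl2E := (sl2_Ma, sl2_Mb, sl2_Mc, sl2_Md, sl2_Va, sl2_Vb, sl2_Vc, sl2_Vd).

Definition tr g : F := a g + d g.

Lemma trC x y : tr (x * y)%g = tr (y * x)%g.
Proof. by rewrite /tr !sl2E; ring. Qed.

Lemma trJ x y : tr (y * x * y^-1)%g = tr x.
Proof. by rewrite trC mulgA mulVg mul1g. Qed.

Definition vact g e : F * F := (a g * e.1 + b g * e.2, c g * e.1 + d g * e.2).
(** Equality of lines in the plane; the zero vector is parallel to everything, which is why nonzero
    conditions accompany it. *)
Definition parallel e e' : bool := e.1 * e'.2 == e.2 * e'.1.
Definition eig g e : bool := (e != (0, 0)) && parallel (vact g e) e.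
Definition share x y : bool := [exists e, eig x e && eig y e].

Lemma vactM x y e : vact (x * y)%g e = vact x (vact y e).
Proof. by rewrite /vact !sl2E /=; congr (_, _); ring. Qed.

Lemma vact1 e : vact 1%g e = e.
Proof. by have [h1 h2 h3 h4] := sl2_1; rewrite /vact h1 h2 h3 h4; case: e => ? ? /=; congr (_, _); ring. Qed.

Lemma vact0 g : vact g (0, 0) = (0, 0).
Proof. by rewrite /vact /= !mulr0 addr0. Qed.

Lemma vact_eq0 g e : (vact g e == (0, 0)) = (e == (0, 0)).
Proof.
apply/eqP/eqP => [h|->]; last exact: vact0.
by rewrite -(vact1 e) -(mulVg g) vactM h vact0.
Qed.

Lemma parallelC e e' : parallel e e' = parallel e' e.
Proof. by rewrite /parallel eq_sym mulrC [e.1 * _]mulrC. Qed.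

Lemma parallel_vact g e e' : parallel (vact g e) (vact g e') = parallel e e'.
Proof.
rewrite /parallel -subr_eq0 -[RHS]subr_eq0; congr (_ == _) => /=.
by apply: (eq_of_lincomb1 (k := e.1 * e'.2 - e.2 * e'.1) (sl2_det X g)); ring.
Qed.

Lemma parallel_trans e' e e'' : e' != (0, 0) -> parallel e e' -> parallel e' e'' -> parallel e e''.
Proof.
case: e e' e'' => [e1 e2] [f1 f2] [g1 g2]; rewrite /parallel /= xpair_eqE negb_and => nz /eqP h1 /eqP h2.
rewrite -subr_eq0; case/orP: nz => nz.
  rewrite -(mulrI_eq0 _ (mulfI nz)); apply/eqP.
  by apply: (eq_of_lincomb2 (k := g1) (k' := e1) h1 h2); ring.
rewrite -(mulrI_eq0 _ (mulfI nz)); apply/eqP.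
by apply: (eq_of_lincomb2 (k := g2) (k' := e2) h1 h2); ring.
Qed.

(** The stabiliser of the line through [e], a Borel subgroup; for [e] zero it is the whole group. *)
Definition borel_set e : {set gT} := [set g | parallel (vact g e) e].

Lemma borel_group_set e : group_set (borel_set e).
Proof.
apply/group_setP; split=> [|x y]; first by rewrite inE vact1 /parallel mulrC.
rewrite !inE => hx hy; have [->|nz] := eqVneq e (0, 0); first by rewrite vact0 /parallel.
rewrite vactM; apply: parallel_trans hx; first by rewrite vact_eq0.
by rewrite parallel_vact.
Qed.

Canonical borel e : {group gT} := Group (borel_group_set e).

Lemma mem_borel g e : (g \in borel e) = parallel (vact g e) e.
Proof. by rewrite inE. Qed.

Lemma sl2_upper s : exists g, [/\ a g = 1, b g = s, c g = 0 & d g = 1].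
Proof. by apply: sl2_surj; ring. Qed.

Lemma sl2_lower s : exists g, [/\ a g = 1, b g = 0, c g = s & d g = 1].
Proof. by apply: sl2_surj; ring. Qed.

Lemma borel_proper e : e != (0, 0) -> borel e \proper [set: gT].
Proof.
move=> nz; rewrite properE subsetT /=; apply/subsetPn.
move: nz; case: e => e1 e2; rewrite xpair_eqE negb_and => /orP[nz|nz].
  have [g [ga gb gc gd]] := sl2_lower 1; exists g; rewrite ?inE // /parallel /vact /= ga gb gc gd.
  rewrite -subr_eq0 (_ : _ - _ = - (e1 * e1)); last by ring.
  by rewrite oppr_eq0 mulf_neq0.
have [g [ga gb gc gd]] := sl2_upper 1; exists g; rewrite ?inE // /parallel /vact /= ga gb gc gd.
rewrite -subr_eq0 (_ : _ - _ = e2 * e2); last by ring.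
by rewrite mulf_neq0.
Qed.

Definition sl2_scalar g : bool := [&& b g == 0, c g == 0 & a g == d g].

Lemma tr_sl2_scalar g : sl2_scalar g -> tr g ^+ 2 = 4.
Proof.
case/and3P=> /eqP hb /eqP hc /eqP had; have := sl2_det X g.
rewrite /tr had hb hc => h.
by apply: (eq_of_lincomb1 (k := 4) h); ring.
Qed.

(** [e1] and [e2] may coincide, and if [x] has no eigenline over the field an arbitrary vector is
    supplied, so that later case analyses are uniform. *)
Lemma eigenlines x : ~~ sl2_scalar x -> exists e1 e2, [/\ e1 != (0, 0), e2 != (0, 0) &
  forall e, eig x e -> parallel e e1 || parallel e e2].
Proof.
move=> nx.
have nz1 : ((1, 0) : F * F) != (0, 0) by rewrite xpair_eqE oner_eq0.
case: (pickP (eig x)) => [e1 h1|none]; last by exists (1, 0), (1, 0); split=> // e; rewrite none.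
have [n1 q1] := andP h1.
case: (pickP (fun e => eig x e && ~~ parallel e e1)) => [e2 /andP[h2 h12]|none]; last first.
  by exists e1, e1; split=> // e he; have := none e; rewrite he /= => /negbFE ->.
have [n2 q2] := andP h2.
exists e1, e2; split=> // e he; have [n3 q3] := andP he.
apply/negPn/negP; rewrite negb_or => /andP[h31 h32].
(* A nonzero binary quadratic form has at most two zeros on the projective line. *)
case/negP: nx; move: q1 q2 q3 h12 h31 h32; rewrite /parallel /vact /=.
case: e1 e2 e {h1 h2 he n1 n2 n3} => [x1 y1] [x2 y2] [x3 y3] /=.
move=> /eqP q1 /eqP q2 /eqP q3.
rewrite -[x2 * y1 == _]subr_eq0 -[x3 * y1 == _]subr_eq0 -[x3 * y2 == _]subr_eq0.
move=> h21 h31 h32; have nz := mulf_neq0 (mulf_neq0 h21 h31) h32.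
have D0 t : (x2 * y1 - y2 * x1) * (x3 * y1 - y3 * x1) * (x3 * y2 - y3 * x2) * t = 0 -> t == 0.
  by move/eqP; rewrite mulf_eq0 (negPf nz).
rewrite /sl2_scalar -[a x == _]subr_eq0; apply/and3P; split; apply: D0.
- by apply: (eq_of_lincomb3 (k := x2 * x3 * (x3 * y2 - y3 * x2))
    (k' := - (x1 * x3 * (x3 * y1 - y3 * x1))) (k'' := x1 * x2 * (x2 * y1 - y2 * x1))
    q1 q2 q3); ring.
- by apply: (eq_of_lincomb3 (k := - (y2 * y3 * (x3 * y2 - y3 * x2)))
    (k' := y1 * y3 * (x3 * y1 - y3 * x1)) (k'' := - (y1 * y2 * (x2 * y1 - y2 * x1)))
    q1 q2 q3); ring.
- by apply: (eq_of_lincomb3 (k := - ((x2 * y3 + y2 * x3) * (x3 * y2 - y3 * x2)))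
    (k' := (x1 * y3 + y1 * x3) * (x3 * y1 - y3 * x1))
    (k'' := - ((x1 * y2 + y1 * x2) * (x2 * y1 - y2 * x1)))
    q1 q2 q3); ring.
Qed.

(* tr (y n) for the traceless matrix n = [[n0, n1], [n2, - n0]]. *)
Definition pair_tr y (n0 n1 n2 : F) : F := n0 * (a y - d y) + n1 * c y + n2 * b y.

(** The traceless matrix n has determinant 0, hence rank one with kernel equal to its image, the
    line of [e]. Then tr (y n) = 0 says that [y] preserves this line. *)
Lemma nilpotent_eigenvector n0 n1 n2 : (n0, n1, n2) != (0, 0, 0) ->
  n0 ^+ 2 + n1 * n2 = 0 ->
  exists2 e, e != (0, 0) & forall y, pair_tr y n0 n1 n2 = 0 -> eig y e.
Proof.
move=> nz nil; have [e0|nz'] := eqVneq (n0, n2) (0, 0).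
  case: e0 nz => -> ->; rewrite !xpair_eqE eqxx andbT /= => nz1.
  exists (1, 0); first by rewrite xpair_eqE oner_eq0.
  move=> y; rewrite /pair_tr !mul0r add0r addr0 => /eqP.
  rewrite mulf_eq0 (negPf nz1) /= /eig xpair_eqE oner_eq0 /parallel /vact /= => /eqP ->.
  by rewrite !mulr0 !mul0r addr0 mul0r.
exists (n0, n2) => // y hy; rewrite /eig nz' /parallel /vact /=; apply/eqP.
move: hy; rewrite /pair_tr => hy.
by apply: (eq_of_lincomb2 (k := n2) (k' := - c y) hy nil); ring.
Qed.

Lemma eig_borel x e : eig x e -> x \in borel e.
Proof. by rewrite mem_borel => /andP[]. Qed.

Lemma borel_eig x e : e != (0, 0) -> x \in borel e -> eig x e.
Proof. by rewrite mem_borel /eig => -> ->. Qed.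

(** The traceless parts of [x] and [y], with coordinates a - d, b, c, have zero cross product; this
    is commutation in a form suited to elimination. *)
Definition crossed x y : bool :=
  [&& (a x - d x) * b y == (a y - d y) * b x,
      (a x - d x) * c y == (a y - d y) * c x & b x * c y == c x * b y].

Lemma commute_crossed x y : crossed x y -> commute x y.
Proof.
case/and3P=> /eqP h1 /eqP h2 /eqP h3; apply: (sl2_inj (s := X)); rewrite !sl2E.
- by apply: (eq_of_lincomb1 (k := 1) h3); ring.
- by apply: (eq_of_lincomb1 (k := 1) h1); ring.
- by apply: (eq_of_lincomb1 (k := -1) h2); ring.
- by apply: (eq_of_lincomb1 (k := -1) h3); ring.
Qed.

Lemma crossed_commute x y : commute x y -> crossed x y.
Proof.
move=> h; have ha := congr1 a h; have hb := congr1 b h; have hc := congr1 c h.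
rewrite !sl2E in ha hb hc; apply/and3P; split; apply/eqP.
- by apply: (eq_of_lincomb1 (k := 1) hb); ring.
- by apply: (eq_of_lincomb1 (k := -1) hc); ring.
- by apply: (eq_of_lincomb1 (k := 1) ha); ring.
Qed.

(** A matrix commuting with a nonscalar [x] is a linear combination of 1 and [x]. *)
Lemma crossed_span x y : ~~ sl2_scalar x -> crossed x y -> exists s t,
  [/\ a y = s + t * a x, b y = t * b x, c y = t * c x & d y = s + t * d x].
Proof.
move=> nx /and3P[/eqP h1 /eqP h2 /eqP h3].
suff [t [t1 t2 t3]] : exists t, [/\ a y - d y = t * (a x - d x), b y = t * b x & c y = t * c x].
  exists (a y - t * a x), t; split=> //; first by ring.
  by apply: (eq_of_lincomb1 (k := -1) t1); ring.
have [b0|bn0] := eqVneq (b x) 0; last first.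
  exists (b y / b x); split; last 2 first.
  - by rewrite divfK.
  - by apply: (mulfI bn0); rewrite h3; field.
  by apply: (mulfI bn0); rewrite [LHS]mulrC -h1; field.
have [c0|cn0] := eqVneq (c x) 0; last first.
  exists (c y / c x); split; last 2 first.
  - by apply: (mulfI cn0); rewrite -h3; field.
  - by rewrite divfK.
  by apply: (mulfI cn0); rewrite [LHS]mulrC -h2; field.
have an0 : a x - d x != 0 by move: nx; rewrite /sl2_scalar b0 c0 eqxx /= subr_eq0.
exists ((a y - d y) / (a x - d x)); split; first by rewrite divfK.
  by apply: (mulfI an0); rewrite h1 b0 !mulr0.
by apply: (mulfI an0); rewrite h2 c0 !mulr0.
Qed.

Lemma cent1_span x y : ~~ sl2_scalar x -> y \in 'C[x]%g -> exists s t,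
  [/\ a y = s + t * a x, b y = t * b x, c y = t * c x & d y = s + t * d x].
Proof. by move=> nx /cent1P h; apply: crossed_span => //; apply: crossed_commute. Qed.

Lemma cent1_commute x y z : ~~ sl2_scalar x -> y \in 'C[x]%g -> z \in 'C[x]%g -> commute y z.
Proof.
move=> nx /(cent1_span nx)[s [t [h1 h2 h3 h4]]] /(cent1_span nx)[s' [t' [k1 k2 k3 k4]]].
apply: commute_crossed; rewrite /crossed h1 h2 h3 h4 k1 k2 k3 k4.
by apply/and3P; split; apply/eqP; ring.
Qed.

(** Centralisers of nonscalar elements are abelian, so two of them that share a nonscalar element
    coincide. *)
Lemma cent1_eq x y : ~~ sl2_scalar x -> ~~ sl2_scalar y -> y \in 'C[x]%g -> 'C[y]%g = 'C[x]%g.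
Proof.
move=> nx ny yx; have xy : x \in 'C[y]%g by rewrite cent1C.
apply/setP => z; apply/idP/idP => hz; apply/cent1P.
  exact: (cent1_commute ny).
exact: (cent1_commute nx).
Qed.

Lemma cent1_proper x : ~~ sl2_scalar x -> 'C[x]%g \proper [set: gT].
Proof.
move=> nx; rewrite properE subsetT /=; apply/negP => /subsetP sub.
have cx y : crossed x y.
  by apply: crossed_commute; have /cent1P : y \in 'C[x]%g by rewrite sub ?inE.
have [g [ga gb gc gd]] := sl2_upper 1; have [h [ha hb hc hd]] := sl2_lower 1.
case/negP: nx; have := cx g; have := cx h; rewrite /crossed ga gb gc gd ha hb hc hd.
rewrite !subrr !mul0r !mulr0 !mulr1 => /and3P[_ _ hbx] /and3P[hadx _ hcx].
by rewrite /sl2_scalar hbx eq_sym hcx -[a x == _]subr_eq0 hadx.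
Qed.

End SL2Algebra.

(** * Trace equations and fibres of the product map *)

Section SL2Fibres.
Variables (F : finFieldType) (gT : finGroupType) (X : sl2_coord F gT).
Implicit Types (g h x y z u v : gT) (e : F * F).

Local Notation a := (ca X).
Local Notation b := (cb X).
Local Notation c := (cc X).
Local Notation d := (cd X).
Local Notation tr := (tr X).
Local Notation share := (share X).
Local Notation sl2_scalar := (sl2_scalar X).

Lemma share_of_nilpotent x y n0 n1 n2 : (n0, n1, n2) != (0, 0, 0) ->
  n0 ^+ 2 + n1 * n2 = 0 ->
  pair_tr X x n0 n1 n2 = 0 -> pair_tr X y n0 n1 n2 = 0 -> share x y.
Proof.
move=> nz nil hx hy; have [e _ he] := nilpotent_eigenvector X nz nil.
by apply/existsP; exists e; rewrite !he.
Qed.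

(** [cross0], [cross1], [cross2] are the entries of the commutator v u - u v, a traceless matrix
    orthogonal to [u] and [v] for the trace form. *)
Definition cross0 u v : F := c u * b v - b u * c v.
Definition cross1 u v : F := b u * (a v - d v) - (a u - d u) * b v.
Definition cross2 u v : F := (a u - d u) * c v - c u * (a v - d v).

Lemma cross_eq0 u v : (cross0 u v, cross1 u v, cross2 u v) = (0, 0, 0) -> crossed X u v.
Proof.
case; rewrite /cross0 /cross1 /cross2 => h0 h1 h2; apply/and3P; split; apply/eqP.
- by apply: (eq_of_lincomb1 (k := -1) h1); ring.
- by apply: (eq_of_lincomb1 (k := 1) h2); ring.
- by apply: (eq_of_lincomb1 (k := -1) h0); ring.
Qed.

Lemma pair_tr_cross_l u v : pair_tr X u (cross0 u v) (cross1 u v) (cross2 u v) = 0.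
Proof. by rewrite /pair_tr /cross0 /cross1 /cross2; ring. Qed.

Lemma pair_tr_cross_r u v : pair_tr X v (cross0 u v) (cross1 u v) (cross2 u v) = 0.
Proof. by rewrite /pair_tr /cross0 /cross1 /cross2; ring. Qed.

(** For noncommuting [u] and [v] the two linear conditions are independent, so their traceless
    solutions form the line of the commutator. *)
Lemma orthogonal_cross u v n0 n1 n2 : ~~ crossed X u v ->
  pair_tr X u n0 n1 n2 = 0 -> pair_tr X v n0 n1 n2 = 0 ->
  exists s, [/\ n0 = s * cross0 u v, n1 = s * cross1 u v & n2 = s * cross2 u v].
Proof.
move=> nc hu hv.
have nz : (cross0 u v, cross1 u v, cross2 u v) != (0, 0, 0).
  by apply: contra nc => /eqP; apply: cross_eq0.
have e01 : n0 * cross1 u v = n1 * cross0 u v.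
  move: hu hv; rewrite /pair_tr /cross0 /cross1 => hu hv.
  by apply: (eq_of_lincomb2 (k := - b v) (k' := b u) hu hv); ring.
have e02 : n0 * cross2 u v = n2 * cross0 u v.
  move: hu hv; rewrite /pair_tr /cross0 /cross2 => hu hv.
  by apply: (eq_of_lincomb2 (k := c v) (k' := - c u) hu hv); ring.
have e12 : n1 * cross2 u v = n2 * cross1 u v.
  move: hu hv; rewrite /pair_tr /cross1 /cross2 => hu hv.
  by apply: (eq_of_lincomb2 (k := - (a v - d v)) (k' := a u - d u) hu hv); ring.
move: nz e01 e02 e12; set w0 := cross0 u v; set w1 := cross1 u v; set w2 := cross2 u v.
move=> nz e01 e02 e12.
have [z0|z0] := eqVneq w0 0; last first.
  exists (n0 / w0); split; first by rewrite divfK.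
    by apply: (mulfI z0); rewrite mulrC -e01; field.
  by apply: (mulfI z0); rewrite mulrC -e02; field.
have [z1|z1] := eqVneq w1 0; last first.
  exists (n1 / w1); split; last 2 first.
  - by rewrite divfK.
  - by apply: (mulfI z1); rewrite mulrC -e12; field.
  by apply: (mulfI z1); rewrite mulrC e01; field.
have z2 : w2 != 0 by move: nz; rewrite z0 z1 !xpair_eqE eqxx.
exists (n2 / w2); split; last by rewrite divfK.
  by apply: (mulfI z2); rewrite mulrC e02; field.
by apply: (mulfI z2); rewrite mulrC e12; field.
Qed.

(* 1, g, h, g h is a basis of the matrix algebra. *)
Lemma traces_inj g h x y : ~ commute g h -> ~~ share g h ->
  tr x = tr y -> tr (g * x)%g = tr (g * y)%g -> tr (h * x)%g = tr (h * y)%g ->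
  tr (g * h * x)%g = tr (g * h * y)%g -> x = y.
Proof.
move=> ncom nsh t1 tg th tgh.
have nc : ~~ crossed X g h by apply/negP => /commute_crossed.
pose n0 := a x - a y; pose n1 := b x - b y; pose n2 := c x - c y.
have dd : d x - d y = - n0.
  by move: t1; rewrite /tr /n0 => t1; apply: (eq_of_lincomb1 (k := 1) t1); ring.
have hg : pair_tr X g n0 n1 n2 = 0.
  move: tg; rewrite /tr !sl2E /pair_tr => tg.
  by apply: (eq_of_lincomb2 (k := 1) (k' := - d g) tg dd); rewrite /n0 /n1 /n2; ring.
have hh : pair_tr X h n0 n1 n2 = 0.
  move: th; rewrite /tr !sl2E /pair_tr => th.
  by apply: (eq_of_lincomb2 (k := 1) (k' := - d h) th dd); rewrite /n0 /n1 /n2; ring.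
have hgh : pair_tr X (g * h)%g n0 n1 n2 = 0.
  move: tgh; rewrite /tr /pair_tr !(sl2_Ma _ (g * h)%g) !(sl2_Md _ (g * h)%g) => tgh.
  by apply: (eq_of_lincomb2 (k := 1) (k' := - d (g * h)%g) tgh dd); rewrite /n0 /n1 /n2; ring.
have [s [s0 s1 s2]] := orthogonal_cross nc hg hh.
have [z|nz] := eqVneq s 0.
  move: s0 s1 s2; rewrite z !mul0r => s0 s1 s2; move: dd; rewrite s0 oppr0.
  move: s0 s1 s2 => /eqP; rewrite subr_eq0 => /eqP ha /eqP; rewrite subr_eq0 => /eqP hb.
  move=> /eqP; rewrite subr_eq0 => /eqP hc /eqP; rewrite subr_eq0 => /eqP hd.
  exact: (sl2_inj ha hb hc hd).
(* The difference of [x] and [y] is [s] times the commutator of [g] and [h]. Orthogonality to [g h]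
   makes the commutator nilpotent, and its kernel is a common eigenline. *)
case/negP: nsh.
apply: (share_of_nilpotent (n0 := cross0 g h) (n1 := cross1 g h) (n2 := cross2 g h)).
- by apply: contra nc => /eqP; apply: cross_eq0.
- apply: (mulfI nz); rewrite mulr0; move: hgh; rewrite /pair_tr s0 s1 s2 !sl2E => hgh.
  by apply: (eq_of_lincomb1 (k := -1) hgh); rewrite /cross0 /cross1 /cross2; ring.
- exact: pair_tr_cross_l.
- exact: pair_tr_cross_r.
Qed.

(** The degenerate pairs that the fibre count excludes: x y = 1, or a common eigenline. *)
Definition bad x y : bool := (x == y^-1)%g || share x y.

(* With u = x y and v = y z, the conditions tr y = tr (u y^-1) = tr (y^-1 v) = t are affine
   in y, so y lies on the intersection of a line with the quadric det = 1. *)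
Lemma fibre_le2 (t : F) u v (S : {set gT}) : t != 0 ->
  (forall y, y \in S -> [/\ tr y = t, tr (u * y^-1)%g = t, tr (y^-1 * v)%g = t,
     ~~ bad (u * y^-1)%g y & ((y^-1 * v != y^-1)%g && (y^-1 * v != y^-1 * u)%g)]) ->
  (#|S| <= 2)%N.
Proof.
move=> t0 hS; rewrite leqNgt; apply/negP => /card_gt2P[y1 [y2 [y3 [[S1 S2 S3] [n12 n23 n31]]]]].
have [ty1 tx1 tz1] := hS _ S1; rewrite negb_or => /andP[nx1 nsh1] /andP[nz1 nz1'].
have [ty2 tx2 tz2 _ _] := hS _ S2; have [ty3 tx3 tz3 _ _] := hS _ S3.
have [cr|nc] := boolP (crossed X u v).
  have [su|nu] := boolP (sl2_scalar u).
    case/and3P: su => /eqP ub /eqP uc /eqP uad.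
    have ud : d u = 1.
      apply: (mulIf t0); rewrite mul1r -[in RHS]tx1 -ty1 /tr !sl2E ub uc uad; ring.
    have u1 : u = 1%g.
      have [h1 h2 h3 h4] := @sl2_1 F gT X.
      by apply: (sl2_inj (s := X)); rewrite ?h1 ?h2 ?h3 ?h4 ?uad.
    by move: nx1; rewrite u1 mul1g eqxx.
  have [al [be [va vb vc vd]]] := crossed_span nu cr.
  have ab : al + be = 1.
    apply: (mulIf t0); rewrite mul1r -[RHS]tz1.
    move: tx1 ty1; rewrite /tr !sl2E va vb vc vd => tx1 ty1.
    by apply: (eq_of_lincomb2 (k := - be) (k' := - al) tx1 ty1); ring.
  have detv := sl2_det X v; have detu := sl2_det X u.
  (* Here v = al + be u with [al + be = 1], and the determinants of [u] and [v] are 1. The first two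
     factors lead to the excluded values of z = y^-1 v, the third to a unipotent x y. *)
  have key : al * be * (tr u - 2) = 0.
    move: detv; rewrite va vb vc vd /tr => detv.
    by apply: (eq_of_lincomb3 (k := 1) (k' := - be ^+ 2) (k'' := - (al + be + 1))
                 detv detu ab); ring.
  move/eqP: key; rewrite !mulf_eq0 subr_eq0 -orbA => /or3P[/eqP al0|/eqP be0|/eqP tru].
  - move: ab; rewrite al0 add0r => be1; case/negP: nz1'; apply/eqP; congr (_ * _)%g.
    by apply: (sl2_inj (s := X)); rewrite ?va ?vb ?vc ?vd ?al0 ?be1; ring.
  - move: ab; rewrite be0 addr0 => al1; case/negP: nz1; apply/eqP.
    rewrite (_ : v = 1%g) ?mulg1 //; have [h1 h2 h3 h4] := @sl2_1 F gT X.
    by apply: (sl2_inj (s := X)); rewrite ?va ?vb ?vc ?vd ?h1 ?h2 ?h3 ?h4 ?al1 ?be0; ring.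
  case/negP: nsh1; move: nx1 tx1; have : tr (u * y1^-1 * y1)%g = 2 by rewrite mulgKV.
  move: (u * y1^-1)%g => x1 trxy nx1 tx1.
  have dy := sl2_det X y1; have dx := sl2_det X x1.
  (* The nilpotent matrix is x - y^-1: equal traces make it traceless, and tr (x y) = 2 makes its
     determinant 0. *)
  apply: (share_of_nilpotent (n0 := a x1 - d y1) (n1 := b x1 + b y1) (n2 := c x1 + c y1)).
  - apply: contra nx1 => /eqP[h0 h1 h2]; apply/eqP; apply: (sl2_inj (s := X)); rewrite sl2E.
    + by apply: (eq_of_lincomb1 (k := 1) h0); ring.
    + by apply: (eq_of_lincomb1 (k := 1) h1); ring.
    + by apply: (eq_of_lincomb1 (k := 1) h2); ring.
    move: tx1; rewrite -ty1 /tr => tx1.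
    by apply: (eq_of_lincomb2 (k := 1) (k' := -1) tx1 h0); ring.
  - move: trxy tx1; rewrite -ty1 /tr !sl2E => trxy tx1.
    have e : d y1 = a x1 + d x1 - a y1 by apply: (eq_of_lincomb1 (k := -1) tx1); ring.
    rewrite e in trxy dy *.
    by apply: (eq_of_lincomb3 (k := 1) (k' := -1) (k'' := -1) trxy dy dx); ring.
  - move: trxy tx1; rewrite -ty1 /tr /pair_tr !sl2E => trxy tx1.
    have e : d y1 = a x1 + d x1 - a y1 by apply: (eq_of_lincomb1 (k := -1) tx1); ring.
    rewrite e in trxy dy *.
    by apply: (eq_of_lincomb2 (k := 1) (k' := -2) trxy dx); ring.
  - move: trxy tx1; rewrite -ty1 /tr /pair_tr !sl2E => trxy tx1.
    have e : d y1 = a x1 + d x1 - a y1 by apply: (eq_of_lincomb1 (k := -1) tx1); ring.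
    rewrite e in trxy dy *.
    by apply: (eq_of_lincomb2 (k := 1) (k' := -2) trxy dy); ring.
(* When [u] and [v] do not commute, all solutions lie on the line through [y1] in the direction n of
   the commutator. *)
have diff y : tr y = t -> tr (u * y^-1)%g = t -> tr (y^-1 * v)%g = t -> exists s,
    [/\ a y = a y1 + s * cross0 u v, b y = b y1 + s * cross1 u v,
        c y = c y1 + s * cross2 u v & d y = d y1 - s * cross0 u v].
  move=> ty tx tz.
  have dd : d y - d y1 = - (a y - a y1).
    by move: ty; rewrite -ty1 /tr => h; apply: (eq_of_lincomb1 (k := 1) h); ring.
  have hu : pair_tr X u (a y - a y1) (b y - b y1) (c y - c y1) = 0.
    move: tx; rewrite -tx1 /tr !sl2E /pair_tr => h.
    by apply: (eq_of_lincomb2 (k := -1) (k' := a u) h dd); ring.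
  have hv : pair_tr X v (a y - a y1) (b y - b y1) (c y - c y1) = 0.
    move: tz; rewrite -tz1 /tr !sl2E /pair_tr => h.
    by apply: (eq_of_lincomb2 (k := -1) (k' := a v) h dd); ring.
  have [s [s0 s1 s2]] := orthogonal_cross nc hu hv.
  exists s; split; try by rewrite -?s0 -?s1 -?s2; ring.
  by move: dd; rewrite s0 => dd; apply: (eq_of_lincomb1 (k := 1) dd); ring.
have [s [sa sb sc sd]] := diff y2 ty2 tx2 tz2.
have [r [ra rb rc rd]] := diff y3 ty3 tx3 tz3.
have s0 : s != 0.
  apply: contra n12 => /eqP z; apply/eqP; apply: (sl2_inj (s := X));
    by rewrite ?sa ?sb ?sc ?sd z; ring.
have r0 : r != 0.
  apply: contra n31 => /eqP z; apply/eqP; apply: (sl2_inj (s := X));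
    by rewrite ?ra ?rb ?rc ?rd z; ring.
have sr : s - r != 0.
  rewrite subr_eq0; apply: contra n23 => /eqP z; apply/eqP; apply: (sl2_inj (s := X));
    by rewrite ?ra ?rb ?rc ?rd ?sa ?sb ?sc ?sd z; ring.
have d1 := sl2_det X y1; have d2 := sl2_det X y2; have d3 := sl2_det X y3.
rewrite sa sb sc sd in d2; rewrite ra rb rc rd in d3.
(* The determinant of y1 + s n is 1 - s P - s^2 Q. Three points with determinant 1 force P = Q = 0;
   then n is nilpotent and its kernel is fixed by [u] and [y1], hence by x = u y1^-1. *)
pose Q := cross0 u v ^+ 2 + cross1 u v * cross2 u v.
pose P := pair_tr X y1 (cross0 u v) (cross1 u v) (cross2 u v).
have e2 : P + s * Q = 0.
  apply: (mulfI s0); rewrite mulr0 /P /Q /pair_tr.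
  by apply: (eq_of_lincomb2 (k := -1) (k' := 1) d2 d1); ring.
have e3 : P + r * Q = 0.
  apply: (mulfI r0); rewrite mulr0 /P /Q /pair_tr.
  by apply: (eq_of_lincomb2 (k := -1) (k' := 1) d3 d1); ring.
have Q0 : Q = 0.
  by apply: (mulfI sr); rewrite mulr0; apply: (eq_of_lincomb2 (k := 1) (k' := -1) e2 e3); ring.
have P0 : P = 0 by move: e2; rewrite Q0 mulr0 addr0.
have nz : (cross0 u v, cross1 u v, cross2 u v) != (0, 0, 0).
  by apply: contra nc => /eqP; apply: cross_eq0.
have [e enz he] := nilpotent_eigenvector X nz Q0.
case/negP: nsh1; apply/existsP; exists e; rewrite (he _ P0) andbT.
apply: borel_eig => //; rewrite groupM ?groupV //; apply: eig_borel; apply: he => //.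
exact: pair_tr_cross_l.
Qed.

(** Writing y = s + r x, trace and determinant give r^2 (4 - (tr x)^2) = 4 - t^2. This fixes r up to
    sign, and the trace then fixes s. *)
Lemma card_cent1_trace x (t : F) : 2 != 0 :> F -> tr x ^+ 2 != 4 ->
  (#|[set y in 'C[x]%g | tr y == t]| <= 2)%N.
Proof.
move=> two_neq0 regx; have nx : ~~ sl2_scalar x by apply: contra regx => /tr_sl2_scalar ->.
have T0 : 4 - tr x ^+ 2 != 0 by rewrite subr_eq0 eq_sym.
rewrite leqNgt; apply/negP => /card_gt2P[y1 [y2 [y3 [[]]]]].
move=> /setIdP[/(cent1_span nx)[s1 [t1 [a1 b1 c1 d1]]] /eqP tr1].
move=> /setIdP[/(cent1_span nx)[s2 [t2 [a2 b2 c2 d2]]] /eqP tr2].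
move=> /setIdP[/(cent1_span nx)[s3 [t3 [a3 b3 c3 d3]]] /eqP tr3] [n12 n23 n31].
have dx := sl2_det X x.
have sq y s r : a y = s + r * a x -> b y = r * b x -> c y = r * c x -> d y = s + r * d x ->
    tr y = t -> r ^+ 2 * (4 - tr x ^+ 2) = 4 - t ^+ 2 /\ 2 * s = t - r * tr x.
  move=> ya yb yc yd ty; have dy := sl2_det X y; rewrite ya yb yc yd in dy.
  have e : 2 * s = t - r * tr x by rewrite -ty /tr ya yd; ring.
  split=> //; rewrite -ty /tr ya yd.
  by apply: (eq_of_lincomb2 (k := 4) (k' := - 4 * r ^+ 2) dy dx); ring.
have [q1 l1] := sq _ _ _ a1 b1 c1 d1 tr1; have [q2 l2] := sq _ _ _ a2 b2 c2 d2 tr2.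
have [q3 l3] := sq _ _ _ a3 b3 c3 d3 tr3.
have eqy r s : r ^+ 2 * (4 - tr x ^+ 2) = 4 - t ^+ 2 ->
    s ^+ 2 * (4 - tr x ^+ 2) = 4 - t ^+ 2 -> r = s \/ r = - s.
  move=> h1 h2; have /eqP : r ^+ 2 = s ^+ 2 by apply: (mulIf T0); rewrite h1 h2.
  by rewrite eqf_sqr => /orP[/eqP|/eqP]; [left|right].
have same y y' s s' r r' : a y = s + r * a x -> b y = r * b x -> c y = r * c x ->
    d y = s + r * d x -> a y' = s' + r' * a x -> b y' = r' * b x -> c y' = r' * c x ->
    d y' = s' + r' * d x -> 2 * s = t - r * tr x -> 2 * s' = t - r' * tr x -> r = r' -> y = y'.
  move=> ya yb yc yd ya' yb' yc' yd' ls ls' er; rewrite -er in ya' yb' yc' yd' ls'.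
  have es : s = s' by apply: (mulfI two_neq0); rewrite ls ls'.
  by apply: (sl2_inj (s := X)); rewrite ?ya ?yb ?yc ?yd ?ya' ?yb' ?yc' ?yd' ?es.
case: (eqy _ _ q1 q2) => e12; first by case/eqP: n12; apply: (same y1 y2 s1 s2 t1 t2).
case: (eqy _ _ q3 q2) => e32; first by case/eqP: n23; apply/esym; apply: (same y3 y2 s3 s2 t3 t2).
by case/eqP: n31; apply: (same y3 y1 s3 s1 t3 t1); rewrite // e32 e12.
Qed.

Lemma card_cent1 x : 2 != 0 :> F -> tr x ^+ 2 != 4 -> (#|'C[x]%g| <= 2 * #|F|)%N.
Proof.
move=> two_neq0 regx; have -> : #|'C[x]%g| = (\sum_(t : F) #|[set y in 'C[x]%g | tr y == t]|)%N.
  rewrite -sum1_card (partition_big tr predT) //=; apply: eq_bigr => t _.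
  by rewrite -sum1dep_card.
apply: leq_trans (_ : \sum_(t : F) 2 <= _)%N; first by apply: leq_sum => t _; apply: card_cent1_trace.
by rewrite sum_nat_const mulnC.
Qed.

Lemma card_sl2_le : (#|gT| <= #|F| ^ 4)%N.
Proof.
have -> : (#|F| ^ 4 = #|{: F * F * F * F}|)%N by rewrite !card_prod !expnS muln1 !mulnA.
apply: (@leq_card _ _ (fun g => (a g, b g, c g, d g))) => x y [].
exact: sl2_inj.
Qed.

Lemma card_sl2_ge : (#|F| ^ 3 <= 2 * #|gT|)%N.
Proof.
have q2 : (1 < #|F|)%N by apply: card_finNzRing_gt1.
suff h : (#|F|.-1 * #|F| ^ 2 <= #|gT|)%N.
  have : (#|F| <= 2 * #|F|.-1)%N by lia.
  by rewrite (expnS _ 2) -(leq_pmul2r (_ : 0 < #|F| ^ 2))%N ?expn_gt0 ?(ltnW q2) //; lia.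
have -> : (#|F|.-1 * #|F| ^ 2 = #|[set x : F | x != 0%R]| * #|{: F * F}|)%N.
  rewrite card_prod expnS expn1; congr (_ * _)%N.
  by rewrite -(cardsC1 (0 : F)); apply: eq_card => x; rewrite !inE.
rewrite -cardsT -cardsX.
pose f (g : gT) := (a g, (b g, c g)).
apply: leq_trans (leq_imset_card f predT); apply: subset_leq_card.
apply/subsetP => -[x [y z]]; rewrite !inE andbT /= => nx.
have [|g [ga gb gc _]] := @sl2_surj F gT X x y z ((1 + y * z) / x); first by field.
by apply/imsetP; exists g; rewrite // /f ga gb gc.
Qed.

End SL2Fibres.

(** * Growth in SL_2 *)

Lemma exists_le_average (R : realType) (I : finType) (w F : I -> R) (P : pred I) (t : R) :
  (forall i, 0 <= w i) -> \sum_(i | P i) w i = 1 ->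
  \sum_(i | P i) w i * F i <= t -> exists2 i, P i & F i <= t.
Proof.
move=> w0 w1 H.
(* The reflection [1 + t - F i] moves the threshold to 1, which is positive. *)
have [|||i Pi hi] := @exists_ge_average R I w (fun i => 1 + t - F i) P 1 w0.
- by rewrite w1.
- exact: ltr01.
- have -> : \sum_(i | P i) w i * (1 + t - F i) =
     (1 + t) * (\sum_(i | P i) w i) - \sum_(i | P i) w i * F i.
    by rewrite mulr_sumr -sumrB; apply: eq_bigr => i _; ring.
  by rewrite w1; lra.
by exists i => //; lra.
Qed.

Lemma card_le_fibres (I J : finType) (f : I -> J) (A : {set I}) (B : {set J}) (n : nat) :
  (forall x, x \in A -> f x \in B) ->
  (forall y, y \in B -> #|[set x in A | f x == y]| <= n)%N -> (#|A| <= #|B| * n)%N.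
Proof.
move=> hB hn; rewrite -[leqLHS]muln1.
apply: (@double_count_le _ _ _ _ (fun x y => f x == y)) => // x xA.
by rewrite card_gt0; apply/set0Pn; exists (f x); rewrite inE hB //=.
Qed.

(** * Powers of a symmetric set *)

Section SetPowers.
Variables (gT : finGroupType) (A : {set gT}).
Hypothesis A1 : 1%g \in A.

Lemma expgs_subset m n : (m <= n)%N -> (A ^+ m \subset A ^+ n)%g.
Proof.
move=> /subnK <-; elim: (n - m)%N => [|k IH] //.
apply: subset_trans IH _; rewrite addSn expgS.
by apply/subsetP => x xA; rewrite -[x]mul1g mem_mulg.
Qed.

Lemma mem_expgsD m n x y : x \in (A ^+ m)%g -> y \in (A ^+ n)%g ->
  (x * y \in A ^+ (m + n))%g.
Proof. by move=> hx hy; rewrite expgD mem_mulg. Qed.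

Lemma mem_expgs1 x : x \in A -> (x \in A ^+ 1)%g.
Proof. by rewrite expg1. Qed.

Hypothesis AV : (A^-1)%g = A.

Lemma memV_sym x : x \in A -> x^-1%g \in A.
Proof. by move=> xA; rewrite -AV inE invgK. Qed.

(** Multiply [A] by the part of A^m in [H]: two factorisations x y = x0 y0 of one product give x0^-1
    x = y0 y^-1, an element of A^2 in [H]. *)
Lemma card_expgs_group (H : {group gT}) m :
  (#|A| * #|A ^+ m :&: H| <= #|A ^+ m.+1| * #|A ^+ 2 :&: H|)%N%g.
Proof.
rewrite -cardsX; apply: (card_le_fibres (f := fun u => (u.1 * u.2)%g)).
  move=> [x y]; rewrite !inE /= => /and3P[xA yA _].
  by rewrite expgS mem_mulg.
move=> z _; have [->|[[x0 y0] u0]] := set_0Vmem [set u in setX A (A ^+ m :&: H)%g | (u.1 * u.2)%g == z].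
  by rewrite cards0.
have inj : {in [set u in setX A (A ^+ m :&: H)%g | (u.1 * u.2)%g == z] &,
    injective (fun u => (x0^-1 * u.1)%g)}.
  move=> [x y] [x' y']; rewrite !inE /= => /andP[_ /eqP e] /andP[_ /eqP e'] /mulgI ex.
  by move: e'; rewrite -e ex => /mulgI ->.
rewrite -(card_in_imset inj); apply: subset_leq_card.
apply/subsetP => _ /imsetP[[x y] hu ->] /=.
move: hu u0; rewrite !inE /= => /andP[/and3P[xA _ yH] /eqP e] /andP[/and3P[x0A _ y0H] /eqP e0].
apply/andP; split; first by rewrite (expgS _ 1) expg1 mem_mulg ?memV_sym.
have -> : (x0^-1 * x = y0 * y^-1)%g.
  by apply: (mulgI x0); rewrite mulKVg mulgA e0 -e mulgK.
by rewrite groupM ?groupV.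
Qed.

End SetPowers.

(** * Escape from cosets of proper subgroups *)

Section Spread.
Variables (R : realType) (F : finFieldType) (gT : finGroupType) (X : sl2_coord F gT).
Variables (A : {set gT}) (w : gT -> R).
Implicit Types (g h x y z : gT) (P Q : pred gT).

Local Notation tr := (tr X).
Local Notation share := (share X).
Local Notation scal := (sl2_scalar X).

Definition mass P : R := \sum_(x in A | P x) w x.

(** The bound 1/20 lets five cosets together carry mass at most 1/4, as [mass_bad] requires. *)
Definition spread := [/\ forall x, 0 <= w x, \sum_(x in A) w x = 1 &
  forall (H : {group gT}) g, H \proper [set: gT] -> mass (mem (g *: H)%g) <= 1 / 20].

Hypothesis sp : spread.

Lemma mass_mono P Q : (forall x, x \in A -> P x -> Q x) -> mass P <= mass Q.
Proof.
case: sp => w0 _ _ PQ; rewrite /mass [leRHS]big_mkcondr [leLHS]big_mkcondr /=.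
apply: ler_sum => x xA; have := PQ x xA; case: (P x) => [->//|_].
by case: ifP.
Qed.

Lemma massU P Q : mass (predU P Q) <= mass P + mass Q.
Proof.
case: sp => w0 _ _; rewrite /mass !big_mkcondr /= -big_split /=.
by apply: ler_sum => x _; have := w0 x; case: (P x); case: (Q x) => /=; lra.
Qed.

Lemma mass_coset (H : {group gT}) P : H \proper [set: gT] ->
  (forall x y, P x -> P y -> (x^-1 * y)%g \in H) -> mass P <= 1 / 20.
Proof.
move=> pH PH; case: sp => w0 _ spr.
case: (pickP P) => [x0 Px0|none]; last first.
  by rewrite /mass big1 ?divr_ge0 // => x; rewrite none andbF.
apply: le_trans (spr H x0 pH); apply: mass_mono => x _ Px.
by rewrite /= mem_lcoset PH.
Qed.

Lemma mass_cent1 x : ~~ scal x -> mass (mem 'C[x]%g) <= 1 / 20.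
Proof.
move=> nx; apply: (mass_coset (H := 'C[x]%G)); first exact: cent1_proper nx.
by move=> y z; rewrite /= => hy hz; rewrite groupM ?groupV.
Qed.

(** The elements carrying one line to another lie in a single left coset of a Borel subgroup. *)
Lemma mass_parallel e e' : e != (0, 0) -> e' != (0, 0) ->
  mass (fun g => parallel (vact X g e) e') <= 1 / 20.
Proof.
move=> nz nz'; apply: (mass_coset (H := borel X e)); first exact: borel_proper.
move=> x y hx hy; rewrite mem_borel -(parallel_vact X x) -vactM mulKVg.
by apply: parallel_trans hy _ => //; rewrite parallelC.
Qed.

(* The elements g lie in the union of five cosets: one of 'C[x], and one of the stabiliser
   of an eigenline of x for each pair of eigenlines of x and y. *)
Lemma mass_bad x y : ~~ scal x -> ~~ scal y ->
  mass (fun g => bad X (g * x * g^-1)%g y) <= 1 / 4.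
Proof.
move=> nx ny.
have [e1 [e2 [n1 n2 he]]] := eigenlines nx; have [f1 [f2 [m1 m2 hf]]] := eigenlines ny.
pose q e f g := parallel (vact X g e) f.
pose q0 g := (g * x * g^-1 == y^-1)%g.
have h0 : mass q0 <= 1 / 20.
  apply: (mass_coset (H := 'C[x]%G)); first exact: cent1_proper nx.
  rewrite /q0 => g h /eqP hg /eqP hh; apply/cent1P; rewrite /commute.
  have e : (g * x * g^-1 = h * x * h^-1)%g by rewrite hg hh.
  transitivity (g^-1 * (h * x * h^-1) * h)%g; first by rewrite !mulgA mulgKV.
  by rewrite -e !mulgA mulVg mul1g.
have := massU q0 (predU (predU (q e1 f1) (q e1 f2)) (predU (q e2 f1) (q e2 f2))).
have := massU (predU (q e1 f1) (q e1 f2)) (predU (q e2 f1) (q e2 f2)).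
have := massU (q e1 f1) (q e1 f2); have := massU (q e2 f1) (q e2 f2).
have := mass_parallel n1 m1; have := mass_parallel n1 m2; have := mass_parallel n2 m1; have := mass_parallel n2 m2.
rewrite -/(q e1 f1) -/(q e1 f2) -/(q e2 f1) -/(q e2 f2).
have : mass (fun g => bad X (g * x * g^-1)%g y) <=
  mass (predU q0 (predU (predU (q e1 f1) (q e1 f2)) (predU (q e2 f1) (q e2 f2)))).
  apply: mass_mono => g _; rewrite /bad /= => /orP[h|]; first by rewrite /q0 h.
  case/existsP => e /andP[/andP[enz eg] ey]; apply/orP; right.
  pose e' := vact X g^-1%g e.
  have e'nz : e' != (0, 0) by rewrite vact_eq0.
  have ge' : vact X g e' = e by rewrite -vactM mulgV vact1.
  have xe' : eig X x e'.
    rewrite /eig e'nz /= -(parallel_vact X g) ge' /e' -!vactM.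
    by rewrite ?mulgA.
  have key e0 f0 : parallel e' e0 -> parallel e f0 -> q e0 f0 g.
    move=> h1 h2; rewrite /q; apply: parallel_trans h2 => //.
    by rewrite -ge' parallel_vact parallelC.
  case/orP: (he _ xe') => h1; case/orP: (hf _ ey) => h2; rewrite /=.
  - by rewrite (key _ _ h1 h2).
  - by rewrite (key _ _ h1 h2) orbT.
  - by rewrite (key _ _ h1 h2) !orbT.
  - by rewrite (key _ _ h1 h2) !orbT.
by lra.
Qed.

Lemma exists_not_mass P : mass P < 1 -> exists2 x, x \in A & ~~ P x.
Proof.
move=> h; case: (pickP (fun x => (x \in A) && ~~ P x)) => [x /andP[]|none]; first by exists x.
case: sp => _ w1 _; move: h; rewrite -w1 /mass (eq_bigl (mem A)) ?ltxx //.
by move=> x /=; have := none x; case: (x \in A) => //= /negbFE ->.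
Qed.

Lemma generate_spread : (<<A>> = [set: gT])%g.
Proof.
apply/eqP; rewrite eqEproper subsetT /=; apply/negP => pr.
have := mass_coset (P := mem <<A>>%g) pr.
case: sp => w0 w1 _; rewrite /mass (eq_bigl (mem A)); last first.
  by move=> x /=; case xA: (x \in A) => //=; rewrite mem_gen.
rewrite w1 => /(_ _); have: ~ (1 <= 1 / 20 :> R) by lra.
by move=> h hh; apply: h; apply: hh => x y hx hy; rewrite groupM ?groupV.
Qed.

(** Take [g] outside the centraliser of an elementary unipotent, so that it is nonscalar, then [h]
    outside the centraliser of [g] and the stabilisers of its eigenlines: three cosets of mass at
    most 3/20. *)
Lemma exists_free_pair : exists g h, [/\ g \in A, h \in A, ~ commute g h & ~~ share g h].
Proof.
have lt n : n <= 3 / 20 :> R -> n < 1 by lra.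
have [u [ua ub uc ud]] := sl2_upper X 1.
have nu : ~~ scal u by rewrite /sl2_scalar ub oner_eq0.
have [|g gA ng] := @exists_not_mass (mem 'C[u]%g).
  by apply: lt; apply: le_trans (mass_cent1 nu) _; lra.
have nsg : ~~ scal g.
  apply: contra ng => /and3P[/eqP gb /eqP gc /eqP gad]; apply/cent1P.
  apply: (@commute_crossed _ _ X); rewrite /crossed gb gc gad subrr.
  by rewrite !mulr0 !mul0r eqxx.
have [e1 [e2 [n1 n2 he]]] := eigenlines nsg.
have [|h hA nh] := @exists_not_mass (predU (mem 'C[g]%g) (predU (fun h => parallel (vact X h e1) e1)
    (fun h => parallel (vact X h e2) e2))).
  apply: lt; apply: le_trans (massU _ _) _.
  have := mass_cent1 nsg; have := mass_parallel n1 n1; have := mass_parallel n2 n2.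
  have := massU (fun h => parallel (vact X h e1) e1) (fun h => parallel (vact X h e2) e2).
  by lra.
exists g, h; move: nh; rewrite /= !negb_or => /and3P[nc h1 h2]; split=> //.
  by move=> com; case/negP: nc; apply/cent1P.
apply/negP => /existsP[e /andP[ge /andP[enz ehe]]].
have fx e0 : e0 != (0, 0) -> parallel e e0 -> parallel (vact X h e0) e0.
  move=> nz0 c0; apply: (@parallel_trans _ (vact X h e)); first by rewrite vact_eq0.
    by rewrite parallel_vact parallelC.
  exact: parallel_trans ehe c0.
by case/orP: (he _ ge) => /fx hh; [case/negP: h1|case/negP: h2]; apply: hh.
Qed.

End Spread.

(** * Rich tori and the growth dichotomy *)

Section Growth.
Variables (R : realType) (F : finFieldType) (gT : finGroupType) (X : sl2_coord F gT).
Variables (A : {set gT}) (w : gT -> R) (L : nat).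
Implicit Types (g h x y z r : gT).

Local Notation tr := (tr X).
Local Notation share := (share X).
Local Notation scal := (sl2_scalar X).

Hypothesis two_neq0 : 2 != 0 :> F.
Hypothesis A1 : 1%g \in A.
Hypothesis AV : (A^-1)%g = A.
Hypothesis small : (#|(A ^+ 12)%g| <= L * #|A|)%N.
Hypothesis sp : spread A w.

(** Nonzero trace is what [fibre_le2] needs; the second condition excludes plus or minus unipotents,
    so that the centraliser is a maximal torus. *)
Definition regular x : bool := (tr x != 0) && (tr x ^+ 2 != 4).

Lemma regular_nscal x : regular x -> ~~ scal x.
Proof. by case/andP=> _; apply: contra => /tr_sl2_scalar ->. Qed.

Lemma regularJ x y : regular (y * x * y^-1)%g = regular x.
Proof. by rewrite /regular trJ. Qed.

Lemma card_pow n : (n <= 12)%N -> (#|(A ^+ n)%g| <= L * #|A|)%N.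
Proof.
by move=> hn; apply: leq_trans small; apply: subset_leq_card; apply: expgs_subset.
Qed.

Lemma cardA_gt0 : (0 < #|A|)%N.
Proof. by rewrite card_gt0; apply/set0Pn; exists 1%g. Qed.

Lemma L_gt0 : (0 < L)%N.
Proof.
rewrite lt0n; apply/negP => /eqP L0.
by have := @card_pow 1 isT; rewrite expg1 L0 mul0n leqNgt cardA_gt0.
Qed.

Lemma nregular_trace x : ~~ regular x -> tr x \in [set 0; 2; - 2].
Proof.
rewrite negb_and !negbK !inE => /orP[-> //|].
have -> : (4 : F) = 2 ^+ 2 by ring.
by rewrite eqf_sqr => /orP[] ->; rewrite ?orbT.
Qed.

(** Otherwise all traces on A^3 lie in a set of size three. By [traces_inj] four such traces
    determine an element of [A], so [A] has at most 3^4 = 81 elements. *)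
Lemma exists_regular : (81 < #|A|)%N -> exists2 r, r \in (A ^+ 3)%g & regular r.
Proof.
move=> hA; case: (pickP (fun r => (r \in A ^+ 3)%g && regular r)) => [r /andP[]|none].
  by exists r.
have [g [h [gA hA' ncom nsh]]] := exists_free_pair X sp.
have tri x : x \in (A ^+ 3)%g -> tr x \in [set 0; 2; - 2].
  by move=> xA; apply: nregular_trace; have := none x; rewrite xA /= => ->.
pose T : {set F} := [set 0; 2; - 2].
have T3 : (#|T| <= 3)%N.
  by rewrite /T -!setUA; do 2 (rewrite cardsU1; apply: leq_trans (leq_add (leq_b1 _) (leqnn _)) _; rewrite ?ltnS ?add1n ?ltnS); rewrite ?cards1.
pose f x := (tr x, tr (g * x)%g, tr (h * x)%g, tr (g * h * x)%g).
have finj : {in A &, injective f}.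
  by move=> x y _ _ [t1 t2 t3 t4]; apply: (traces_inj ncom nsh t1 t2 t3 t4).
have : (#|f @: A| <= #|setX (setX (setX T T) T) T|)%N.
  apply: subset_leq_card; apply/subsetP => _ /imsetP[x xA ->].
  have x1 := mem_expgs1 xA; have g1 := mem_expgs1 gA; have h1 := mem_expgs1 hA'.
  have up m y : (m <= 3)%N -> y \in (A ^+ m)%g -> y \in (A ^+ 3)%g.
    by move=> hm; apply/subsetP; apply: expgs_subset.
  rewrite !in_setX /=; apply/andP; split; [apply/andP; split; [apply/andP; split|]|]; apply: tri.
  - exact: up x1.
  - exact: up (mem_expgsD g1 x1).
  - exact: up (mem_expgsD h1 x1).
  - exact: up (mem_expgsD (mem_expgsD g1 h1) x1).
rewrite card_in_imset // !cardsX.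
have : (#|T| * #|T| * #|T| * #|T| <= 3 * 3 * 3 * 3)%N by rewrite !leq_mul.
by lia.
Qed.

Section OneTorus.
Variable r : gT.
Hypothesis rA : r \in (A ^+ 3)%g.
Hypothesis rreg : regular r.

Let S : {set gT} := [set (h * r * h^-1)%g | h in A].

Lemma mem_S x : x \in S -> [/\ x \in (A ^+ 5)%g, tr x = tr r & ~~ scal x].
Proof.
case/imsetP=> h hA ->; rewrite trJ; split=> //; last by rewrite regular_nscal ?regularJ.
apply: (mem_expgsD (m := 4) (n := 1)); last by rewrite expg1 memV_sym.
by apply: (mem_expgsD (m := 1) (n := 3)); rewrite ?expg1.
Qed.

(** By [mass_bad] each pair is bad for conjugators [g] of mass at most 1/4; averaging over [g]
    yields one for which at most a quarter of the pairs are bad. *)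
Lemma exists_few_bad : exists2 g, g \in A &
  (4 * #|[set u in setX S S | bad X (g * u.1 * g^-1)%g u.2]| <= #|S| ^ 2)%N.
Proof.
pose N g := #|[set u in setX S S | bad X (g * u.1 * g^-1)%g u.2]|.
case: (sp) => w0 w1 _.
have [|g gA hg] := @exists_le_average R gT w (fun g => (N g)%:R) (mem A) ((#|S| ^ 2)%:R / 4) w0 w1.
  have -> : \sum_(g in A) w g * (N g)%:R =
      \sum_(u in setX S S) mass A w (fun g => bad X (g * u.1 * g^-1)%g u.2).
    rewrite /mass; under [RHS]eq_bigr do rewrite big_mkcondr.
    rewrite exchange_big; apply: eq_bigr => g _ /=.
    rewrite -big_mkcondr sumr_const mulr_natr; congr (_ *+ _).
    by apply: eq_card => u; rewrite [LHS]in_set.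
  apply: (@le_trans _ _ (\sum_(u in setX S S) 1 / 4)).
    apply: ler_sum => u; rewrite inE => /andP[u1 u2].
    by apply: (mass_bad sp); case: (mem_S u1) (mem_S u2) => _ _ h1 [_ _ h2].
  by rewrite sumr_const cardsX expnS expn1 div1r -(mulr_natl (4^-1)).
exists g => //; rewrite -(ler_nat R) natrM.
by move: hg; rewrite -/(N g) ler_pdivlMr // mulrC.
Qed.

(** Good triples map by (x, y, z) to (g x g^-1 y, y z) with fibres of size at most 2. As [S] lies in
    A^5, the image lies in A^12 in each coordinate, since 1 + 5 + 1 + 5 = 12. *)
Lemma card_S_cube : (#|S| ^ 3 <= 512 * L ^ 2 * #|A| ^ 2)%N.
Proof.
have [g gA few] := exists_few_bad.
set Bad := [set u in setX S S | _] in few.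
have t0 : tr r != 0 by case/andP: rreg.
pose Good := [set u in setX (setX S S) S | [&& ~~ bad X (g * u.1.1 * g^-1)%g u.1.2,
   (u.2 != u.1.2^-1)%g & (u.2 != u.1.2^-1 * (g * u.1.1 * g^-1) * u.1.2)%g]].
pose B2 := [set (u, u.2^-1%g) | u in setX S S].
pose B3 := [set (u, u.2^-1 * (g * u.1 * g^-1) * u.2)%g | u in setX S S].
have cover : setX (setX S S) S \subset (Good :|: setX Bad S) :|: (B2 :|: B3).
  apply/subsetP => -[[x y] z]; rewrite !in_setX => /andP[/andP[xS yS] zS].
  rewrite !in_setU !in_setX [_ \in Good]inE [_ \in Bad]inE !in_setX /= xS yS zS /=.
  have [//|_] := boolP (bad _ _ _); rewrite ?orbT //=.
  have [e|_] /= := eqVneq z (y^-1)%g.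
    by apply/orP; left; apply/imsetP; exists (x, y); rewrite ?in_setX ?xS ?yS //= e.
  have [e|//] := eqVneq z (y^-1 * (g * x * g^-1) * y)%g; rewrite /=.
  by apply/orP; right; apply/imsetP; exists (x, y); rewrite ?in_setX ?xS ?yS //= e.
have c2 : (#|B2| <= #|S| * #|S|)%N by rewrite -cardsX leq_imset_card.
have c3 : (#|B3| <= #|S| * #|S|)%N by rewrite -cardsX leq_imset_card.
have good : (#|Good| <= #|setX (A ^+ 12)%g (A ^+ 12)%g| * 2)%N.
  apply: (card_le_fibres (f := fun u => ((g * u.1.1 * g^-1) * u.1.2, u.1.2 * u.2)%g)).
    move=> [[x y] z]; rewrite inE !in_setX => /andP[/andP[/andP[xS yS] zS] _] /=.
    have [xA _ _] := mem_S xS; have [yA _ _] := mem_S yS; have [zA _ _] := mem_S zS.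
    have g1 := mem_expgs1 gA; have gV1 := mem_expgs1 (memV_sym AV gA).
    apply/andP; split.
      exact: (mem_expgsD (mem_expgsD (mem_expgsD g1 xA) gV1) yA).
    have := mem_expgsD yA zA; apply/subsetP; exact: expgs_subset.
  move=> [u v] _.
  set D := [set t in Good | _].
  have inj : {in D &, injective (fun t : gT * gT * gT => t.1.2)}.
    move=> [[x y] z] [[x' y'] z']; rewrite !inE /= => /andP[_ /eqP[e1 e2]] /andP[_ /eqP[e1' e2']] ey.
    move: e1' e2'; rewrite -ey -e1 -e2 => /mulIg/mulIg/mulgI -> /mulgI ->.
    by [].
  rewrite -(card_in_imset inj); apply: (@fibre_le2 _ _ X (tr r) u v) => // _ /imsetP[[[x y] z] hD ->] /=.
  move: hD; rewrite /D inE => /andP[]; rewrite /Good inE !in_setX /=.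
  move=> /andP[/andP[/andP[xS yS] zS] /and3P[nb nz1 nz2]] /eqP[<- <-].
  have [_ tx _] := mem_S xS; have [_ ty _] := mem_S yS; have [_ tz _] := mem_S zS.
  by rewrite mulgK mulKg trJ tx ty tz nb nz1 mulgA nz2.
have := subset_leq_card cover; rewrite !cardsX => tot.
have u1 : (#|Good :|: setX Bad S :|: (B2 :|: B3)| <= #|Good :|: setX Bad S| + #|B2 :|: B3|)%N.
  exact: leq_card_setU.
have u2 : (#|Good :|: setX Bad S| <= #|Good| + #|setX Bad S|)%N by apply: leq_card_setU.
have u3 : (#|B2 :|: B3| <= #|B2| + #|B3|)%N by apply: leq_card_setU.
rewrite cardsX in u2; rewrite cardsX in good.
have P12 := @card_pow 12 isT.
have {}good : (#|Good| <= 2 * (L * #|A|) ^ 2)%N.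
  apply: leq_trans good _; rewrite mulnC leq_mul2l /= expnS expn1.
  exact: leq_mul.
have La : (1 <= L ^ 2 * #|A| ^ 2)%N by rewrite muln_gt0 !expn_gt0 L_gt0 cardA_gt0.
have bs : (4 * (#|Bad| * #|S|) <= #|S| ^ 3)%N by rewrite mulnA expnSr leq_mul2r few orbT.
rewrite expnMn in good; rewrite -mulnA.
(* Fewer than 8 conjugates satisfy the bound through 512 = 8^3. Otherwise bad pairs take at most a
   quarter of all triples and the two excluded values of [z] another quarter. *)
have [s8|s8] := ltnP #|S| 8.
  have : (#|S| ^ 3 <= 8 ^ 3)%N by rewrite leq_exp2r // ltnW.
  by lia.
have h8 : (8 * #|S| ^ 2 <= #|S| ^ 3)%N by rewrite (expnS _ 2) leq_mul2r s8 orbT.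
have e3 : (#|S| ^ 3 = #|S| * #|S| * #|S|)%N by rewrite !expnS muln1 mulnA.
have e2 : (#|S| ^ 2 = #|S| * #|S|)%N by rewrite !expnS muln1.
by lia.
Qed.

(** Orbit-stabiliser: the map from [A] to its conjugates of [r] has fibres no larger than the part
    of A^2 in the centraliser, and [card_S_cube] bounds the number of conjugates. *)
Lemma torus_rich : (#|A| <= 512 * L ^ 2 * #|(A ^+ 2 :&: 'C[r])%g| ^ 3)%N.
Proof.
have hS : (#|A| <= #|S| * #|(A ^+ 2 :&: 'C[r])%g|)%N.
  apply: (card_le_fibres (f := fun h => (h * r * h^-1)%g)) => [h hA|z _].
    by apply/imsetP; exists h.
  have [->|[h0]] := set_0Vmem [set h in A | (h * r * h^-1 == z)%g]; first by rewrite cards0.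
  rewrite inE => /andP[h0A /eqP e0].
  rewrite -(card_lcoset _ h0^-1%g); apply: subset_leq_card; apply/subsetP => y.
  rewrite mem_lcoset invgK inE => /andP[hA /eqP e].
  rewrite inE; apply/andP; split.
    rewrite -(mulKg h0 y) (expgS _ 1) expg1 mem_mulg // memV_sym //.
  have := congr1 (fun u => u * (h0 * y))%g (etrans e (esym e0)); rewrite mulgKV !mulgA mulgKV => ee.
  by apply/cent1P; apply: (mulgI h0); rewrite !mulgA.
have S3 := card_S_cube; set t := #|_ :&: _|%g in hS *.
have A0 := cardA_gt0.
have h3 : (#|A| ^ 3 <= #|S| ^ 3 * t ^ 3)%N by rewrite -expnMn leq_exp2r.
have : (#|A| ^ 3 <= 512 * L ^ 2 * #|A| ^ 2 * t ^ 3)%N.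
  by apply: leq_trans h3 _; rewrite leq_mul2r S3 orbT.
rewrite (expnS _ 2) -(mulnA _ (#|A| ^ 2)%N) [(#|A| ^ 2 * t ^ 3)%N]mulnC mulnA leq_mul2r.
by rewrite expn_eq0 andbT -leqn0 leqNgt A0.
Qed.

End OneTorus.

Lemma card_nregular_cent1 x : regular x ->
  (#|[set y in 'C[x]%g | ~~ regular y]| <= 6)%N.
Proof.
move=> /andP[_ rx]; pose C t := [set y in 'C[x]%g | tr y == t].
apply: leq_trans (_ : #|C 0%R :|: C 2%R :|: C (-2)%R| <= _)%N.
  apply: subset_leq_card; apply/subsetP => y /setIdP[yC /nregular_trace].
  by rewrite !in_setU !in_set1 => ht; rewrite /C ![y \in [set _ in _ | _]]in_set yC.
have c t : (#|C t| <= 2)%N by apply: card_cent1_trace.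
have u1 : (#|C 0%R :|: C 2%R :|: C (-2)%R| <= #|C 0%R :|: C 2%R| + #|C (-2)%R|)%N by apply: leq_card_setU.
have u2 : (#|C 0%R :|: C 2%R| <= #|C 0%R| + #|C 2%R|)%N by apply: leq_card_setU.
by have := c 0; have := c 2; have := c (-2); lia.
Qed.

Section Pivot.
Variable r : gT.
Hypothesis rA : r \in (A ^+ 3)%g.
Hypothesis rreg : regular r.
Hypothesis Abig : (2 ^ 21 * L ^ 5 < #|A|)%N.

Let meets h := [exists x in (A ^+ 3)%g, regular x && (x \in 'C[h * r * h^-1]%g)].

Lemma meets_rich h : meets h -> (12 * L < #|(A ^+ 2 :&: 'C[h * r * h^-1])%g|)%N /\
  (#|A| <= 512 * L ^ 2 * #|(A ^+ 2 :&: 'C[h * r * h^-1])%g| ^ 3)%N.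
Proof.
case/existsP=> x /and3P[xA xreg xC].
have <- : 'C[x]%g = 'C[h * r * h^-1]%g.
  by apply: (@cent1_eq _ _ X) xC; rewrite regular_nscal ?regularJ.
have rich := torus_rich xA xreg; split=> //.
set t := #|(A ^+ 2 :&: 'C[x])%g| in rich *; rewrite ltnNge; apply/negP => tl.
(* Rounding 12 up to 2^4 gives 2^9 L^2 (2^4 L)^3 = 2^21 L^5, which contradicts [Abig]. *)
have t3 : (t ^ 3 <= (2 ^ 4 * L) ^ 3)%N.
  by rewrite leq_exp2r // (leq_trans tl) // leq_mul2r orbT.
move: Abig; rewrite ltnNge => /negP; apply; apply: leq_trans rich _.
apply: leq_trans (leq_mul (leqnn _) t3) _.
by rewrite expnMn -[512%N]/(2 ^ 9)%N mulnACA -expnM -!expnD.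
Qed.

(** Conjugation by [g] carries the rich part of A^2 into A^4, and [card_expgs_group] returns to A^2
    at the cost of a factor [L]. More than 6 elements of the new torus survive, while at most 6 are
    not regular. *)
Lemma meets_step g h : g \in A -> meets h -> meets (g * h)%g.
Proof.
move=> gA /meets_rich[tbig _].
set s := (h * r * h^-1)%g in tbig.
have es : (g * h * r * (g * h)^-1 = g * s * g^-1)%g by rewrite /s invMg !mulgA.
have sreg : regular (g * s * g^-1)%g by rewrite !regularJ.
clearbody s.
have t4 : (#|(A ^+ 2 :&: 'C[s])%g| <= #|(A ^+ 4 :&: 'C[g * s * g^-1])%g|)%N.
  rewrite -(cardJg _ g^-1%g); apply: subset_leq_card; apply/subsetP => _ /imsetP[y hy ->].
  move: hy; rewrite !in_setI => /andP[yA /cent1P yC]; rewrite conjgE invgK.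
  apply/andP; split.
    have := mem_expgsD (mem_expgsD (mem_expgs1 gA) yA) (mem_expgs1 (memV_sym AV gA)).
    by rewrite mulgA.
  apply/cent1P; rewrite /commute !mulgA !mulgKV.
  by congr (_ * _)%g; rewrite -!mulgA yC.
have H := card_expgs_group AV 'C[g * s * g^-1]%G 4.
have P5 := @card_pow 5 isT.
have t2 : (#|(A ^+ 2 :&: 'C[s])%g| <= L * #|(A ^+ 2 :&: 'C[g * s * g^-1])%g|)%N.
  rewrite -(leq_pmul2l cardA_gt0).
  apply: leq_trans (_ : #|A| * #|(A ^+ 4 :&: 'C[g * s * g^-1])%g| <= _)%N; first by rewrite leq_mul2l t4 orbT.
  apply: leq_trans H _; rewrite mulnA [(#|A| * L)%N]mulnC.
  by rewrite leq_mul2r P5 orbT.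
have t6 : (6 < #|(A ^+ 2 :&: 'C[g * s * g^-1])%g|)%N.
  by rewrite ltnNge; apply/negP => h6; move: t2 tbig L_gt0; nia.
have n6 := card_nregular_cent1 sreg.
have : ~~ ((A ^+ 2 :&: 'C[g * s * g^-1])%g \subset [set y in 'C[g * s * g^-1]%g | ~~ regular y]).
  by apply/negP => /subset_leq_card /leq_trans /(_ n6); rewrite leqNgt t6.
case/subsetPn => y /setIP[yA yC]; rewrite in_set yC /= negbK => yreg.
apply/existsP; exists y; rewrite es yreg yC !andbT.
by move: yA; apply/subsetP; apply: expgs_subset.
Qed.

Lemma meets_all h : meets h.
Proof.
have : h \in <<A>>%g by rewrite (generate_spread sp) inE.
case/gen_prodgP => n [f fA ->]; elim: n f fA => [|n IH] f fA.
  rewrite big_ord0; apply/existsP; exists r; rewrite rA rreg invg1 mulg1 mul1g.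
  exact: cent1id.
by rewrite big_ord_recl; apply: meets_step => //; apply: IH => i.
Qed.

(** Double counting of pairs (h, y) with [y] a regular element of A^2 in the torus of h r h^-1. For
    given [y], the element h^-1 y h has at most 2 values in the torus of [r], and each determines
    [h] up to the centraliser of [y], of size at most 2 |F|. *)
Lemma card_group_le : (#|gT| ^ 2 <= 2 ^ 19 * L ^ 5 * #|A| ^ 2)%N.
Proof.
pose Y := [set y in (A ^+ 2)%g | regular y].
pose N h := #|[set y in Y | y \in 'C[h * r * h^-1]%g]|.
have N3 h : (#|A| <= 2 ^ 12 * L ^ 2 * N h ^ 3)%N.
  have [big rich] := meets_rich (meets_all h).
  have sreg : regular (h * r * h^-1)%g by rewrite regularJ.
  have n6 := card_nregular_cent1 sreg.
  have : ((A ^+ 2 :&: 'C[h * r * h^-1])%g \subset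
      [set y in Y | y \in 'C[h * r * h^-1]%g] :|: [set y in 'C[h * r * h^-1]%g | ~~ regular y]).
    apply/subsetP => y /setIP[yA yC]; rewrite in_setU [y \in [set _ in Y | _]]in_set.
    rewrite [y \in [set _ in 'C[_]%g | _]]in_set yC /Y in_set yA /= andbT.
    exact: orbN.
  move/subset_leq_card => sub.
  have u : (#|[set y in Y | y \in 'C[h * r * h^-1]%g] :|: [set y in 'C[h * r * h^-1]%g | ~~ regular y]|
     <= N h + #|[set y in 'C[h * r * h^-1]%g | ~~ regular y]|)%N by apply: leq_card_setU.
  have t2 : (#|(A ^+ 2 :&: 'C[h * r * h^-1])%g| <= 2 * N h)%N by move: L_gt0; lia.
  apply: leq_trans rich _.
  have : (#|(A ^+ 2 :&: 'C[h * r * h^-1])%g| ^ 3 <= (2 * N h) ^ 3)%N by rewrite leq_exp2r.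
  by rewrite expnMn; nia.
case: (@arg_minnP _ 1%g predT N isT) => h0 _ hmin.
have dc : (#|[set: gT]| * N h0 <= #|Y| * (4 * #|F|))%N.
  apply: (@double_count_le _ _ _ _ (fun h y => y \in 'C[h * r * h^-1]%g)) => [h _|y].
    exact: hmin.
  rewrite inE => /andP[_ yreg]; have [_ yr] := andP yreg; have [_ rr] := andP rreg.
  have c2 : (#|[set z in 'C[r]%g | tr z == tr y]| <= 2)%N by apply: card_cent1_trace.
  have cy := card_cent1 two_neq0 yr.
  apply: leq_trans (_ : #|[set z in 'C[r]%g | tr z == tr y]| * #|'C[y]%g| <= _)%N; last first.
    by rewrite (_ : 4 * #|F| = 2 * (2 * #|F|))%N ?mulnA // -mulnA leq_mul.
  apply: (card_le_fibres (f := fun h => (h^-1 * y * h)%g)) => [h|z _].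
    move=> /setIdP[_ /cent1P com]; rewrite in_set; apply/andP; split.
      apply/cent1P; rewrite /commute.
      by have := congr1 (fun u => h^-1 * u * h)%g com; rewrite !mulgA !mulgKV mulVg mul1g.
    by rewrite -{2}(invgK h) trJ.
  have [->|[h1]] := set_0Vmem [set h in [set h in [set: gT] | y \in 'C[h * r * h^-1]%g] | (h^-1 * y * h == z)%g].
    by rewrite cards0.
  rewrite inE => /andP[_ /eqP e1].
  rewrite -(card_rcoset 'C[y]%g h1); apply: subset_leq_card; apply/subsetP => h.
  rewrite inE => /andP[_ /eqP e]; rewrite mem_rcoset; apply/cent1P; rewrite /commute.
  have := e; rewrite -e1 => ee.
  have := congr1 (fun u => h * u * h1^-1)%g ee; rewrite !mulgA mulgV mul1g mulgK => q.
  by rewrite q.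
rewrite cardsT in dc.
have Y2 : (#|Y| <= L * #|A|)%N.
  apply: leq_trans (@card_pow 2 isT); apply: subset_leq_card.
  by apply/subsetP => y; rewrite inE => /andP[].
have q3 := card_sl2_ge X.
have G0 : (0 < #|gT|)%N by apply/card_gt0P; exists 1%g.
have A0 := cardA_gt0.
have h1 : (#|gT| * N h0 <= 4 * #|F| * (L * #|A|))%N.
  by apply: leq_trans dc _; rewrite mulnC leq_mul2l Y2 orbT.
have h2 : (#|gT| ^ 3 * N h0 ^ 3 <= (4 * #|F| * (L * #|A|)) ^ 3)%N by rewrite -expnMn leq_exp2r.
have h3 : (#|gT| ^ 3 * #|A| <= 2 ^ 12 * L ^ 2 * (4 * #|F| * (L * #|A|)) ^ 3)%N.
  apply: leq_trans (_ : #|gT| ^ 3 * (2 ^ 12 * L ^ 2 * N h0 ^ 3) <= _)%N; first by rewrite leq_mul2l N3 orbT.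
  by rewrite mulnCA leq_mul2l h2 orbT.
have h4 : (#|gT| ^ 3 * #|A| <= 2 ^ 19 * L ^ 5 * #|gT| * #|A| ^ 3)%N.
  apply: leq_trans h3 _; rewrite !expnMn.
  have -> : (2 ^ 12 * L ^ 2 * (4 ^ 3 * #|F| ^ 3 * (L ^ 3 * #|A| ^ 3)) =
     2 ^ 18 * (L ^ 2 * L ^ 3) * #|F| ^ 3 * #|A| ^ 3)%N by lia.
  rewrite -expnD leq_mul2r; apply/orP; right.
  by have := leq_mul (leqnn (2 ^ 18 * L ^ 5)) q3; lia.
(* The cube of the count turns |F|^3 into at most 2 |G|; a common factor |G| |A| is then
   cancelled. *)
have gA0 : (0 < #|gT| * #|A|)%N by rewrite muln_gt0 G0 A0.
rewrite -(leq_pmul2r gA0).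
by move: h4; rewrite !expnS !expn0 !muln1; lia.
Qed.

End Pivot.

Lemma growth : (#|A| <= 2 ^ 21 * L ^ 5)%N \/ (#|gT| ^ 2 <= 2 ^ 19 * L ^ 5 * #|A| ^ 2)%N.
Proof.
have [//|Abig] := leqP #|A| (2 ^ 21 * L ^ 5); first by left.
right; have [|r rA rreg] := exists_regular; last exact: card_group_le rA rreg Abig.
apply: leq_ltn_trans Abig; have : (0 < L ^ 5)%N by rewrite expn_gt0 L_gt0.
by lia.
Qed.

End Growth.

(** * Quasirandomness *)

Lemma card_sqr_le2 (F : finFieldType) (c : F) : (#|[set a : F | a ^+ 2 == c]| <= 2)%N.
Proof.
rewrite leqNgt; apply/negP => /card_gt2P[x [y [z [[]]]]].
rewrite !inE => /eqP hx /eqP hy /eqP hz [nxy nyz nzx].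
have := eqf_sqr x y; have := eqf_sqr z y; rewrite hx hy hz eqxx.
rewrite (negPf nxy) [z == y]eq_sym (negPf nyz) /= => /esym/eqP ez /esym/eqP ex.
by move: nzx; rewrite ez ex eqxx.
Qed.

Lemma sum_inv_sqr_le (C : numDomainType) (F : finFieldType) (H : F -> C) (j : F) : j != 0 ->
  (forall i, 0 <= H i) -> \sum_(a | a != 0) H (j * a ^- 2) <= 2 * \sum_i H i.
Proof.
move=> j0 H0; rewrite (partition_big (fun a => j * a ^- 2) predT) //= mulr_sumr.
apply: ler_sum => i _.
rewrite (eq_bigr (fun=> H i)) => [|a /andP[_ /eqP <-] //].
rewrite sumr_const -(mulr_natl (H i)) ler_wpM2r // ler_nat.
apply: leq_trans (card_sqr_le2 (j / i)); apply: subset_leq_card.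
apply/subsetP => a ha; have {ha}/andP[a0 /eqP <-] : (a != 0) && (j * a ^- 2 == i) := ha; rewrite inE.
by apply/eqP; field; rewrite a0.
Qed.

(** * Fourier analysis along a unipotent subgroup *)

Section CharacterSums.
Variables (C : numClosedFieldType) (F : finFieldType) (gT : finGroupType).
Variable chi : F -> C.
Hypothesis chiD : forall s t, chi (s + t) = chi s * chi t.
Hypothesis chiN : forall s, chi (- s) = (chi s)^*.
Hypothesis chi_sum : forall j, \sum_s chi (j * s) = (if j == 0 then #|F|%:R else 0).
Variables (u dg : F -> gT).
Hypothesis uD : forall s t, u (s + t) = (u s * u t)%g.
Hypothesis udg : forall s a, a != 0 -> (u s * dg a = dg a * u (a ^- 2 * s)%R)%g.
Implicit Types (phi psi f t : gT -> C).

Local Notation nsq x := (`|x| ^+ 2).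
Local Notation q := (#|F|%:R : C).

(** Convolution in the form that visibly commutes with right translation, hence with [ft], the
    Fourier transform along the cosets of the unipotent subgroup [u]. *)
Definition cv f phi x : C := \sum_y f (x * y^-1)%g * phi y.
Definition ft phi j x : C := \sum_s chi (- (j * s)) * phi (x * u s)%g.

Lemma parseval_at phi x : \sum_j nsq (ft phi j x) = q * \sum_s nsq (phi (x * u s)%g).
Proof.
under eq_bigr => j _.
  rewrite normCK /ft rmorph_sum big_distrlr /=.
  under eq_bigr => s _ do under eq_bigr => s' _ do
    rewrite rmorphM /= -chiN opprK mulrACA -chiD.
  over.
rewrite exchange_big mulr_sumr; apply: eq_bigr => s _ /=.
rewrite exchange_big /= (bigD1 s) //= [X in _ + X]big1 ?addr0 => [|s' ns].
  under eq_bigr do rewrite addrC subrr.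
  by rewrite -mulr_suml normCK; have := chi_sum 0; rewrite eqxx => <-; under [in RHS]eq_bigr do rewrite mul0r.
rewrite -mulr_suml; under eq_bigr do rewrite addrC -mulrBr mulrC.
by rewrite chi_sum subr_eq0 (negPf ns) mul0r.
Qed.

Lemma parseval phi : \sum_j \sum_x nsq (ft phi j x) = q ^+ 2 * \sum_x nsq (phi x).
Proof.
rewrite exchange_big /=; under eq_bigr do rewrite parseval_at.
rewrite -mulr_sumr exchange_big /= expr2 -mulrA; congr (_ * _).
under eq_bigr => s _ do rewrite (sum_translater (fun x => nsq (phi x))).
by rewrite sumr_const mulr_natl.
Qed.

Lemma ft_cv f phi j x : ft (cv f phi) j x = cv f (ft phi j) x.
Proof.
rewrite /ft /cv; under eq_bigr do rewrite mulr_sumr.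
under [RHS]eq_bigr do rewrite mulr_sumr.
rewrite [RHS]exchange_big; apply: eq_bigr => s _ /=.
rewrite -(sum_translater _ (u s)); apply: eq_bigr => y _.
by rewrite invMg mulgA mulgK mulrCA.
Qed.

Lemma ft_equivariant phi j x s : ft phi j (x * u s)%g = chi (j * s) * ft phi j x.
Proof.
rewrite /ft mulr_sumr (reindex_inj (addIr (- s))) /=; apply: eq_bigr => r _.
rewrite -mulgA -uD addrCA subrr addr0 mulrA -chiD; congr (chi _ * _).
by ring.
Qed.

Lemma cauchy_schwarz_norm (I : finType) (a b : I -> C) :
  nsq (\sum_i a i * b i) <= (\sum_i nsq (a i)) * (\sum_i nsq (b i)).
Proof.
apply: le_trans (_ : (\sum_i `|a i| * `|b i|) ^+ 2 <= _).
  rewrite lerXn2r ?nnegrE ?sumr_ge0 // => [i _|]; first by rewrite mulr_ge0.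
  by apply: le_trans (ler_norm_sum _ _ _) _; apply: ler_sum => i _; rewrite normrM.
by apply: cauchy_schwarz_real => i; apply: normr_real.
Qed.

(* Translation by dg a moves psi to the component of character j a^-2, and a^-2 takes every
   value at most twice. *)
Lemma sum_torus_le t psi j : j != 0 ->
  (forall x s, psi (x * u s)%g = chi (j * s) * psi x) ->
  \sum_(a | a != 0) nsq (\sum_y t y * psi (y * dg a)%g) <=
  2 * (\sum_x nsq (psi x)) * \sum_x nsq (t x).
Proof.
move=> j0 equi.
have q0 : 0 < q by rewrite ltr0n; apply/card_gt0P; exists 0.
(* Averaging over right translation by [u s], moved past [dg a], shows that the pairing sees only
   the Fourier component of [t] at [- j * a ^- 2]. *)
have key a : a != 0 -> q * \sum_y t y * psi (y * dg a)%g =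
    \sum_y psi (y * dg a)%g * ft t (- j * a ^- 2) y.
  move=> a0; rewrite mulr_natl -sumr_const.
  under eq_bigr => s _ do rewrite -(sum_translater _ (u s)).
  rewrite exchange_big; apply: eq_bigr => y _ /=.
  rewrite /ft mulr_sumr; apply: eq_bigr => s _.
  rewrite -mulgA udg // mulgA equi mulrC -mulrA mulrCA; congr (_ * (chi _ * _)).
  by ring.
have q2 : 0 < q ^+ 2 by rewrite exprn_gt0.
rewrite -(ler_pM2l q2) [leLHS]mulr_sumr.
apply: (@le_trans _ _ (\sum_(a | a != 0) (\sum_x nsq (psi x)) * \sum_x nsq (ft t (- j * a ^- 2) x))).
  apply: ler_sum => a a0.
  have -> : q ^+ 2 = nsq q by rewrite normr_nat.
  rewrite -exprMn -normrM key //; apply: le_trans (cauchy_schwarz_norm _ _) _.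
  by rewrite (sum_translater (fun y => nsq (psi y))).
rewrite -mulr_sumr [X in _ <= X]mulrC.
have -> : 2 * (\sum_x nsq (psi x)) * (\sum_x nsq (t x)) * q ^+ 2 =
   (\sum_x nsq (psi x)) * (2 * (q ^+ 2 * (\sum_x nsq (t x)))) by ring.
rewrite ler_wpM2l ?sumr_ge0 // -1?parseval => [x _|]; first by rewrite exprn_ge0.
apply: (@sum_inv_sqr_le _ _ (fun i => \sum_x nsq (ft t i x))); first by rewrite oppr_eq0.
by move=> i; apply: sumr_ge0 => x _; rewrite exprn_ge0.
Qed.

(** Right translation by [dg a] preserves the norm on the left, so q - 1 translates may be summed;
    [sum_torus_le] then applies at each fixed [x]. *)
Lemma cv_ft_le f phi j : j != 0 ->
  (q - 1) * (\sum_x nsq (cv f (ft phi j) x)) <=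
  2 * (\sum_x nsq (ft phi j x)) * (#|gT|%:R * \sum_x nsq (f x)).
Proof.
move=> j0; set psi := ft phi j.
have q1 : q - 1 = #|[pred a : F | a != 0]|%:R.
  have c0 : (0 < #|F|)%N by apply/card_gt0P; exists 0.
  have -> : #|[pred a : F | a != 0]| = (#|F| - 1)%N by rewrite subn1 -(cardC1 (0 : F)).
  by rewrite natrB.
rewrite q1 mulr_natl -sumr_const.
have -> : \sum_(a in [pred a : F | a != 0]) \sum_x nsq (cv f psi x) =
    \sum_(a : F | a != 0) \sum_x nsq (\sum_y f (x * y^-1)%g * psi (y * dg a)%g).
  apply: eq_bigr => a _; rewrite -(sum_translater _ (dg a)); apply: eq_bigr => x _.
  congr (nsq _); rewrite /cv -(sum_translater _ (dg a)); apply: eq_bigr => y _.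
  by rewrite invMg mulgA mulgK.
rewrite exchange_big /=.
apply: (@le_trans _ _ (\sum_x 2 * (\sum_y nsq (psi y)) * \sum_y nsq (f (x * y^-1)%g))).
  apply: ler_sum => x _; apply: (sum_torus_le (fun y => f (x * y^-1)%g) j0) => y s.
  exact: ft_equivariant.
rewrite -mulr_sumr ler_wpM2l //.
  by rewrite mulr_ge0 // sumr_ge0 // => x _; rewrite exprn_ge0.
rewrite exchange_big /=.
under eq_bigr => y _ do rewrite (sum_translater (fun x => nsq (f x))).
by rewrite sumr_const mulr_natl.
Qed.

(** The subtracted term is the component of the trivial character; the others are summed by
    Parseval. *)
Lemma cv_nontrivial_le f phi :
  (q - 1) * (q ^+ 2 * (\sum_x nsq (cv f phi x)) - \sum_x nsq (\sum_s cv f phi (x * u s)%g)) <=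
  2 * (q ^+ 2 * \sum_x nsq (phi x)) * (#|gT|%:R * \sum_x nsq (f x)).
Proof.
have e0 x : \sum_s cv f phi (x * u s)%g = ft (cv f phi) 0 x.
  apply: eq_bigr => s _; rewrite mul0r oppr0.
  have c00 : chi 0 = 1.
    have h := chiD 0 0; rewrite addr0 in h.
    have nz : chi 0 != 0.
      apply/negP => /eqP z; have := chi_sum 0; under eq_bigr do rewrite mul0r z.
      rewrite eqxx sumr_const mul0rn => /eqP; rewrite eq_sym pnatr_eq0.
      by rewrite -leqn0 leqNgt; case/negP; apply/card_gt0P; exists 0.
    by apply: (mulfI nz); rewrite mulr1.
  by rewrite c00 mul1r.
have -> : \sum_x nsq (\sum_s cv f phi (x * u s)%g) = \sum_x nsq (ft (cv f phi) 0 x).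
  by apply: eq_bigr => x _; rewrite e0.
rewrite -!parseval (bigD1 0) //= addrC addrK mulr_sumr.
apply: (@le_trans _ _ (\sum_(j | j != 0) 2 * (\sum_x nsq (ft phi j x)) * (#|gT|%:R * \sum_x nsq (f x)))).
  apply: ler_sum => j j0; under eq_bigr do rewrite ft_cv.
  exact: cv_ft_le.
rewrite -mulr_suml -mulr_sumr ler_wpM2r //.
  by rewrite mulr_ge0 // sumr_ge0 // => x _; rewrite exprn_ge0.
rewrite ler_wpM2l // [leRHS](bigD1 0) //= lerDr sumr_ge0 // => x _.
by rewrite exprn_ge0.
Qed.

End CharacterSums.

(** A root of 1 + X + ... + X^(p-1) is a p-th root of unity other than 1; its powers form the
    character. *)
Lemma exists_additive_character (C : numClosedFieldType) (p : nat) : prime p ->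
  exists chi : 'F_p -> C, [/\ forall s t, chi (s + t) = chi s * chi t,
    forall s, chi (- s) = (chi s)^* &
    forall j, \sum_s chi (j * s) = (if j == 0 then #|'F_p|%:R else 0)].
Proof.
move=> pp; have p1 := prime_gt1 pp; have p0 := prime_gt0 pp.
have [z rz] : exists z : C, root (\poly_(i < p) 1) z.
  apply/closed_rootP; rewrite size_poly_eq ?oner_eq0 //.
  by rewrite neq_ltn p1 orbT.
have sz : \sum_(i < p) z ^+ i = 0.
  move: rz; rewrite /root horner_poly => /eqP rz; rewrite -[RHS]rz.
  by apply: eq_bigr => i _; rewrite mul1r.
have zp : z ^+ p = 1.
  by apply/eqP; rewrite -subr_eq0 subrX1 sz mulr0.
have z1 : z != 1.
  apply/negP => /eqP e; move/eqP: sz; rewrite e; under eq_bigr do rewrite expr1n.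
  by rewrite sumr_const card_ord pnatr_eq0 -leqn0 leqNgt p0.
have nz : `|z| = 1.
  by apply/eqP; rewrite -(@pexpr_eq1 _ _ p) // -normrX zp normr1.
have z0 : z != 0 by rewrite -normr_eq0 nz oner_eq0.
have zp' : z ^+ (Zp_trunc (pdiv p)).+2 = 1 by rewrite Fp_cast.
pose chi (s : 'F_p) : C := z ^+ (s : nat).
have chiD s t : chi (s + t) = chi s * chi t.
  by rewrite /chi -exprD /= (expr_mod _ zp').
have chi0 : chi 0 = 1 by rewrite /chi expr0.
exists chi; split=> // [s|j].
  have n1 : `|chi s| = 1 by rewrite /chi normrX nz expr1n.
  have nzs : chi s != 0 by rewrite -normr_eq0 n1 oner_eq0.
  by apply: (mulfI nzs); rewrite -chiD subrr chi0 -normCK n1 expr1n.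
case: eqP => [->|/eqP j0].
  by under eq_bigr do rewrite mul0r chi0; rewrite sumr_const.
have chi1 : chi 1 = z.
  by rewrite /chi -[LHS]/(z ^+ (1 %% (Zp_trunc (pdiv p)).+2)) (expr_mod _ zp') expr1.
have e : \sum_s chi (j * s) = (\sum_s chi (j * s)) * z.
  rewrite [LHS](reindex_inj (addIr j^-1)) mulr_suml; apply: eq_bigr => s _.
  by rewrite mulrDr divff // chiD chi1.
apply/eqP; have /eqP : (\sum_s chi (j * s)) * (1 - z) = 0 by rewrite mulrBr mulr1 -e subrr.
by rewrite mulf_eq0 subr_eq0 [1 == z]eq_sym (negPf z1) orbF.
Qed.

(** * Transfer to real-valued functions *)

Section RealTransfer.
Variables (R : realType) (gT : finGroupType) (p : nat).
Hypothesis pp : prime p.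
Implicit Types (f phi : gT -> R) (u dg : 'F_p -> gT).

Lemma conv_rE f phi x : conv f phi x = \sum_y f (x * y^-1)%g * phi y.
Proof.
have := convE f phi x 1%g; rewrite invg1 mulg1 => ->.
by apply: eq_bigr => y _; rewrite mulg1.
Qed.

(** When [u] is a homomorphism, this is q times the projection onto the vectors invariant under
    it. *)
Definition coset_sum u phi x : R := \sum_s phi (x * u s)%g.

Lemma conv_coset_sum u f phi x : conv f (coset_sum u phi) x = coset_sum u (conv f phi) x.
Proof.
rewrite /coset_sum /conv [RHS]exchange_big; apply: eq_bigr => y _ /=.
by rewrite mulr_sumr; apply: eq_bigr => s _; rewrite mulgA.
Qed.

Lemma l2_coset_sum_le u phi : l2norm_sq (coset_sum u phi) <= #|'F_p|%:R ^+ 2 * l2norm_sq phi.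
Proof.
rewrite /l2norm_sq /coset_sum expr2 -mulrA.
apply: (@le_trans _ _ (\sum_x #|'F_p|%:R * \sum_s phi (x * u s)%g ^+ 2)).
  by apply: ler_sum => x _; apply: sqr_sum_le_card.
rewrite -mulr_sumr ler_wpM2l // exchange_big /=.
under eq_bigr => s _ do rewrite (sum_translater (fun x => phi x ^+ 2)).
by rewrite sumr_const mulr_natl.
Qed.

Lemma conv_nontrivial_le u dg f phi :
  (forall s t, u (s + t) = (u s * u t)%g) ->
  (forall s a, a != 0 -> (u s * dg a = dg a * u (a ^- 2 * s)%R)%g) ->
  (#|'F_p|%:R - 1) * (#|'F_p|%:R ^+ 2 * l2norm_sq (conv f phi) - l2norm_sq (coset_sum u (conv f phi)))
  <= 2 * (#|'F_p|%:R ^+ 2 * l2norm_sq phi) * (#|gT|%:R * l2norm_sq f).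
Proof.
move=> uD udg; have [chi [chiD chiN chiS]] := exists_additive_character R[i] pp.
pose io : {rmorphism R -> R[i]} := real_complex R.
have := cv_nontrivial_le chiD chiN chiS uD udg (fun x => io (f x)) (fun x => io (phi x)).
have nq (x : R) : `|io x| ^+ 2 = io (x ^+ 2).
  by rewrite real_normK ?rmorphXn //; apply/complex_realP; exists x.
have ecv x : cv (fun x => io (f x)) (fun x => io (phi x)) x = io (conv f phi x).
  by rewrite conv_rE rmorph_sum; apply: eq_bigr => y _; rewrite rmorphM.
under eq_bigr do rewrite ecv nq.
have -> : \sum_x `|\sum_s cv (fun x => io (f x)) (fun x => io (phi x)) (x * u s)%g| ^+ 2 =
    io (l2norm_sq (coset_sum u (conv f phi))).
  rewrite rmorph_sum; apply: eq_bigr => x _ /=.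
  by under eq_bigr do rewrite ecv; rewrite -rmorph_sum nq.
under [X in _ <= 2 * (_ * X) * _]eq_bigr do rewrite nq.
under [X in _ <= _ * (_ * X)]eq_bigr do rewrite nq.
rewrite -!rmorph_sum -!/(l2norm_sq _).
have natc n : n%:R = io n%:R by rewrite rmorph_nat.
rewrite !natc -(rmorph1 io) -!(rmorphXn io) -!(rmorphM io) -!(rmorphB io) -!(rmorphM io).
by rewrite lecR.
Qed.

End RealTransfer.

(** * Mixing from two opposite unipotent subgroups *)

Section Quasirandom.
Variables (R : realType) (gT : finGroupType) (p : nat).
Hypothesis pp : prime p.
Variable X : sl2_coord 'F_p gT.
Implicit Types (f g phi : gT -> R) (x y h : gT).

Local Notation a := (ca X).
Local Notation b := (cb X).
Local Notation c := (cc X).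
Local Notation d := (cd X).
Local Notation q := (#|'F_p|%:R : R).

(** The default value 1 is reached only when the prescribed determinant is not 1. *)
Definition sl2_mk (a' b' c' d' : 'F_p) : gT :=
  odflt 1%g [pick g | [&& a g == a', b g == b', c g == c' & d g == d']].

Lemma sl2_mkP a' b' c' d' : a' * d' - b' * c' = 1 ->
  [/\ a (sl2_mk a' b' c' d') = a', b (sl2_mk a' b' c' d') = b',
      c (sl2_mk a' b' c' d') = c' & d (sl2_mk a' b' c' d') = d'].
Proof.
move=> h; rewrite /sl2_mk; case: pickP => [g /and4P[/eqP ? /eqP ? /eqP ? /eqP ?] //|none].
have [g [ga gb gc gd]] := @sl2_surj _ _ X _ _ _ _ h.
by have := none g; rewrite ga gb gc gd !eqxx.
Qed.

Definition up s := sl2_mk 1 s 0 1.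
Definition lo s := sl2_mk 1 0 s 1.
Definition dgu t := sl2_mk t 0 0 t^-1.
Definition dgl t := sl2_mk t^-1 0 0 t.

Lemma upP s : [/\ a (up s) = 1, b (up s) = s, c (up s) = 0 & d (up s) = 1].
Proof. by apply: sl2_mkP; ring. Qed.
Lemma loP s : [/\ a (lo s) = 1, b (lo s) = 0, c (lo s) = s & d (lo s) = 1].
Proof. by apply: sl2_mkP; ring. Qed.
Lemma dguP t : t != 0 -> [/\ a (dgu t) = t, b (dgu t) = 0, c (dgu t) = 0 & d (dgu t) = t^-1].
Proof. by move=> t0; apply: sl2_mkP; rewrite divff // mulr0 subr0. Qed.
Lemma dglP t : t != 0 -> [/\ a (dgl t) = t^-1, b (dgl t) = 0, c (dgl t) = 0 & d (dgl t) = t].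
Proof. by move=> t0; apply: sl2_mkP; rewrite mulVf // mulr0 subr0. Qed.

Lemma upD s t : up (s + t) = (up s * up t)%g.
Proof.
have [a1 b1 c1 d1] := upP s; have [a2 b2 c2 d2] := upP t; have [a3 b3 c3 d3] := upP (s + t).
by apply: (sl2_inj (s := X)); rewrite !sl2E ?a1 ?a2 ?a3 ?b1 ?b2 ?b3 ?c1 ?c2 ?c3 ?d1 ?d2 ?d3; ring.
Qed.

Lemma loD s t : lo (s + t) = (lo s * lo t)%g.
Proof.
have [a1 b1 c1 d1] := loP s; have [a2 b2 c2 d2] := loP t; have [a3 b3 c3 d3] := loP (s + t).
by apply: (sl2_inj (s := X)); rewrite !sl2E ?a1 ?a2 ?a3 ?b1 ?b2 ?b3 ?c1 ?c2 ?c3 ?d1 ?d2 ?d3; ring.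
Qed.

Lemma up_dgu s t : t != 0 -> (up s * dgu t = dgu t * up (t ^- 2 * s)%R)%g.
Proof.
move=> t0; have [a1 b1 c1 d1] := upP s; have [a2 b2 c2 d2] := dguP t0.
have [a3 b3 c3 d3] := upP (t ^- 2 * s).
by apply: (sl2_inj (s := X)); rewrite !sl2E ?a1 ?a2 ?a3 ?b1 ?b2 ?b3 ?c1 ?c2 ?c3 ?d1 ?d2 ?d3; field.
Qed.

Lemma lo_dgl s t : t != 0 -> (lo s * dgl t = dgl t * lo (t ^- 2 * s)%R)%g.
Proof.
move=> t0; have [a1 b1 c1 d1] := loP s; have [a2 b2 c2 d2] := dglP t0.
have [a3 b3 c3 d3] := loP (t ^- 2 * s).
by apply: (sl2_inj (s := X)); rewrite !sl2E ?a1 ?a2 ?a3 ?b1 ?b2 ?b3 ?c1 ?c2 ?c3 ?d1 ?d2 ?d3; field.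
Qed.

(** On the big cell, a function invariant on both sides under [up] depends only on the lower left
    entry. *)
Lemma bruhat h : c h != 0 ->
  h = (up ((a h - 1) / c h)%R * lo (c h) * up ((d h - 1) / c h)%R)%g.
Proof.
move=> h0; have [a1 b1 c1 d1] := upP ((a h - 1) / c h); have [a2 b2 c2 d2] := loP (c h).
have [a3 b3 c3 d3] := upP ((d h - 1) / c h); have dt := sl2_det X h.
apply: (sl2_inj (s := X)); rewrite !sl2E ?a1 ?a2 ?a3 ?b1 ?b2 ?b3 ?c1 ?c2 ?c3 ?d1 ?d2 ?d3.
- by field.
- by apply: (mulfI h0); apply: (eq_of_lincomb1 (k := -1) dt); field.
- by ring.
- by field.
Qed.

Lemma card_lower_entry s : s != 0 -> #|[pred h | c h == s]| = (#|'F_p| ^ 2)%N.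
Proof.
move=> s0; rewrite expnS expn1 -card_prod.
have inj : {in [pred h | c h == s] &, injective (fun h => (a h, d h))}.
  move=> x y; rewrite !inE => /eqP cx /eqP cy [ea ed].
  apply: (sl2_inj ea _ _ ed); last by rewrite cx cy.
  have dx := sl2_det X x; have dy := sl2_det X y; rewrite ?ea ?ed ?cx ?cy in dx dy.
  by apply: (mulIf s0); apply: (eq_of_lincomb2 (k := -1) (k' := 1) dx dy); ring.
rewrite -(card_in_image inj); apply: eq_card => -[x y]; rewrite inE.
have [|g [ga gb gc gd]] := @sl2_surj _ _ X x ((x * y - 1) / s) s y; first by field.
by apply/imageP; exists g; rewrite ?inE ?gc ?ga ?gd.
Qed.

(** Multiplied by the order of [H], the sum is a sum of squares of sums over cosets of [H]. *)
Lemma sum_corr_group_ge0 g (H : {group gT}) : 0 <= \sum_(h in H) corr g h.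
Proof.
have H0 : 0 < #|H|%:R :> R by rewrite ltr0n cardG_gt0.
rewrite -(pmulr_rge0 _ H0).
have -> : #|H|%:R * (\sum_(h in H) corr g h) = \sum_x (\sum_(k in H) g (x * k)%g) ^+ 2.
  rewrite mulr_natl -sumr_const.
  have -> : \sum_x (\sum_(k in H) g (x * k)%g) ^+ 2 =
      \sum_(k in H) \sum_x g (x * k)%g * \sum_(h in H) g (x * h)%g.
    rewrite exchange_big; apply: eq_bigr => x _ /=.
    by rewrite expr2 mulr_suml.
  apply: eq_bigr => k kH; rewrite /corr exchange_big /= -(sum_translater _ k).
  apply: eq_bigr => x _; rewrite mulr_sumr.
  rewrite [RHS](reindex_inj (mulgI k)) /=.
  apply: eq_big => h; first by rewrite groupMl.
  by rewrite mulgA.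
by apply: sumr_ge0 => x _; apply: sqr_ge0.
Qed.

(** The norm is q times the sum of [corr g (lo s)]. By [bruhat] the terms with [s] nonzero represent
    the big cell; all correlations sum to 0 and those on the Borel subgroup to something
    nonnegative, so these terms are at most 0 in total and only [s = 0] counts. *)
Lemma l2_coset_sum_lo_up_le (phi : gT -> R) : \sum_x phi x = 0 ->
  l2norm_sq (coset_sum lo (coset_sum up phi)) <= q * l2norm_sq (coset_sum up phi).
Proof.
move=> m0; set g := coset_sum up phi.
have q0 : 0 < q by rewrite ltr0n; apply/card_gt0P; exists 0.
have gU x s : g (x * up s)%g = g x.
  rewrite /g /coset_sum (reindex_inj (addrI (- s))) /=; apply: eq_bigr => r _.
  by rewrite -mulgA -upD addrA subrr add0r.
have sg : \sum_x g x = 0.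
  rewrite /g /coset_sum exchange_big big1 // => s _; by rewrite (sum_translater phi).
have cU h s : corr g (h * up s)%g = corr g h.
  by apply: eq_bigr => x _; rewrite mulgA gU.
have Uc h s : corr g (up s * h)%g = corr g h.
  rewrite /corr -[RHS](sum_translater _ (up s)); apply: eq_bigr => x _.
  by rewrite gU mulgA.
have e1 : l2norm_sq (coset_sum lo g) = q * \sum_s corr g (lo s).
  rewrite /l2norm_sq /coset_sum; under eq_bigr do rewrite expr2 mulr_suml.
  rewrite exchange_big mulr_natl -sumr_const; apply: eq_bigr => s _ /=.
  under eq_bigr do rewrite mulr_sumr.
  rewrite exchange_big (reindex_inj (addrI s)) /=; apply: eq_bigr => r _.
  under eq_bigr do rewrite loD mulgA.
  by rewrite (sum_translater (fun x => g x * g (x * lo r)%g)).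
rewrite e1 ler_wpM2l ?(ltW q0) // (bigD1 0) //=.
have -> : corr g (lo 0) = l2norm_sq g.
  apply: eq_bigr => x _; rewrite (_ : lo 0 = 1%g) ?mulg1 ?expr2 //.
  by apply: (mulgI (lo 0)); rewrite -loD addr0 mulg1.
rewrite gerDl.
have q2 : 0 < q ^+ 2 by rewrite exprn_gt0.
rewrite -(pmulr_rle0 _ q2).
have -> : q ^+ 2 * \sum_(s | s != 0) corr g (lo s) = \sum_(h | c h != 0) corr g h.
  rewrite (partition_big c (fun s => s != 0)) //= mulr_sumr; apply: eq_bigr => s s0.
  rewrite (eq_bigr (fun=> corr g (lo s))) => [|h /andP[h0 /eqP hs]]; last first.
    by rewrite (bruhat h0) cU Uc hs.
  rewrite sumr_const -[RHS]mulr_natl -natrX; congr (_%:R * _).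
  rewrite -(card_lower_entry s0); apply: eq_card => h; rewrite !inE.
  by rewrite unfold_in; case: eqP => [->|]; rewrite ?s0 ?andbF.
have tot : \sum_h corr g h = 0.
  rewrite /corr exchange_big /=; under eq_bigr do rewrite -mulr_sumr (sum_translate g) sg mulr0.
  exact: big1.
rewrite -[leRHS]tot [leRHS](bigID (fun h => c h != 0)) /= lerDl.
rewrite (eq_bigl (mem (borel X (1, 0)))); first exact: sum_corr_group_ge0.
move=> h; rewrite negbK; apply/esym; rewrite [LHS]mem_borel /parallel /vact /=.
by rewrite !mulr0 !mulr1 ?addr0 eq_sym ?addr0.
Qed.

(** [h1] bounds the part of [G] not invariant under [up]. The invariant part is f convolved with
    [coset_sum up f]; [h2] bounds its part not invariant under [lo], and [h3] the rest. *)
Lemma quasirandom f : odd p -> \sum_x f x = 0 ->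
  l2norm_sq (conv f f) <= 9 * #|gT|%:R / p%:R * l2norm_sq f ^+ 2.
Proof.
move=> oddp f0; set G := conv f f.
have sG : \sum_x G x = 0 by rewrite sum_conv f0 mul0r.
have h1 := conv_nontrivial_le pp f f upD up_dgu; rewrite -/G in h1.
have h2 := conv_nontrivial_le pp f (coset_sum up f) loD lo_dgl.
have e2 : conv f (coset_sum up f) =1 coset_sum up G by move=> x; rewrite conv_coset_sum.
have e2' : l2norm_sq (conv f (coset_sum up f)) = l2norm_sq (coset_sum up G).
  by apply: eq_bigr => x _; rewrite e2.
have e2'' : l2norm_sq (coset_sum lo (conv f (coset_sum up f))) = l2norm_sq (coset_sum lo (coset_sum up G)).
  by apply: eq_bigr => x _; congr (_ ^+ 2); apply: eq_bigr => s _; rewrite e2.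
rewrite e2' e2'' in h2.
have h3 := l2_coset_sum_lo_up_le sG; have h4 := l2_coset_sum_le up f.
move: h1 h2 h3 h4; rewrite card_Fp //.
have p3 : 3 <= p%:R :> R by rewrite (ler_nat _ 3) odd_prime_gt2.
have ff : 0 <= l2norm_sq f by apply: sumr_ge0 => x _; apply: sqr_ge0.
have g0 : 0 <= l2norm_sq (coset_sum up G) by apply: sumr_ge0 => x _; apply: sqr_ge0.
have n0 : 0 <= #|gT|%:R :> R by [].
move: p3 ff g0 n0; move: (p%:R : R) (#|gT|%:R : R) (l2norm_sq f) (l2norm_sq (coset_sum up G))
  (l2norm_sq G) (l2norm_sq (coset_sum lo (coset_sum up G))) (l2norm_sq (coset_sum up f)).
move=> P n s g F k t p3 s0 g0 n0 h1 h2 h3 h4.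
have P0 : 0 < P by lra.
have ns : 0 <= n * s by rewrite mulr_ge0.
have b1 : (P - 1) * ((P ^+ 2 - P) * g) <= 2 * (P ^+ 4 * s) * (n * s).
  apply: (@le_trans _ _ ((P - 1) * (P ^+ 2 * g - k))).
    by apply: ler_wpM2l; [lra | rewrite mulrBl; lra].
  apply: le_trans h2 _; rewrite ler_wpM2r // ler_wpM2l //.
  have -> : P ^+ 4 * s = P ^+ 2 * (P ^+ 2 * s) by ring.
  by rewrite ler_wpM2l ?exprn_ge0 ?(ltW P0).
have b2 : (P - 1) ^+ 2 * g <= 2 * P ^+ 3 * n * s ^+ 2.
  rewrite -(ler_pM2l P0).
  have -> : P * ((P - 1) ^+ 2 * g) = (P - 1) * ((P ^+ 2 - P) * g) by ring.
  by have -> : P * (2 * P ^+ 3 * n * s ^+ 2) = 2 * (P ^+ 4 * s) * (n * s) by ring.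
have b3 : (P - 1) ^+ 2 * (P ^+ 2 * F) <= 2 * P ^+ 2 * (2 * P - 1) * n * s ^+ 2.
  have hh : (P - 1) * ((P - 1) * (P ^+ 2 * F - g)) <= (P - 1) * (2 * (P ^+ 2 * s) * (n * s)).
    by rewrite ler_wpM2l //; lra.
  have -> : (P - 1) ^+ 2 * (P ^+ 2 * F) = (P - 1) * ((P - 1) * (P ^+ 2 * F - g)) + (P - 1) ^+ 2 * g.
    by ring.
  have -> : 2 * P ^+ 2 * (2 * P - 1) * n * s ^+ 2 =
    (P - 1) * (2 * (P ^+ 2 * s) * (n * s)) + 2 * P ^+ 3 * n * s ^+ 2 by ring.
  exact: lerD.
have b4 : (P - 1) ^+ 2 * F <= 2 * (2 * P - 1) * (n * s ^+ 2).
  have P2 : 0 < P ^+ 2 by rewrite exprn_gt0.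
  rewrite -(ler_pM2l P2); move: b3.
  have -> : P ^+ 2 * ((P - 1) ^+ 2 * F) = (P - 1) ^+ 2 * (P ^+ 2 * F) by ring.
  by have -> : 2 * P ^+ 2 * (2 * P - 1) * n * s ^+ 2 = P ^+ 2 * (2 * (2 * P - 1) * (n * s ^+ 2)) by ring.
have Pm : 0 < (P - 1) ^+ 2 by rewrite exprn_gt0 //; lra.
rewrite -(ler_pM2l Pm); apply: le_trans b4 _.
have -> : (P - 1) ^+ 2 * (9 * n / P * s ^+ 2) = (9 * (P - 1) ^+ 2 / P) * (n * s ^+ 2) by ring.
rewrite ler_wpM2r ?mulr_ge0 ?sqr_ge0 // ler_pdivlMr //.
(* What remains is 2 (2 P - 1) P at most 9 (P - 1)^2, valid from P = 3 on. *)
by rewrite !expr2; nra.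
Qed.

End Quasirandom.

(** * Flattening *)

Lemma det2 (F : comPzRingType) (A : 'M[F]_2) :
  \det A = A 0 0 * A 1 1 - A 0 1 * A 1 0.
Proof.
rewrite (expand_det_row _ 0) !big_ord_recl big_ord0 addr0 /cofactor !det_mx11 !mxE /=.
rewrite expr0 mul1r expr1 mulN1r mulrN.
by congr (A _ _ * A _ _ - A _ _ * A _ _); apply: val_inj.
Qed.

(** * Entries of the concrete group *)

Section SL2Coordinates.
Variable p : nat.
Implicit Types g x y : SL2 p.

Definition SL2_mx g : 'M['F_p]_2 := GLval (sgval g).

Lemma SL2_mxM x y : SL2_mx (x * y)%g = SL2_mx x *m SL2_mx y.
Proof. by rewrite /SL2_mx sgvalM ?in_setT // GL_MxE. Qed.

Lemma SL2_mx_entryM x y i j :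
  SL2_mx (x * y)%g i j = SL2_mx x i 0 * SL2_mx y 0 j + SL2_mx x i 1 * SL2_mx y 1 j.
Proof.
rewrite SL2_mxM mxE !big_ord_recl big_ord0 addr0.
by congr (_ * _ + SL2_mx x _ _ * SL2_mx y _ _); apply: val_inj.
Qed.

Lemma SL2_mx_det g : \det (SL2_mx g) = 1.
Proof. by have := subgP g; rewrite inE => /eqP. Qed.

Lemma SL2_mx_inj : injective SL2_mx.
Proof. by move=> x y h; apply: val_inj; apply: val_inj. Qed.

Lemma SL2_mx_surj (A : 'M['F_p]_2) : \det A = 1 -> exists g, SL2_mx g = A.
Proof.
move=> dA; have uA : A \is a GRing.unit by rewrite -[_ \is a _]/(A \in unitmx) unitmxE dA unitr1.
pose g : {'GL_2(p)} := FinRing.Unit uA.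
exists (subg (SL2_group p) g); rewrite /SL2_mx subgK //.
by rewrite inE /= dA.
Qed.

Lemma ord2P (i : 'I_2) : i = 0 \/ i = 1.
Proof. by case: i => -[|[|//]] hi; [left|right]; apply: val_inj. Qed.

Definition SL2_coord : sl2_coord 'F_p (SL2 p).
Proof.
apply: (@Sl2Coord _ _ (fun g => SL2_mx g 0 0) (fun g => SL2_mx g 0 1)
  (fun g => SL2_mx g 1 0) (fun g => SL2_mx g 1 1)); try by move=> x y; apply: SL2_mx_entryM.
- by move=> g; rewrite -det2 SL2_mx_det.
- move=> x y h1 h2 h3 h4; apply: SL2_mx_inj; apply/matrixP => i j.
  by case: (ord2P i) => ->; case: (ord2P j) => ->.
move=> a b c d h.
have [|g eg] := @SL2_mx_surj (\matrix_(i, j) (if i == 0 then (if j == 0 then a else b)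
                                    else (if j == 0 then c else d))).
  by rewrite det2 !mxE /= h.
by exists g; rewrite eg !mxE.
Qed.

End SL2Coordinates.

Lemma two_neq0_Fp p : prime p -> odd p -> 2 != 0 :> 'F_p.
Proof.
move=> pp op; rewrite -(dvdn_pcharf (pchar_Fp pp)).
by apply/negP => /dvdn_leq -/(_ isT); rewrite leqNgt odd_prime_gt2.
Qed.

Section Flattening.
Variables (R : realType) (p : nat).
Hypothesis pp : prime p.
Hypothesis oddp : odd p.
Implicit Types mu f : SL2 p -> R.

(** A right translate of [a *: S] becomes a left translate of a conjugate of [S], which has the same
    growth. *)
Lemma measure_of_conj mu (S : {set SL2 p}) a z :
  measure_of mu ((a *: S) :* z)%g = measure_of mu ((a * z) *: (S :^ z))%g.
Proof.
rewrite /measure_of; apply: eq_bigl => x.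
by rewrite mem_rcoset !mem_lcoset mem_conjg conjgE invgK invMg !mulgA mulgV mul1g.
Qed.

(** If the norm does not drop, the approximate group is moved to a translate charged by [mu], and
    [growth] is applied with [M ^ 464] to the normalised restriction of [mu]. *)
Lemma flattening mu (M : nat) (K : R) k : is_prob mu -> symmetric_measure mu ->
  (2 ^ 20 <= M)%N -> M%:R ^+ 2400 <= K ->
  (forall (Gamma : {group SL2 p}) (g : SL2 p), Gamma \proper [set: SL2 p] ->
     measure_of mu (g *: Gamma)%g <= K^-1) ->
  (forall g, mu g <= K^-1) ->
  l2norm_sq (conv_dbl mu k.+1) <= l2norm_sq (conv_dbl mu k) / M%:R \/
  l2norm_sq (conv_dbl mu k) <= M%:R ^+ 1600 / #|SL2 p|%:R.
Proof.
move=> pmu smu M20 MK hG hinf; set f := conv_dbl mu k.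
have M0 : (0 < M)%N by apply: leq_trans M20; rewrite expn_gt0.
have MR0 : 0 < M%:R :> R by rewrite ltr0n.
have MR1 : 1 <= M%:R :> R by rewrite ler1n.
have K0 : 0 < K by apply: lt_le_trans MK; rewrite exprn_gt0.
have [h|h] := leP (l2norm_sq (conv_dbl mu k.+1)) (l2norm_sq f / M%:R); [by left|right].
have pf : is_prob f by apply: conv_dbl_prob.
have sf : symmetric_measure f by apply: conv_dbl_symmetric.
have h' : l2norm_sq f <= M%:R * l2norm_sq (conv f f).
  by move/ltW: h; rewrite ler_pdivrMr // mulrC.
have M20R : 2 ^+ 20 <= M%:R :> R by rewrite -natrX ler_nat.
have [S [a [S1 SV S12 Sq Sm]]] := approximate_group_of_energy pf sf M20R h'.
have m0 : 0 < measure_of f (a *: S)%g.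
  by apply: lt_le_trans Sm; rewrite invr_gt0 exprn_gt0.
have [z hz] := conv_dbl_translate pmu m0.
pose A := (S :^ z)%g; pose b := (a * z)%g.
rewrite measure_of_conj -/A -/b in hz.
have mA : M%:R ^- 21 <= measure_of mu (b *: A)%g by apply: le_trans Sm hz.
set m := measure_of mu (b *: A)%g in mA.
have mpos : 0 < m by apply: lt_le_trans mA; rewrite invr_gt0 exprn_gt0.
have mu0 x : 0 <= mu x by case/andP: (proj1 pmu x).
have mE : m = \sum_(x in A) mu (b * x)%g.
  rewrite /m /measure_of [LHS](reindex_inj (mulgI b)) /=.
  by apply: eq_bigl => x; rewrite mem_lcoset mulKg.
have A1 : 1%g \in A by rewrite mem_conjg conj1g.
have AV : (A^-1)%g = A by rewrite /A -{2}SV; apply/setP => x; rewrite inE !mem_conjg inE conjVg.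
have cA : #|A| = #|S| by rewrite cardJg.
have A12 : (#|(A ^+ 12)%g| <= M ^ 464 * #|A|)%N.
  have -> : (A ^+ 12 = (S ^+ 12) :^ z)%g.
    rewrite /A; elim: 12%N => [|n IH]; first by rewrite !expg0 conjs1g.
    by rewrite !expgS conjsMg IH.
  by rewrite cardJg cA -(ler_nat R) natrM natrX.
have KM e : (e <= 2400)%N -> M%:R ^+ e <= K.
  by move=> he; apply: le_trans MK; apply: ler_weXn2l.
pose w x := mu (b * x)%g / m.
have sp : spread A w.
  split=> [x||H g pH].
  - by rewrite divr_ge0 // ltW.
  - by rewrite -mulr_suml -mE divff // gt_eqF.
  rewrite /mass -mulr_suml ler_pdivrMr //.
  apply: (@le_trans _ _ K^-1).
    apply: le_trans (hG H (b * g)%g pH).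
    rewrite /measure_of [leRHS](reindex_inj (mulgI b)) /=.
    rewrite big_mkcond [leRHS]big_mkcond; apply: ler_sum => x _.
    have -> : (b * x \in (b * g) *: H)%g = (x \in g *: H)%g.
      by rewrite !mem_lcoset invMg -mulgA mulKg.
    by case: (x \in A) => //=; case: ifP.
  (* Normalising costs at most [M ^+ 21], and 20 M^21 is at most M^22, hence at most [K]. *)
  apply: (@le_trans _ _ (1 / 20 * M%:R ^- 21)); last by rewrite ler_wpM2l ?divr_ge0.
  rewrite div1r -invfM lef_pV2 ?posrE ?mulr_gt0 ?exprn_gt0 //.
  have h20 : 20 <= M%:R :> R.
    by rewrite (ler_nat _ 20) (leq_trans _ M20) // (@leq_trans (2 ^ 5)%N) // leq_exp2l.
  apply: le_trans (KM 22%N isT); rewrite (exprS _ 21); apply: ler_wpM2r h20.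
  by rewrite exprn_ge0 // ltW.
have [small|big] := growth (SL2_coord p) (two_neq0_Fp pp oddp) A1 AV A12 sp.
  (* A small [A] cannot carry mass M^-21 when points have mass at most 1/K: that would give [K] at
     most M^(2322 + 21), less than M^2400. *)
  exfalso; have mK : m <= #|A|%:R / K.
    by rewrite mE mulr_natl -sumr_const; apply: ler_sum => x _; apply: hinf.
  have cardA : #|A|%:R <= M%:R ^+ 2322 :> R.
    rewrite -natrX ler_nat; apply: leq_trans small _.
    rewrite -expnM (expnD M 2 2320) leq_mul2r; apply/orP; right.
    by apply: (@leq_trans ((2 ^ 20) ^ 2)%N); [rewrite -expnM leq_exp2l | rewrite leq_exp2r].
  have : M%:R ^- 21 <= M%:R ^+ 2322 / K.
    by apply: le_trans mA (le_trans mK _); rewrite ler_wpM2r // invr_ge0 ltW.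
  rewrite ler_pdivlMr // ler_pdivrMl ?exprn_gt0 // -exprD => /(le_trans MK).
  by rewrite ler_eXn2l // (lt_le_trans _ M20R) // -natrX ltr1n (ltn_exp2l 0).
(* The exponent 1161 is half of 464 * 5 + 2, the 2 covering the factor 2^19; and 1161 + 422 is below
   1600. *)
have bigR : #|SL2 p|%:R <= M%:R ^+ 1161 * #|A|%:R :> R.
  rewrite -natrX -natrM ler_nat -(@leq_exp2r _ _ 2) //; apply: leq_trans big _.
  rewrite expnMn leq_mul2r; apply/orP; right.
  rewrite -!expnM (expnD M 2 2320) leq_mul2r; apply/orP; right.
  by apply: (@leq_trans ((2 ^ 20) ^ 2)%N); [rewrite -expnM leq_exp2l | rewrite leq_exp2r].
have G0 : 0 < #|SL2 p|%:R :> R by rewrite ltr0n; apply/card_gt0P; exists 1%g.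
rewrite ler_pdivlMr // mulrC.
have q0 : 0 <= l2norm_sq f by apply: sumr_ge0 => x _; apply: sqr_ge0.
apply: le_trans (ler_wpM2r q0 bigR) _.
rewrite cA -mulrA; apply: le_trans (ler_wpM2l _ Sq) _; first by rewrite exprn_ge0 // ltW.
by rewrite -exprD ler_weXn2l.
Qed.

End Flattening.

(** * Deviation from the uniform measure *)

Section Deviation.
Variables (R : realType) (gT : finGroupType).
Implicit Types f mu : gT -> R.

Local Notation n := (#|gT|%:R : R).

Lemma card_gT_gt0 : 0 < n.
Proof. by rewrite ltr0n; apply/card_gt0P; exists 1%g. Qed.

Lemma l2norm_sq_center f : \sum_x f x = 1 ->
  l2norm_sq (fun x => f x - n^-1) = l2norm_sq f - n^-1.
Proof.
move=> sf; have n0 := card_gT_gt0; rewrite /l2norm_sq.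
transitivity (\sum_x f x ^+ 2 - 2 * n^-1 * (\sum_x f x) + \sum_(x : gT) n^-1 ^+ 2).
  by rewrite mulr_sumr -sumrB -big_split /=; apply: eq_bigr => x _; ring.
rewrite sf sumr_const -[_ *+ _]mulr_natr mulr1.
by field; rewrite gt_eqF.
Qed.

Lemma conv_center f x : \sum_y f y = 1 ->
  conv (fun y => f y - n^-1) (fun y => f y - n^-1) x = conv f f x - n^-1.
Proof.
move=> sf; have n0 := card_gT_gt0; rewrite /conv.
transitivity (\sum_y f y * f (y^-1 * x)%g - n^-1 * (\sum_y f y)
   - n^-1 * (\sum_y f (y^-1 * x)%g) + \sum_(y : gT) n^-1 ^+ 2).
  by rewrite !mulr_sumr -!sumrB -big_split /=; apply: eq_bigr => y _; ring.
have -> : \sum_y f (y^-1 * x)%g = 1.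
  by rewrite (sum_inv (fun y => f (y * x)%g)) (sum_translater f).
rewrite sf sumr_const -[_ *+ _]mulr_natr.
by field; rewrite gt_eqF.
Qed.

Definition deviation f : R := l2norm_sq f - n^-1.

Lemma deviation_ge0 f : \sum_x f x = 1 -> 0 <= deviation f.
Proof.
move=> sf; rewrite /deviation -l2norm_sq_center //.
by apply: sumr_ge0 => x _; apply: sqr_ge0.
Qed.

(** Doubling never increases the deviation; this serves where [K] is too small for any gain. *)
Lemma deviation_conv_le f : is_prob f -> deviation (conv f f) <= deviation f.
Proof.
move=> pf; rewrite lerD2r /l2norm_sq.
have F0 x : 0 <= conv f f x by apply: conv_ge0 => y; case/andP: (proj1 pf y).
apply: (@le_trans _ _ (\sum_x l2norm_sq f * conv f f x)).
  by apply: ler_sum => x _; rewrite expr2 ler_wpM2r // conv_sym_le_l2.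
by rewrite -mulr_sumr sum_conv (proj2 pf) !mulr1.
Qed.

End Deviation.

Lemma deviation_quasirandom (R : realType) (p : nat) (f : SL2 p -> R) :
  prime p -> odd p -> is_prob f ->
  deviation (conv f f) <= 9 * #|SL2 p|%:R / p%:R * deviation f ^+ 2.
Proof.
move=> pp op [_ sf].
have n0 := card_gT_gt0 R (SL2 p).
have m0 : \sum_x (f x - #|SL2 p|%:R^-1) = 0.
  rewrite sumrB sf sumr_const -[_ *+ _]mulr_natr mulVf ?subrr //.
  by rewrite gt_eqF.
have := quasirandom pp (SL2_coord p) op m0.
rewrite l2norm_sq_center // -/(deviation f); apply: le_trans.
rewrite /deviation -l2norm_sq_center ?sum_conv ?sf ?mulr1 //.
by apply: ler_sum => x _; rewrite conv_center.
Qed.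

(** * Gain at each doubling *)

Section Step.
Variables (R : realType) (p : nat) (mu : SL2 p -> R) (K : R).
Hypothesis pp : prime p.
Hypothesis oddp : odd p.
Hypothesis pmu : is_prob mu.
Hypothesis smu : symmetric_measure mu.
Hypothesis hG : forall (Gamma : {group SL2 p}) (g : SL2 p), Gamma \proper [set: SL2 p] ->
  measure_of mu (g *: Gamma)%g <= K^-1.
Hypothesis hinf : forall g, mu g <= K^-1.

(** In the nearly flat case of [flattening] the deviation is at most M^1600 / |G|, so
    quasirandomness multiplies it by at most 9 M^1600 / p, and [p] is at least M^1602. *)
Lemma deviation_step (M : nat) k : (2 ^ 20 <= M)%N -> M%:R ^+ 6500 <= K ->
  deviation (conv_dbl mu k.+1) <= deviation (conv_dbl mu k) / M%:R.
Proof.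
move=> M20 MK; set f := conv_dbl mu k.
have M0 : (0 < M)%N by apply: leq_trans M20; rewrite expn_gt0.
have MR0 : 0 < M%:R :> R by rewrite ltr0n.
have MR1 : 1 <= M%:R :> R by rewrite ler1n.
have K0 : 0 < K by apply: lt_le_trans MK; rewrite exprn_gt0.
have n0 := card_gT_gt0 R (SL2 p).
have pf : is_prob f by apply: conv_dbl_prob.
have d0 : 0 <= deviation f by apply: deviation_ge0; case: pf.
have MK' : M%:R ^+ 2400 <= K by apply: le_trans MK; apply: ler_weXn2l.
case: (flattening pp oddp k pmu smu M20 MK' hG hinf) => h.
  rewrite /deviation mulrBl; apply: lerB => //.
  by rewrite ler_pdivrMr // ler_peMr // invr_ge0 ltW.
(* Points of mass at most 1/K need at least [K] of them to reach total mass 1. With |G| at most p^4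
   this gives M^(4 * 1602) at most p^4. *)
have KN : K <= #|SL2 p|%:R.
  have : 1 <= #|SL2 p|%:R / K.
    by rewrite -[leLHS](proj2 pmu) mulr_natl -sumr_const; apply: ler_sum => x _; apply: hinf.
  by rewrite ler_pdivlMr // mul1r.
have p0 : 0 < p%:R :> R by rewrite ltr0n prime_gt0.
have bigp : M%:R ^+ 1602 <= p%:R :> R.
  rewrite -(@ler_pXn2r _ 4) ?nnegrE ?exprn_ge0 ?(ltW MR0) ?(ltW p0) // -exprM.
  apply: (@le_trans _ _ K); first by apply: le_trans MK; apply: ler_weXn2l.
  apply: le_trans KN _; rewrite -natrX ler_nat.
  by have := card_sl2_le (SL2_coord p); rewrite card_Fp.
apply: le_trans (deviation_quasirandom pp oddp pf) _.
rewrite expr2 mulrA [leRHS]mulrC ler_wpM2r //.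
have dle : deviation f <= M%:R ^+ 1600 / #|SL2 p|%:R.
  by apply: le_trans h; rewrite gerBl invr_ge0 ltW.
apply: (@le_trans _ _ (9 * #|SL2 p|%:R / p%:R * (M%:R ^+ 1600 / #|SL2 p|%:R))).
  by rewrite ler_wpM2l // divr_ge0 ?mulr_ge0 ?(ltW n0) ?(ltW p0).
have -> : 9 * #|SL2 p|%:R / p%:R * (M%:R ^+ 1600 / #|SL2 p|%:R) = 9 * M%:R ^+ 1600 / p%:R :> R.
  by move: (M%:R ^+ 1600) => y; field; rewrite !gt_eqF.
rewrite ler_pdivrMr // ler_pdivlMl // mulrCA -exprS.
apply: le_trans bigp; rewrite (exprS _ 1601) ler_wpM2r ?exprn_ge0 ?(ltW MR0) //.
by rewrite (ler_nat _ 9) (leq_trans _ M20) // (@leq_trans (2 ^ 4)%N) // leq_exp2l.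
Qed.

(** The integer [M] is chosen between y and 2 y; one of the two factors [y ^+ 6500] of [K] absorbs
    2^6500. For [y] at most 2^20 the claimed factor is at least 1. *)
Lemma deviation_step_powR (y : R) k : K = (y ^+ 6500) ^+ 2 -> 1 <= y ->
  deviation (conv_dbl mu k.+1) <= deviation (conv_dbl mu k) * (2 ^+ 20 / y).
Proof.
move=> Ky y1; have y0 : 0 < y by apply: lt_le_trans y1.
have pf : is_prob (conv_dbl mu k) by apply: conv_dbl_prob.
have d0 : 0 <= deviation (conv_dbl mu k) by apply: deviation_ge0; case: pf.
have [ysmall|ybig] := leP y (2 ^+ 20).
  apply: le_trans (deviation_conv_le pf) _.
  by rewrite ler_peMr // ler_pdivlMr // mul1r.
have [M /andP[M1 M2]] : exists M : nat, y <= M%:R <= 2 * y.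
  exists (Num.truncn y).+1; have /andP[h1 h2] := truncn_itv (ltW y0).
  by rewrite ltW //= -natr1; lra.
apply: le_trans (_ : deviation (conv_dbl mu k) / M%:R <= _).
  apply: deviation_step; first by rewrite -(ler_nat R) natrX; lra.
  rewrite Ky; apply: (@le_trans _ _ ((2 * y) ^+ 6500)).
    by rewrite lerXn2r ?nnegrE //; lra.
  rewrite exprMn [leRHS]expr2 ler_wpM2r ?exprn_ge0 ?(ltW y0) //.
  rewrite lerXn2r ?nnegrE ?(ltW y0) // ltW // (le_lt_trans _ ybig) //.
  by rewrite -natrX ler_nat (leq_exp2l 1).
rewrite ler_wpM2l //; apply: (@le_trans _ _ y^-1).
  by rewrite lef_pV2 ?posrE // (lt_le_trans y0).
by rewrite ler_peMl ?invr_ge0 ?(ltW y0) // -natrX ler1n expn_gt0.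
Qed.

End Step.

Theorem theorem45 (R : realType) :
  exists c C : R, [/\ 0 < c, c < 1, 1 < C &
    forall (p : nat) (mu : SL2 p -> R) (K : R),
      prime p -> odd p ->
      is_prob mu -> symmetric_measure mu ->
      1 <= K ->
      (forall (Gamma : {group SL2 p}) (g : SL2 p),
         Gamma \proper [set: SL2 p] ->
         measure_of mu (g *: Gamma)%g <= K^-1) ->
      linfnorm mu <= K^-1 ->
      forall k : nat, k%:R <= K `^ c ->
        0 <= l2norm_sq (conv_pow mu (2 ^ k)) - (#|[set: SL2 p]|%:R)^-1
          <= C ^+ k * K `^ (- (c * k%:R))].
Proof.
(* Half of 1/6500, to leave room for rounding to an integer; 2^20 is the threshold on [M] in
   [deviation_step]. *)
exists ((6500 * 2)%:R^-1), (2 ^+ 20); split.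
- by rewrite invr_gt0 ltr0n.
- by rewrite invf_lt1 ?ltr0n // ltr1n.
- by rewrite -natrX ltr1n (ltn_exp2l 0).
move=> p mu K pp op pmu smu K1 hG hinf k _.
have K0 : 0 <= K by apply: le_trans K1.
have hinf' g : mu g <= K^-1 by apply: le_trans hinf; apply: le_bigmax.
rewrite cardsT.
have -> : l2norm_sq (conv_pow mu (2 ^ k)) = l2norm_sq (conv_dbl mu k).
  by apply: eq_bigr => x _; rewrite conv_pow_dbl.
rewrite -/(deviation _) deviation_ge0 /=; last by case: (conv_dbl_prob k pmu).
set y := K `^ (6500 * 2)%:R^-1.
have y1 : 1 <= y by rewrite -(powRr0 K) ler_powR // invr_ge0 ler0n.
have Ky : K = (y ^+ 6500) ^+ 2.
  by rewrite -exprM -powR_mulrn ?powR_ge0 // -powRrM mulVf ?powRr1 // pnatr_eq0.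
have -> : K `^ (- ((6500 * 2)%:R^-1 * k%:R)) = (y^-1) ^+ k.
  by rewrite -mulNr powRrM powR_mulrn ?powR_ge0 // powRN.
(* The base case holds because values at most 1 give a squared norm at most the total mass 1. *)
rewrite -exprMn; elim: k => [|k IH].
  rewrite expr0 /deviation lerBlDr.
  apply: (@le_trans _ _ 1); last by rewrite lerDl invr_ge0 ler0n.
  rewrite -[leRHS](proj2 pmu); apply: ler_sum => x _.
  by have /andP[h0 h1] := proj1 pmu x; rewrite expr2 ler_piMl.
apply: le_trans (deviation_step_powR pp op pmu smu hG hinf' k Ky y1) _.
rewrite [(2 ^+ 20 / y) ^+ k.+1]exprSr ler_wpM2r // mulr_ge0 ?exprn_ge0 // invr_ge0 (le_trans _ y1) //.
Qed.
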